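(* Let $\gamma=[0;1,1,c_3,1,c_5,1,c_7,1,\dots]$, i.e. $\gamma$ has infinite continued fraction expansion $[c_0;c_1,c_2,\dots]$ with $c_0=0$, $c_n=1$ for $n$ even $\ge2$ and for $n=1$, and $c_{2n+1}\in\{1,2\}$ for all $n\in\mathbb{N}$; let $p_n/q_n$ be its convergents. Let $d\ge2$, $a>0$, and consider the $d$-dimensional hyperrectangular lattice graph with edge lengths $a_1=\gamma a$ and $a_j=a$ for $j=2,\dots,d$, with Hamiltonian $H$ having $\delta$ couplings of strength $\alpha\in\left[\frac{4\pi(2-\sqrt{3})}{a},\frac{2\pi^2}{5a}\right]$ at all vertices. Then $k^2$ is the lower endpoint of a spectral gap of $H$ if and only if $k^2=\left(\frac{q_{2n}\pi}{a}\right)^2$ for some $n$ with $c_{2n+1}=2$.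
   Context: $[c_0;c_1,c_2,\dots]$ denotes the continued fraction $c_0+\cfrac{1}{c_1+\cfrac{1}{c_2+\cdots}}$; the $n$-th convergent is $p_n/q_n=[c_0;c_1,\dots,c_n]$ in lowest terms with $q_n>0$. The lattice graph $\Gamma$ has vertex set $\{(n_1a_1,\dots,n_da_d): n_i\in\mathbb{Z}\}\subset\mathbb{R}^d$, with an edge (segment of length $a_j$) between two vertices iff they differ by $a_je_j$ for some $j$. $H$ is the self-adjoint operator on $L^2(\Gamma)$ acting as $\psi\mapsto-\psi''$ on each edge, with domain consisting of functions $H^2$ on each edge satisfying at every vertex $v$: $\psi$ is continuous at $v$, and the sum over the $2d$ incident edges of the derivatives at $v$ taken in the direction away from $v$ equals $\alpha\psi(v)$. A spectral gap is an open interval $(E_1,E_2)$ with $E_1<E_2$, $E_1,E_2\in\sigma(H)$ and $(E_1,E_2)\cap\sigma(H)=\emptyset$. *)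

(* Defs.v *)
From HB Require Import structures.
From mathcomp Require Import all_boot all_order all_algebra.
From mathcomp Require Import all_classical all_reals all_analysis.
Set Implicit Arguments. Unset Strict Implicit. Unset Printing Implicit Defensive.
Import Order.TTheory GRing.Theory Num.Theory.
Import numFieldNormedType.Exports.
Local Open Scope classical_set_scope.
Local Open Scope ring_scope.

Fixpoint cf_fin (c : nat -> nat) (i k : nat) : rat :=
  match k with
  | 0 => (c i)%:R
  | k'.+1 => (c i)%:R + (cf_fin c i.+1 k')^-1
  end.

Definition convergent (c : nat -> nat) (n : nat) : rat := cf_fin c 0 n.

Definition cf_q (c : nat -> nat) (n : nat) : int := denq (convergent c n).

Definition has_cf_expansion {R : realType} (gamma : R) (c : nat -> nat) : Prop :=
  (forall n, (0 < n)%N -> (0 < c n)%N) /\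
  ((fun n => ratr (convergent c n) : R) @ \oo --> gamma).

(* vertices n = (n_1,...,n_d) in Z^d (vertex (n_1 a_1, ..., n_d a_d)) *)
Definition vertex (d : nat) := {ffun 'I_d -> int}.
(* edge (v, j) : the segment from v to v + e_j, parametrised by [0, a_j],
   with x = 0 at v and x = a_j at v + e_j *)
Definition edge (d : nat) := (vertex d * 'I_d)%type.

Definition vshift d (v : vertex d) (j : 'I_d) (s : int) : vertex d :=
  [ffun i => v i + (if i == j then s else 0)].

Section Graph.
Context {R : realType}.
Local Notation mu := (@lebesgue_measure R).

Definition L2_on (l : R) (f : R -> R) : Prop :=
  measurable_fun `[0%R, l] f /\
  (\int[mu]_(x in `[0%R, l]) ((f x) ^+ 2)%:E < +oo)%E.

(* g in L^2(Gamma) (one real component), where len j = a_j *)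
Definition L2_graph d (len : 'I_d -> R) (g : edge d -> R -> R) : Prop :=
  (forall e : edge d, measurable_fun `[0%R, len e.2] (g e)) /\
  (\esum_(e in [set: edge d])
      \int[mu]_(x in `[0%R, len e.2]) ((g e x) ^+ 2)%:E < +oo)%E.

(* u in H^2(0,l) with first derivative u1 and second derivative u2:
   u2 in L^2(0,l), u1 and u absolutely continuous with u1' = u2, u' = u1 *)
Definition H2_rep (l : R) (u u1 u2 : R -> R) : Prop :=
  L2_on l u2 /\
  forall x, `[0%R, l]%classic x ->
    u1 x = u1 0 + Rintegral mu `[0%R, x] u2 /\
    u x = u 0 + Rintegral mu `[0%R, x] u1.

(* u (one real component) is in the domain of H and (H - E) u = f.
   At vertex v the incident edges are (v, j) (endpoint x = 0, outward
   derivative u1(0)) and (v - e_j, j) (endpoint x = a_j, outward derivative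
   -u1(a_j)). *)
Definition solves d (len : 'I_d -> R) (alpha E : R)
    (u f : edge d -> R -> R) : Prop :=
  exists u1 u2 : edge d -> R -> R,
    (forall e, H2_rep (len e.2) (u e) (u1 e) (u2 e)) /\
    L2_graph len u /\ L2_graph len u2 /\
    (forall v : vertex d, exists val : R,
        (forall j, u (v, j) 0 = val /\ u (vshift v j (-1), j) (len j) = val) /\
        \sum_(j < d) (u1 (v, j) 0 - u1 (vshift v j (-1), j) (len j))
          = alpha * val) /\
    (forall e, {ae mu, forall x, `[0%R, len e.2]%classic x ->
        - u2 e x - E * u e x = f e x}).

Definition L2_eq d (len : 'I_d -> R) (u w : edge d -> R -> R) : Prop :=
  forall e, {ae mu, forall x, `[0%R, len e.2]%classic x -> u e x = w e x}.

(* E (real) is in the resolvent set of H on the complex Hilbert space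
   L^2(Gamma): every complex f = f1 + i f2 in L^2 has a unique preimage
   psi = u + i w in the domain with (H - E) psi = f.  (Since alpha and E are
   real, the problem splits into real and imaginary parts.)  Bounded inverse
   is automatic since H is closed. *)
Definition resolvent d (len : 'I_d -> R) (alpha E : R) : Prop :=
  forall f1 f2 : edge d -> R -> R, L2_graph len f1 -> L2_graph len f2 ->
    (exists u w, solves len alpha E u f1 /\ solves len alpha E w f2) /\
    (forall u w u' w', solves len alpha E u f1 -> solves len alpha E w f2 ->
       solves len alpha E u' f1 -> solves len alpha E w' f2 ->
       L2_eq len u u' /\ L2_eq len w w').

Definition spectrum d (len : 'I_d -> R) (alpha E : R) : Prop :=
  ~ resolvent len alpha E.

Definition spectral_gap d (len : 'I_d -> R) (alpha E1 E2 : R) : Prop :=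
  E1 < E2 /\ spectrum len alpha E1 /\ spectrum len alpha E2 /\
  (forall E, E1 < E < E2 -> ~ spectrum len alpha E).

Definition rect_len d (gamma a : R) (j : 'I_d) : R :=
  if val j == 0%N then gamma * a else a.

End Graph.

(* Main.v *)
Require Import Defs.
From HB Require Import structures.
From mathcomp Require Import all_boot all_order all_algebra.
From mathcomp Require Import all_classical all_reals all_analysis.
From mathcomp Require Import measurable_realfun.
From mathcomp Require Import ring lra zify.
Import Order.TTheory GRing.Theory Num.Theory.
Import numFieldNormedType.Exports.
Local Open Scope classical_set_scope.
Local Open Scope ring_scope.

(* Write k = pi y / a and S_j = sin(k a_j) / k.  On an edge of length a_j with S_j <> 0 a
   solution of -u'' - k^2 u = f is determined by its vertex values, so (H - k^2) u = f
   becomes a translation invariant nearest neighbour equation on Z^d with weights 1 / S_j.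
   If the diagonal dominates, a Neumann series solves it in l^2.  If not, some plane wave
   lies in the kernel of the symbol, and testing against that wave times exponentially
   decaying cutoffs gives a source without l^2 solution.  Hence, when neither y nor
   gamma y is an integer, k^2 is in the spectrum iff
     y (tan(pi/2 {gamma y}) + (d - 1) tan(pi/2 {y})) >= A,   A = alpha a / (2 pi),
   while integers y > 0 are always in the spectrum.
   The left side increases between consecutive integers of y and gamma y, so a gap can open
   only at such a point, and only if the left side is below A there.  Since A <= pi/5, at
   y = q this forces q (q gamma - p) <= 2/5 with p = [gamma q], which singles out the even
   convergents followed by a partial quotient 2; at gamma y = p, with q = [y], it would give
   p (p - q gamma) < 2/5 gamma^2, contradicting q (p - q gamma) >= 1/3 and gamma <= 5/8.
   Conversely those convergents satisfy q (q gamma - p) < 1/3, and convexity of tan with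
   tan(pi/12) = 2 - sqrt 3 <= A/2 gives the strict inequality at y = q. *)

(** * Continued fractions *)

(** [resolvent] asks for unique solvability and says nothing about the size of the inverse, so a
    sequence of approximate eigenfunctions would contradict it only through the closed graph
    theorem. Membership in the spectrum is therefore always shown by one explicit source that has no
    square summable response: inside a band it superposes the cutoffs of all scales at once, and at
    an integer [y] it sits on a single edge.

    The numbers 2/5 and 1/3 come from one identity. For w = q_{2n} (q_{2n} gamma - p_{2n}), the
    inverse 1/w is q_{2n+1} / q_{2n} plus the ratio of two consecutive errors. The first summand is
    c_{2n+1} plus a fraction, and both the fraction and the error ratio are at most 74/100; if
    c_{2n+1} = 2 they are at least 1/2 and 3/5. Hence w > 2/5 when c_{2n+1} = 1 and w <= 10/31 when
    c_{2n+1} = 2. The window for [alpha] places the threshold for w between these two values. *)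

Section Convergents.
Implicit Types c : nat -> nat.

Fixpoint cf_num c (n : nat) : nat :=
  match n with
  | 0 => c 0%N
  | m.+1 => match m with
            | 0 => (c 1 * c 0 + 1)%N
            | k.+1 => (c n * cf_num c m + cf_num c k)%N
            end
  end.

Fixpoint cf_den c (n : nat) : nat :=
  match n with
  | 0 => 1%N
  | m.+1 => match m with
            | 0 => c 1%N
            | k.+1 => (c n * cf_den c m + cf_den c k)%N
            end
  end.

Lemma cf_numSS c n : cf_num c n.+2 = (c n.+2 * cf_num c n.+1 + cf_num c n)%N.
Proof. by []. Qed.

Lemma cf_denSS c n : cf_den c n.+2 = (c n.+2 * cf_den c n.+1 + cf_den c n)%N.
Proof. by []. Qed.

(** Peels off the front partial quotient, as [cf_fin] does, whereas [cf_num] and [cf_den] recurse at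
    the back; this is the bridge for the induction in [cf_finE]. *)
Lemma cf_front c n :
  cf_num c n.+1 = (c 0 * cf_num (c \o succn) n + cf_den (c \o succn) n)%N /\
  cf_den c n.+1 = cf_num (c \o succn) n.
Proof.
elim/ltn_ind: n => -[_|[_|n IH]].
- by split; rewrite /= /comp; lia.
- by split; rewrite /= /comp; lia.
have [p1 q1] := IH n.+1 (ltnSn _); have [p0 q0] := IH n (ltnW (ltnSn _)).
by rewrite (cf_numSS c) (cf_denSS c) p1 q1 p0 q0 (cf_numSS (_ \o _))
  (cf_denSS (_ \o _)) /=; split; lia.
Qed.

Lemma cf_den_gt0 c n : (forall i, (0 < i)%N -> (0 < c i)%N) -> (0 < cf_den c n)%N.
Proof.
move=> c0; elim/ltn_ind: n => -[//|[_|n IH]]; first exact: c0.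
by rewrite cf_denSS addn_gt0 IH// orbT.
Qed.

Lemma cf_finE c i n : (forall j, (i < j)%N -> (0 < c j)%N) ->
  let c' := fun j => c (i + j)%N in
  cf_fin c i n = (cf_num c' n)%:R / (cf_den c' n)%:R.
Proof.
elim: n i => [|n IH] i c0 c'; first by rewrite /= /c' addn0 divr1.
have c'0 j : (0 < j)%N -> (0 < c' j)%N by move=> j0; apply: c0; lia.
have [-> ->] := cf_front c' n.
have d0 : (0 < cf_den c' n.+1)%N by exact: cf_den_gt0.
rewrite /= IH; last by move=> j ij; apply: c0; lia.
have -> : (fun j => c (i.+1 + j)%N) = c' \o succn.
  by apply/funext => j; rewrite /c' /= addSnnS.
rewrite (cf_front c' n).2 in d0.
rewrite natrD natrM invf_div mulrDl mulfK ?pnatr_eq0 -?lt0n//.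
by rewrite /c' addn0.
Qed.

Lemma convergentE c n : (forall j, (0 < j)%N -> (0 < c j)%N) ->
  convergent c n = (cf_num c n)%:R / (cf_den c n)%:R.
Proof. by move=> c0; rewrite /convergent cf_finE. Qed.

(** As [e] is a natural number, the sign depends on [n] alone: all later convergents lie on one side
    of the [n]-th, which fixes the sign of its error in the limit. The clause for [k = 1] is the
    determinant identity. *)
Lemma cf_cross c n k : exists2 e : nat,
  (cf_num c (n + k)%N)%:Z * (cf_den c n)%:Z
    - (cf_num c n)%:Z * (cf_den c (n + k)%N)%:Z = (-1) ^+ n * e%:Z
  & (k = 1 -> e = 1)%N.
Proof.
have det m : (cf_num c m.+1)%:Z * (cf_den c m)%:Z
    - (cf_num c m)%:Z * (cf_den c m.+1)%:Z = (-1) ^+ m.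
  elim: m => [|m IH]; first by rewrite /=; lia.
  rewrite cf_numSS cf_denSS exprS -IH !PoszD !PoszM.
  ring.
elim/ltn_ind: k => -[_|[_|k IH]].
- by exists 0%N => //; rewrite addn0; lia.
- by exists 1%N => //; rewrite addn1 det mulr1.
have [e1 h1 _] := IH k.+1 (ltnSn _); have [e0 h0 _] := IH k (ltnW (ltnSn _)).
exists (c (n + k.+2)%N * e1 + e0)%N => //.
rewrite addnS in h1; rewrite !addnS cf_numSS cf_denSS !PoszD !PoszM.
rewrite [RHS]mulrDr [in RHS]mulrCA -h1 -h0.
ring.
Qed.

Lemma cf_det c n : (cf_num c n.+1)%:Z * (cf_den c n)%:Z
    - (cf_num c n)%:Z * (cf_den c n.+1)%:Z = (-1) ^+ n.
Proof. by have [e + e1] := cf_cross c n 1; rewrite e1// addn1 mulr1. Qed.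

Lemma cf_coprime c n : coprime (cf_num c n) (cf_den c n).
Proof.
rewrite /coprime -dvdn1.
suff : ((gcdn (cf_num c n) (cf_den c n))%:Z %| 1)%Z by rewrite dvdzE.
have e : 1%Z = (-1) ^+ n * ((cf_num c n.+1)%:Z * (cf_den c n)%:Z
    - (cf_num c n)%:Z * (cf_den c n.+1)%:Z).
  by rewrite cf_det -exprD addnn -mul2n exprM sqrrN expr1n.
rewrite e dvdz_mull// rpredB//.
  by rewrite dvdz_mull// dvdzE/= dvdn_gcdr.
by rewrite dvdz_mulr// dvdzE/= dvdn_gcdl.
Qed.

Lemma cf_qE c n : (forall j, (0 < j)%N -> (0 < c j)%N) ->
  cf_q c n = (cf_den c n)%:Z.
Proof.
move=> c0; rewrite /cf_q convergentE//.
have d0 : (0 < cf_den c n)%N by exact: cf_den_gt0.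
have := @coprimeq_den (cf_num c n)%:Z (cf_den c n)%:Z.
rewrite /= cf_coprime => /(_ isT).
rewrite -!pmulrn ; case: eqP => [|_ ->//].
by move: d0; case: (cf_den c n).
Qed.

End Convergents.

Section Approximation.
Context {R : realType} {c : nat -> nat} {gamma : R}.
Hypothesis cf_gamma : has_cf_expansion gamma c.

Let c_gt0 : forall j, (0 < j)%N -> (0 < c j)%N := cf_gamma.1.

Local Notation p n := ((cf_num c n)%:R : R).
Local Notation q n := ((cf_den c n)%:R : R).

(** The sign makes this the absolute error, and turns the recurrence of the errors into one with
    nonnegative terms. *)
Definition cf_err n : R := (-1) ^+ n * (q n * gamma - p n).

Let q_gt0 n : 0 < q n.
Proof. by rewrite ltr0n cf_den_gt0. Qed.

Let signK n : (-1) ^+ n * (-1) ^+ n = 1 :> R.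
Proof. by rewrite -exprD addnn -mul2n exprM sqrrN !expr1n. Qed.

Lemma cf_det_real n : p n.+1 * q n - p n * q n.+1 = (-1) ^+ n.
Proof.
have /(congr1 (fun z : int => z%:~R : R)) := cf_det c n.
by rewrite rmorphB !rmorphM/= rmorphXn/= rmorphN1 !pmulrn.
Qed.

(** Replace [gamma] by a later convergent, where [cf_cross] gives the sign, and pass to the
    limit. *)
Lemma cf_err_ge0 n : 0 <= cf_err n.
Proof.
have cvgx : (fun m => p (n + m)%N / q (n + m)%N) @ \oo --> gamma.
  have := cf_gamma.2; rewrite -(cvg_shiftn n)/=; apply: cvg_trans.
  apply: near_eq_cvg; near=> m.
  by rewrite convergentE// fmorph_div/= !ratr_nat addnC.
have : (fun m => (-1) ^+ n * (q n * (p (n + m)%N / q (n + m)%N) - p n)) @ \oo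
    --> cf_err n.
  apply: cvgM; first exact: cvg_cst.
  by apply: cvgB; [apply: cvgM => //; exact: cvg_cst|exact: cvg_cst].
move=> /(@cvg_lim _ _) <-//; apply: limr_ge.
  apply: is_cvgM; first exact: is_cvg_cst.
  apply: is_cvgB; last exact: is_cvg_cst.
  by apply: is_cvgM; [exact: is_cvg_cst|apply/cvg_ex; exists gamma].
near=> m; have [e + _] := cf_cross c n m.
move=> /(congr1 (fun z : int => z%:~R : R)).
rewrite rmorphB !rmorphM/= rmorphXn/= rmorphN1 -!pmulrn => h.
have qm := q_gt0 (n + m)%N; have qn0 : q (n + m)%N != 0 by rewrite gt_eqF.
have -> : q n * (p (n + m)%N / q (n + m)%N) - p n = (-1) ^+ n * e%:R / q (n + m)%N.
  by rewrite -h; field.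
by rewrite !mulrA signK mul1r divr_ge0.
Unshelve. all: by end_near. Qed.

Lemma cf_errSS n : cf_err n = (c n.+2)%:R * cf_err n.+1 + cf_err n.+2.
Proof.
rewrite /cf_err cf_numSS cf_denSS !natrD !natrM !exprS.
ring.
Qed.

Lemma cf_err_den n : q n.+1 * cf_err n + q n * cf_err n.+1 = 1.
Proof.
rewrite -[RHS](signK n) -[X in _ = _ * X](cf_det_real n) /cf_err exprS.
ring.
Qed.

(** If one error vanished, the recurrence with nonnegative terms would make the next one vanish too,
    against [cf_err_den]. *)
Lemma cf_err_gt0 n : 0 < cf_err n.
Proof.
rewrite lt_neqAle cf_err_ge0 andbT eq_sym; apply/eqP => e0.
have := cf_errSS n; rewrite e0 => h.
have h1 := cf_err_ge0 n.+1; have h2 := cf_err_ge0 n.+2.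
have c1 : 1 <= (c n.+2)%:R :> R by rewrite ler1n c_gt0.
have e1 : cf_err n.+1 = 0 by nra.
by have := cf_err_den n; rewrite e0 e1 !mulr0 addr0 => /eqP; rewrite eq_sym oner_eq0.
Qed.

(* Cramer's rule: consecutive convergents form a basis of the integer lattice. *)
Lemma cf_basis n (s t : nat) : exists x y : int,
  [/\ s%:R = x%:~R * q n + y%:~R * q n.+1,
      t%:R = x%:~R * p n + y%:~R * p n.+1 &
      (-1) ^+ n * (s%:R * gamma - t%:R) = x%:~R * cf_err n - y%:~R * cf_err n.+1].
Proof.
pose P m := (cf_num c m)%:Z; pose Q m := (cf_den c m)%:Z.
exists ((-1) ^+ n * (s%:Z * P n.+1 - t%:Z * Q n.+1)),
       ((-1) ^+ n * (t%:Z * Q n - s%:Z * P n)).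
rewrite !rmorphM/= !rmorphXn/= !rmorphN1 !rmorphB/= !rmorphM/= /P /Q -!pmulrn.
have d : 1 = (-1) ^+ n * (p n.+1 * q n - p n * q n.+1) by rewrite cf_det_real signK.
split.
- rewrite -[LHS]mulr1 [X in _ * X = _]d; ring.
- rewrite -[LHS]mulr1 [X in _ * X = _]d; ring.
- rewrite /cf_err exprS -[LHS]mulr1 [X in _ * X = _]d; ring.
Qed.

End Approximation.

(** * Approximation constants forced by the pattern of partial quotients *)

Section Pattern.
Context {R : realType} {c : nat -> nat} {gamma : R}.
Hypothesis c0 : c 0%N = 0%N.
Hypothesis c1 : c 1%N = 1%N.
Hypothesis c_even : forall n, (1 <= n)%N -> c (2 * n)%N = 1%N.
Hypothesis c_odd : forall n, c (2 * n).+1 = 1%N \/ c (2 * n).+1 = 2%N.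
Hypothesis cf_gamma : has_cf_expansion gamma c.

Local Notation p n := ((cf_num c n)%:R : R).
Local Notation q n := ((cf_den c n)%:R : R).
Local Notation err := (@cf_err R c gamma).

Let q_gt0 n : 0 < q n.
Proof. by rewrite ltr0n cf_den_gt0// => j; exact: cf_gamma.1. Qed.

Let dblSS n : (2 * n).+2 = (2 * n.+1)%N.
Proof. by rewrite mulnS add2n. Qed.

Let err_even n : err (2 * n) = err (2 * n).+1 + err (2 * n.+1).
Proof. by rewrite cf_errSS dblSS c_even// mul1r. Qed.

Let err_odd n : err (2 * n).+1 =
  (c (2 * n.+1).+1)%:R * err (2 * n.+1) + err (2 * n.+1).+1.
Proof. by rewrite cf_errSS dblSS. Qed.

Let c_oddR n : (c (2 * n).+1)%:R = 1 :> R \/ (c (2 * n).+1)%:R = 2 :> R.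
Proof. by case: (c_odd n) => ->; [left|right]. Qed.

(** For the ratio r_n of the two errors the recurrences give r_n = (c + r_{n+1}) / (c + r_{n+1} + 1)
    with c = c_{2n+3}. One application to 0 < r < 1 gives the range from 1/2 to 3/4, a second one
    the range from 3/5 to 11/15, and 74/100 rounds 11/15 up. *)
Lemma err_ratio n : 3 / 5 * err (2 * n) <= err (2 * n).+1 <= 74 / 100 * err (2 * n).
Proof.
have weak m : 1 / 2 * err (2 * m) < err (2 * m).+1 <= 3 / 4 * err (2 * m).
  have := err_even m; have := err_odd m; have := err_even m.+1.
  have := cf_err_gt0 cf_gamma (2 * m.+1); have := cf_err_gt0 cf_gamma (2 * m).+1.
  have := cf_err_gt0 cf_gamma (2 * m.+1).+1; have := cf_err_gt0 cf_gamma (2 * m.+2).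
  by case: (c_oddR m.+1) => -> *; apply/andP; split; lra.
have /andP[] := weak n.+1; have := err_even n; have := err_odd n.
have := cf_err_gt0 cf_gamma (2 * n.+1).
by case: (c_oddR n.+1) => -> *; apply/andP; split; lra.
Qed.

Let den_even n : q (2 * n.+1) = q (2 * n).+1 + q (2 * n).
Proof. by rewrite -dblSS cf_denSS dblSS c_even// mul1n natrD. Qed.

Let den_odd n : q (2 * n.+1).+1 = (c (2 * n.+1).+1)%:R * q (2 * n.+1) + q (2 * n).+1.
Proof. by rewrite -dblSS cf_denSS natrD natrM. Qed.

Lemma den_le n : q (2 * n) <= q (2 * n).+1.
Proof.
case: n => [|n]; first by rewrite muln0 /= c1.
have := q_gt0 (2 * n.+1); have := q_gt0 (2 * n).+1.
by rewrite den_odd; case: (c_oddR n.+1) => ->; lra.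
Qed.

(** The ratio x of the denominators becomes c + x / (x + 1) at the next step, and x <= 2.74 gives x
    / (x + 1) < 74/100. *)
Lemma den_ratio n : q (2 * n).+1 <= ((c (2 * n).+1)%:R + 74 / 100) * q (2 * n).
Proof.
elim: n => [|n IH]; first by rewrite muln0 /= c1; lra.
rewrite den_odd mulrDl lerD2l den_even.
have := q_gt0 (2 * n); move: IH.
by case: (c_oddR n) => ->; lra.
Qed.

Lemma den_ratio_lb n : (0 < n)%N ->
  ((c (2 * n).+1)%:R + 1 / 2) * q (2 * n) <= q (2 * n).+1.
Proof.
case: n => // n _; rewrite den_odd mulrDl lerD2l den_even.
by have := den_le n; lra.
Qed.

Lemma den_even_ge n : n.+1%:R <= q (2 * n).
Proof.
elim: n => [|n IH]; first by rewrite muln0.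
rewrite den_even -addn1 natrD addrC lerD//.
apply: le_trans (den_le n); apply: le_trans IH.
by rewrite ler1n.
Qed.

(** By [cf_err_den] the inverse of the product is the ratio of denominators plus the ratio of
    errors, hence at most c + 148/100: below 7/2 for c = 2 and below 5/2 for c = 1. *)
Lemma err_den_even_lb n : 2 / 7 <= q (2 * n) * err (2 * n) /\
  (c (2 * n).+1 = 1%N -> 2 / 5 < q (2 * n) * err (2 * n)).
Proof.
have := @cf_err_den R c gamma (2 * n); have := den_ratio n.
have /andP[_] := err_ratio n.
have := q_gt0 (2 * n); have := cf_err_gt0 cf_gamma (2 * n).
move: (q _) (err _) (q _) (err _) => x e y f e0 x0 fe yx xe.
by have [cE|cE] := c_odd n; rewrite cE in yx *; split => //; nra.
Qed.

(** The same identity with the lower bounds 5/2 and 3/5, whose sum is 31/10. The case [n = 0] is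
    void because c_1 = 1, so the denominator is at least 2. *)
Lemma err_den_even_ub n : c (2 * n).+1 = 2%N ->
  q (2 * n) * err (2 * n) <= 10 / 31 /\ 2 <= q (2 * n).
Proof.
case: n => [|n] cE; first by move: cE; rewrite muln0 c1.
split; last first.
  by apply: le_trans (den_even_ge n.+1); rewrite (ler_nat _ 2).
have := @cf_err_den R c gamma (2 * n.+1); have := den_ratio_lb n.+1 (ltn0Sn n).
have /andP[+ _] := err_ratio n.+1.
have := q_gt0 (2 * n.+1); have := cf_err_gt0 cf_gamma (2 * n.+1).
rewrite cE; move: (q _) (err _) (q _) (err _) => x e y f e0 x0 fe yx xe.
by nra.
Qed.

(** The errors of index 0 and 1 are gamma and 1 - gamma, so [err_ratio] at 0 reads 3/5 gamma <= 1 -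
    gamma. *)
Lemma gamma_bounds : 0 < gamma <= 5 / 8.
Proof.
have e0 : err 0 = gamma by rewrite /cf_err /= c0 expr0; lra.
have := @cf_err_den R c gamma 0; have := cf_err_gt0 cf_gamma 0.
have := err_ratio 0; rewrite muln0 e0 /= c1.
by move=> /andP[] *; apply/andP; split; lra.
Qed.

(** In [cf_err_den] at an odd index the next denominator is at most doubled and the next error is
    not larger, so 1 is at most three times the product. *)
Lemma err_den_odd_lb n : 1 / 3 <= q (2 * n).+1 * err (2 * n).+1.
Proof.
have := @cf_err_den R c gamma (2 * n).+1; rewrite dblSS den_even; have := den_le n.
have := err_odd n; have := q_gt0 (2 * n).+1; have := cf_err_gt0 cf_gamma (2 * n.+1).
have := cf_err_gt0 cf_gamma (2 * n.+1).+1.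
move: (q _) (err _) (q _) (err _) (err _) => x e y f g.
by case: (c_oddR n.+1) => -> *; nra.
Qed.

Let den_bracket (f : nat -> nat) (s : nat) : (f 0 <= s)%N ->
  (forall n, (n <= f n)%N) -> exists n, (f n <= s < f n.+1)%N.
Proof.
move=> f0 fge.
have exP : exists n, (f n <= s)%N by exists 0%N.
have ubP n : (f n <= s)%N -> (n <= s)%N by apply: leq_trans.
case: (ex_maxnP exP ubP) => n fn max_n; exists n; rewrite fn ltnNge.
by apply/negP => /max_n; rewrite ltnn.
Qed.

Let int_cases (x : int) : x%:~R <= 0 :> R \/ x%:~R = 1 :> R \/ 2 <= x%:~R :> R.
Proof.
have [x0|x0] := lerP x 0; first by left; rewrite lerz0.
have [->|x1] := eqVneq x 1; first by right; left.
by right; right; rewrite (ler_int _ 2); lia.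
Qed.

Let int_sign (x : int) : x%:~R <= -1 :> R \/ x%:~R = 0 :> R \/ 1 <= x%:~R :> R.
Proof.
have [x0|x0|->] := ltrgt0P x; last by right; left.
  by right; right; rewrite ler1z; lia.
left; rewrite -[-1](rmorphN1 intr) ler_int; lia.
Qed.

(** A one-sided Legendre criterion. With [s] between q_{2n} and q_{2n+2}, expand it in q_{2n} and
    q_{2n+1}. Coefficients other than (1, 0) violate the bracket or the sign of the error, or give a
    product of at least 4/7; (1, 0) with c_{2n+1} = 1 gives more than 2/5. *)
Lemma lower_approx (s t : nat) : (0 < s)%N -> 0 <= s%:R * gamma - t%:R ->
  s%:R * (s%:R * gamma - t%:R) <= 2 / 5 ->
  exists n, c (2 * n).+1 = 2%N /\ s = cf_den c (2 * n).
Proof.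
move=> s0 d0 sd.
have [||n /andP[]] := den_bracket (fun n => cf_den c (2 * n)) s; first by rewrite muln0.
  by move=> n; have := den_even_ge n; rewrite ler_nat; lia.
rewrite -(ler_nat R) -(ltr_nat R) den_even => ns sn.
have [x [y []]] := @cf_basis R c gamma (2 * n) s t.
rewrite exprM sqrrN !expr1n mul1r => sE _ dE; rewrite dE in d0 sd.
have [lb c1lb] := err_den_even_lb n.
have := cf_err_gt0 cf_gamma (2 * n); have := cf_err_gt0 cf_gamma (2 * n).+1.
have Q0 := q_gt0 (2 * n); have Q01 := den_le n; rewrite sE in ns sn sd.
move=> e1 e0; have [y1|[y0|y1]] := int_sign y.
- have [x1|[x1|x2]] := int_cases x; [exfalso; nra|exfalso; nra|].
  have : 2 * err (2 * n) <= x%:~R * err (2 * n) - y%:~R * err (2 * n).+1 by nra.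
  have D0 : 0 <= 2 * err (2 * n) by lra.
  move=> /(ler_pM (ltW Q0) D0 ns) h.
  by exfalso; have := le_trans h sd; nra.
- rewrite y0 !mul0r addr0 subr0 in sE ns sn sd.
  have [x1|[x1|x2]] := int_cases x; [exfalso; nra| |].
    exists n; rewrite x1 !mul1r in sE sd; split; last by apply/eqP; rewrite -(eqr_nat R) sE.
    by case: (c_odd n) => // /c1lb h; exfalso; lra.
  have xQ : 2 * q (2 * n) <= x%:~R * q (2 * n) by nra.
  have xe : 2 * err (2 * n) <= x%:~R * err (2 * n) by nra.
  have Q2 : 0 <= 2 * q (2 * n) by lra.
  have D0 : 0 <= 2 * err (2 * n) by lra.
  have h := ler_pM Q2 D0 xQ xe.
  by exfalso; have := le_trans h sd; nra.
- by have [x1|[x1|x2]] := int_cases x; exfalso; nra.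
Qed.

(** The same expansion between q_{2n+1} and q_{2n+3}. The error is at least that of q_{2n+1}, except
    possibly for [y = 1] with c_{2n+3} = 2, the intermediate convergent: there it is still at least
    half of it, while [s] is at least 2 q_{2n+1}. *)
Lemma upper_approx (s t : nat) : (0 < s)%N -> 0 < t%:R - s%:R * gamma ->
  1 / 3 <= s%:R * (t%:R - s%:R * gamma).
Proof.
move=> s0 d0.
have [||n /andP[]] := den_bracket (fun n => cf_den c (2 * n).+1) s.
- by rewrite muln0 /= c1.
- move=> n; have := den_even_ge n; have := den_le n; rewrite !ler_nat; lia.
rewrite -(ler_nat R) -(ltr_nat R) den_odd den_even => ns sn.
have [x [y []]] := @cf_basis R c gamma (2 * n).+1 s t.
rewrite exprS exprM sqrrN !expr1n mulr1 dblSS den_even => sE _ dE.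
have {}dE : t%:R - s%:R * gamma = x%:~R * err (2 * n).+1 - y%:~R * err (2 * n.+1).
  by rewrite -dE; ring.
have lb := err_den_odd_lb n.
have e1 := cf_err_gt0 cf_gamma (2 * n).+1; have e2 := cf_err_gt0 cf_gamma (2 * n.+1).
have := err_odd n; have e3 := cf_err_gt0 cf_gamma (2 * n.+1).+1.
have Q0 := q_gt0 (2 * n); have Q01 := den_le n.
rewrite dE in d0 *; move=> e123.
suff sd : err (2 * n).+1 <= x%:~R * err (2 * n).+1 - y%:~R * err (2 * n.+1) \/
   err (2 * n).+1 <= 2 * (x%:~R * err (2 * n).+1 - y%:~R * err (2 * n.+1)) /\
   2 * q (2 * n).+1 <= s%:R by case: sd => [|[]]; nra.
have [y1|[y0|y1]] := int_sign y.
- by have [x1|[x1|x2]] := int_cases x; [exfalso; nra|left; nra|left; nra].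
- by have [x1|[x1|x2]] := int_cases x; [exfalso; nra|left; nra|left; nra].
have x1 : 1 <= x%:~R :> R by have [x1|[x1|x2]] := int_cases x; [exfalso; nra|lra|lra].
have [y0|[{}y1|y2]] := int_cases y; [exfalso; lra| |exfalso].
  case: (c_oddR n.+1) => cE; rewrite cE in sn e123; first by exfalso; nra.
  by right; rewrite y1; split; nra.
by case: (c_oddR n.+1) => cE; rewrite cE in sn; nra.
Qed.

End Pattern.

(** * Absolutely continuous functions on an interval *)

Section IteratedIntegrals.
Context {R : realType}.
Local Notation mu := (@lebesgue_measure R).

(** Fubini on the half plane s <= t, whose indicator is a boolean cast to [R]; integrability follows
    from the majorant |f(t)| |g(s)|. It is the source of the product rule below. *)
Lemma Rintegral_swap_triangle (f g : R -> R) :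
  mu.-integrable setT (EFin \o f) -> mu.-integrable setT (EFin \o g) ->
  \int[mu]_(t in setT) (f t * \int[mu]_(s in setT) (g s * ((s : R) <= t)%R%:R)) =
  \int[mu]_s (g s * \int[mu]_t (f t * (s <= t)%R%:R)).
Proof.
move=> fi gi.
have [mf mg] : measurable_fun setT f /\ measurable_fun setT g.
  by split; apply/measurable_EFinP; [move/integrableP : fi => []|move/integrableP : gi => []].
have mle (a b : R -> R) : measurable_fun setT a -> measurable_fun setT b ->
    measurable_fun setT (fun x => (a x <= b x)%R%:R : R).
  move=> ma mb; have -> : (fun x => (a x <= b x)%R%:R : R) = \1_[set x | a x <= b x].
    by apply/funext => x; rewrite indicE; case: (boolP (a x <= b x)) => h;
      [rewrite mem_set|rewrite memNset//; apply/negP].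
  apply: measurable_indic; rewrite -[X in measurable X]setTI.
  exact: measurable_fun_le.
have bnd (a b : R -> R) : [bounded ((a x <= b x)%R%:R : R) | x in setT].
  exists 1; split; rewrite ?num_real// => M M1 x _ /=.
  by rewrite ger0_norm ?ler0n// (le_trans _ (ltW M1))// lern1 leq_b1.
have intM (h a b : R -> R) : measurable_fun setT a -> measurable_fun setT b ->
    mu.-integrable setT (EFin \o h) ->
    mu.-integrable setT (EFin \o (fun x => h x * (a x <= b x)%R%:R)).
  move=> ma mb hi; have := integrableMl measurableT hi (mle _ _ ma mb) (bnd a b).
  by apply: eq_integrable => // x _ /=; rewrite EFinM.
pose h (z : R * R) : \bar R := (f z.1 * (g z.2 * (z.2 <= z.1)%R%:R))%:E.
have mh : measurable_fun setT h.
  apply/measurable_EFinP; apply: measurable_funM; first exact: measurableT_comp.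
  apply: measurable_funM; first exact: measurableT_comp.
  have -> : (fun x : R * R => (x.2 <= x.1)%R%:R : R) = \1_[set x : R * R | x.2 <= x.1].
    by apply/funext => x; rewrite indicE; case: (boolP (x.2 <= x.1)) => ?;
      [rewrite mem_set|rewrite memNset//; apply/negP].
  apply: measurable_indic; rewrite -[X in measurable X]setTI.
  by apply: measurable_fun_le => //.
have h1 t : (\int[mu]_s h (t, s) = (f t * \int[mu]_s (g s * (s <= t)%R%:R))%:E)%E.
  rewrite /h /= -RintegralZl//; last exact: intM.
  rewrite /Rintegral fineK//; apply: integrable_fin_num => //.
  have := @integrableZl _ _ _ mu setT measurableT (f t) _ (intM g id (cst t) (@measurable_id _ _ _) (@measurable_cst _ _ _ _ _ _) gi).
  by apply: eq_integrable => // x _ /=; rewrite EFinM.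
have h2 s : (\int[mu]_t h (t, s) = (g s * \int[mu]_t (f t * (s <= t)%R%:R))%:E)%E.
  rewrite /h /= -RintegralZl//; last exact: intM.
  rewrite /Rintegral fineK//; last first.
    apply: integrable_fin_num => //.
    have := @integrableZl _ _ _ mu setT measurableT (g s) _ (intM f (cst s) id (@measurable_cst _ _ _ _ _ _) (@measurable_id _ _ _) fi).
    by apply: eq_integrable => // x _ /=; rewrite EFinM.
  by apply: eq_integral => x _ /=; rewrite mulrCA.
have hi : (mu \x mu)%E.-integrable setT h.
  apply/integrable12ltyP => //.
  have fni := integrable_norm fi; have gni := integrable_norm gi.
  have K : (\int[mu]_s `|g s|%:E = (\int[mu]_s `|g s|)%:E)%E.
    by rewrite /Rintegral fineK//; apply: integrable_fin_num.
  apply: (@le_lt_trans _ _ (\int[mu]_t (`|f t| * \int[mu]_s `|g s|)%:E)%E).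
    apply: ge0_le_integral => //.
    - by move=> x _; exact: integral_ge0.
    - apply: (@measurable_fun_fubini_tonelli_F _ _ _ _ _ mu (fun z => `|h z|)%E) => //.
      exact: measurableT_comp.
    - apply/measurable_EFinP; apply: measurable_funM => //.
      exact: measurableT_comp.
    - move=> t _; rewrite EFinM -K -ge0_integralZl//.
      + apply: ge0_le_integral => //.
        * apply: measurableT_comp => //.
          exact: (measurableT_comp mh (pair1_measurable t)).
        * by apply/measurable_EFinP; apply: measurable_funM => //; exact: measurableT_comp.
        * move=> s _; rewrite /h /= -EFinM lee_fin normrM ler_wpM2l// normrM.
          by rewrite ler_piMr// ger0_norm ?ler0n// lern1 leq_b1.
      + by apply/measurable_EFinP; exact: measurableT_comp.
  have := @integrableZr _ _ _ mu setT measurableT (\int[mu]_s `|g s|) _ fni.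
  move/integrable_lty; apply => //.
have := Fubini hi.
under eq_integral do rewrite h1; under [RHS]eq_integral do rewrite h2.
by rewrite /Rintegral => /(congr1 fine).
Qed.

End IteratedIntegrals.

Section Primitives.
Context {R : realType}.
Local Notation mu := (@lebesgue_measure R).

(** Absolute continuity in the integral form of [H2_rep]: [f] matters only almost everywhere, and no
    pointwise derivative of [F] is involved. *)
Definition primitive_on (l : R) (F f : R -> R) :=
  mu.-integrable `[0, l] (EFin \o f) /\
  forall x, 0 <= x <= l -> F x = F 0 + \int[mu]_(t in `[0, x]) f t.

Lemma integrable_sub_itv (l x : R) (f : R -> R) : x <= l ->
  mu.-integrable `[0, l] (EFin \o f) -> mu.-integrable `[0, x] (EFin \o f).
Proof.
move=> xl; apply: integrableS => //.
by apply: subset_itvl; rewrite bnd_simp.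
Qed.

Lemma primitive_on_continuous (l : R) F f : 0 <= l ->
  primitive_on l F f -> {within `[0, l], continuous F}.
Proof.
move=> l0 [fi FE].
have c := parameterized_integral_continuous l0 fi.
have : {within `[0, l], continuous (fun x => F 0 + \int[mu]_(t in `[0, x]) f t)}.
  by move=> x; apply: cvgD; [exact: cvg_cst|exact: c].
move=> c1; refine (@subspace_eq_continuous _ `[0, l]%classic R _ F _ c1) => x.
by rewrite inE/= in_itv/= => x0l; rewrite [RHS]FE.
Qed.

Lemma within_continuous_bounded (l : R) (G : R -> R) :
  {within `[0, l], continuous G} ->
  measurable_fun `[0, l] G /\ [bounded G x | x in `[0, l]].
Proof.
move=> cG; split; first exact: subspace_continuous_measurable_fun.
have /compact_bounded[M [_ mrt]] := continuous_compact cG (@segment_compact _ _ _).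
by exists M; split; rewrite ?num_real // => ? ? ? ?; exact: mrt.
Qed.

Lemma integrable_mul_continuous (l : R) (f G : R -> R) :
  mu.-integrable `[0, l] (EFin \o f) -> {within `[0, l], continuous G} ->
  mu.-integrable `[0, l] (EFin \o (fun x => f x * G x)).
Proof.
move=> fi /within_continuous_bounded[mG bG].
have := @integrableMl _ _ _ mu _ (measurable_itv `[0, l]) _ _ fi mG bG.
by apply: eq_integrable => // x _ /=; rewrite EFinM.
Qed.

Lemma integrable_add (D : set R) (f g : R -> R) : measurable D ->
  mu.-integrable D (EFin \o f) -> mu.-integrable D (EFin \o g) ->
  mu.-integrable D (EFin \o (fun x => f x + g x)).
Proof.
move=> mD fi gi; have := @integrableD _ _ _ mu D mD _ _ fi gi.
by apply: eq_integrable => // x _ /=; rewrite EFinD.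
Qed.

Lemma integrable_scale (D : set R) (k : R) (f : R -> R) : measurable D ->
  mu.-integrable D (EFin \o f) -> mu.-integrable D (EFin \o (fun x => k * f x)).
Proof.
move=> mD fi; have := @integrableZl _ _ _ mu D mD k _ fi.
by apply: eq_integrable => // x _ /=; rewrite EFinM.
Qed.

Lemma primitive_onD (l : R) F f G g :
  primitive_on l F f -> primitive_on l G g ->
  primitive_on l (fun x => F x + G x) (fun x => f x + g x).
Proof.
move=> [fi FE] [gi GE]; split; first exact: integrable_add.
move=> x x0l; rewrite FE// GE// RintegralD//.
- by ring.
- by apply: (integrable_sub_itv l) => //; case/andP: x0l.
- by apply: (integrable_sub_itv l) => //; case/andP: x0l.
Qed.

Lemma primitive_onZ (l k : R) F f :
  primitive_on l F f -> primitive_on l (fun x => k * F x) (fun x => k * f x).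
Proof.
move=> [fi FE]; split; first exact: integrable_scale.
move=> x x0l; rewrite FE// RintegralZl//; first by ring.
by apply: (integrable_sub_itv l) => //; case/andP: x0l.
Qed.

Lemma primitive_onB (l : R) F f G g :
  primitive_on l F f -> primitive_on l G g ->
  primitive_on l (fun x => F x - G x) (fun x => f x - g x).
Proof.
move=> Ff /(primitive_onZ l (-1)) /(primitive_onD l _ _ _ _ Ff).
under [X in primitive_on _ X _ -> _]eq_fun do rewrite mulN1r.
by under [X in primitive_on _ _ X -> _]eq_fun do rewrite mulN1r.
Qed.

Lemma primitive_on_eq (l : R) F f G g :
  (forall x, 0 <= x <= l -> F x = G x) -> (forall x, 0 <= x <= l -> f x = g x) ->
  primitive_on l F f -> primitive_on l G g.
Proof.
move=> FG fg [fi FE]; split.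
  apply: eq_integrable fi => // x; rewrite inE/= in_itv/= => /fg.
  by move=> ->.
move=> x /andP[x0 xl]; rewrite -!FG ?x0// ?lexx ?(le_trans x0 xl)// FE ?x0//.
congr (_ + _); apply: eq_Rintegral => t; rewrite inE/= in_itv/= => /andP[t0 tx].
by rewrite fg// t0 (le_trans tx).
Qed.

(** The square of side [l] splits into the triangles s <= t and t <= s, one for each iterated
    integral. *)
Lemma Rintegral_prod_primitives (l : R) (f g : R -> R) : 0 <= l ->
  mu.-integrable `[0, l] (EFin \o f) -> mu.-integrable `[0, l] (EFin \o g) ->
  \int[mu]_(t in `[0, l]) (f t * \int[mu]_(s in `[0, t]) g s) +
  \int[mu]_(s in `[0, l]) (g s * \int[mu]_(t in `[0, s]) f t) =
  (\int[mu]_(t in `[0, l]) f t) * (\int[mu]_(t in `[0, l]) g t).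
Proof.
move=> l0 fi gi; pose D := `[0, l]%classic : set R.
have ext (h : R -> R) : mu.-integrable `[0, l] (EFin \o h) ->
    mu.-integrable setT (EFin \o (h \_ D)).
  by rewrite integrable_mkcond// restrict_EFin.
have := Rintegral_swap_triangle _ _ (ext _ fi) (ext _ gi).
rewrite [X in X = _ -> _](_ : _ = \int[mu]_(t in `[0, l]) (f t * \int[mu]_(s in `[0, t]) g s)); last first.
  rewrite [RHS]Rintegral_mkcond; apply: eq_Rintegral => t _.
  rewrite !patchE /D !mem_setE; case: ifPn => [|_]; last by rewrite mul0r.
  rewrite in_itv/= => /andP[t0 tl]; congr (_ * _).
  rewrite [RHS]Rintegral_mkcond; apply: eq_Rintegral => s _.
  rewrite !patchE /D !mem_setE !in_itv/=.
  have [st|st] := leP s t; rewrite ?mulr1 ?mulr0 ?andbT ?andbF//.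
  by rewrite (le_trans st tl) andbT.
rewrite [X in _ = X -> _](_ : _ = \int[mu]_(s in `[0, l]) (g s *
    (\int[mu]_(t in `[0, l]) f t - \int[mu]_(t in `[0, s]) f t))); last first.
  rewrite [RHS]Rintegral_mkcond; apply: eq_Rintegral => s _.
  rewrite !patchE /D !mem_setE; case: ifPn => [|_]; last by rewrite mul0r.
  rewrite in_itv/= => /andP[s0 sl]; congr (_ * _).
  rewrite Rintegral_itvB// Rintegral_itv_obnd_cbnd; last first.
    apply: integrableS fi => //; apply: subset_itvr; by rewrite bnd_simp.
  rewrite [RHS]Rintegral_mkcond; apply: eq_Rintegral => t _.
  rewrite !patchE /D !mem_setE !in_itv/=.
  have [st|st] := leP s t; rewrite ?mulr1 ?mulr0 ?andbT ?andbF//.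
  by rewrite (le_trans s0 st).
move=> ->.
have cF : {within `[0, l], continuous (fun s => \int[mu]_(t in `[0, s]) f t)}.
  exact: parameterized_integral_continuous.
under [X in X + _]eq_Rintegral do rewrite mulrBr.
rewrite RintegralB//; last 2 first.
  have := integrable_scale `[0, l]%classic (\int[mu]_(t in `[0, l]) f t) _ (measurable_itv _) gi.
  by apply: eq_integrable => // x _ /=; rewrite mulrC.
  exact: integrable_mul_continuous.
by rewrite subrK RintegralZr// mulrC.
Qed.

(** Splitting each factor into its initial value and an integral leaves [Rintegral_prod_primitives],
    the product rule for vanishing initial values. *)
Lemma primitive_onM (l : R) F f G g : 0 <= l ->
  primitive_on l F f -> primitive_on l G g ->
  primitive_on l (fun x => F x * G x) (fun x => f x * G x + g x * F x).
Proof.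
move=> l0 Ff Gg.
have cF := primitive_on_continuous _ _ _ l0 Ff.
have cG := primitive_on_continuous _ _ _ l0 Gg.
have [[fi FE] [gi GE]] := (Ff, Gg).
have fGi := integrable_mul_continuous _ _ _ fi cG.
have gFi := integrable_mul_continuous _ _ _ gi cF.
split; first exact: integrable_add.
move=> x x0l; have /andP[x0 xl] := x0l.
have sub h := integrable_sub_itv l x h xl.
have prod (h k K : R -> R) : mu.-integrable `[0, x] (EFin \o h) ->
    mu.-integrable `[0, x] (EFin \o k) ->
    (forall t, 0 <= t <= x -> K t = K 0 + \int[mu]_(s in `[0, t]) k s) ->
    \int[mu]_(t in `[0, x]) (h t * K t) = K 0 * \int[mu]_(t in `[0, x]) h t +
     \int[mu]_(t in `[0, x]) (h t * \int[mu]_(s in `[0, t]) k s).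
  move=> hi ki KE.
  rewrite -RintegralZl// -RintegralD//; first last.
  - apply: integrable_mul_continuous => //.
    exact: parameterized_integral_continuous.
  - exact: integrable_scale.
  apply: eq_Rintegral => t; rewrite inE/= in_itv/= => tx.
  by rewrite KE//; ring.
have le_sub t : 0 <= t <= x -> 0 <= t <= l.
  by move=> /andP[-> /le_trans]; apply.
rewrite RintegralD//; [|exact: sub|exact: sub].
rewrite (prod f g G) ?(prod g f F); try exact: sub; last 2 first.
  by move=> t /le_sub; exact: FE.
  by move=> t /le_sub; exact: GE.
have := Rintegral_prod_primitives x f g x0 (sub _ fi) (sub _ gi).
rewrite FE// GE// => h.
transitivity (F 0 * G 0 + (G 0 * \int[mu]_(t in `[0, x]) f t +
  F 0 * \int[mu]_(t in `[0, x]) g t + (\int[mu]_(t in `[0, x]) f t) * \int[mu]_(t in `[0, x]) g t)).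
  by ring.
by rewrite -h; ring.
Qed.

End Primitives.

(** * Square integrable functions on one edge *)

Section SquareIntegrable.
Context {R : realType}.
Local Notation mu := (@lebesgue_measure R).

Lemma ae_mono (P Q : R -> Prop) : (forall x, P x -> Q x) ->
  {ae mu, forall x, P x} -> {ae mu, forall x, Q x}.
Proof. by move=> PQ; apply: negligibleS => x /= nQ /PQ. Qed.

Lemma primitive_on_derive (l : R) (F f : R -> R) : 0 < l ->
  (forall x : R, is_derive x 1 F (f x)) -> continuous f -> primitive_on l F f.
Proof.
move=> l0 dF cf.
have cF : continuous F.
  by move=> x; apply: differentiable_continuous; apply/derivable1_diffP; case: (dF x).
split.
  apply: continuous_compact_integrable; first exact: segment_compact.
  exact: continuous_subspaceT.
move=> x /andP[]; rewrite le_eqVlt => /predU1P[<- _|x0 _].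
  by rewrite set_itv1 Rintegral_set1 addr0.
rewrite /Rintegral (@continuous_FTC2 _ f F 0 x)//=; first by ring.
- exact: continuous_subspaceT.
- split; first by move=> y _; case: (dF y).
  + by apply: cvg_at_right_filter; exact: cF.
  + by apply: cvg_at_left_filter; exact: cF.
- by move=> y _; rewrite derive1E; exact: derive_val.
Qed.

Lemma primitive_on_cst (l k : R) : 0 < l -> primitive_on l (cst k) (cst 0).
Proof. by move=> l0; apply: primitive_on_derive => // x; exact: cst_continuous. Qed.

Lemma primitive_on_integral (l k : R) f :
  mu.-integrable `[0, l] (EFin \o f) ->
  primitive_on l (fun x => k + \int[mu]_(t in `[0, x]) f t) f.
Proof.
by move=> fi; split=> // x _; rewrite set_itv1 Rintegral_set1 addr0.
Qed.

Lemma primitive_on_ae (l : R) F f g :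
  measurable_fun `[0, l] g ->
  {ae mu, forall x, `[0, l]%classic x -> f x = g x} ->
  primitive_on l F f -> primitive_on l F g.
Proof.
move=> mg fg [fi FE]; split.
  have mD : measurable (`[0, l]%classic : set R) by exact: measurable_itv.
  apply/integrableP; split; first exact/measurable_EFinP.
  move/integrableP: (fi) => [mf].
  apply: le_lt_trans; rewrite le_eqVlt; apply/orP; left; apply/eqP.
  apply: (@ge0_ae_eq_integral _ _ _ mu) => //.
  - by apply: measurableT_comp => //; exact/measurable_EFinP.
  - exact: measurableT_comp.
  - by apply: ae_mono fg => x h Dx /=; rewrite h.
move=> x x0l; rewrite FE//; congr (_ + _); congr fine.
have sub : `[0, x] `<=` (`[0, l]%classic : set R).
  by case/andP: x0l => _ xl; apply: subset_itvl; rewrite bnd_simp.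
apply: (@ae_eq_integral _ _ _ mu) => //.
- apply: (measurable_funS (measurable_itv `[0, l]) sub).
  by move/integrableP: fi => [].
- by apply: (measurable_funS (measurable_itv `[0, l]) sub); exact/measurable_EFinP.
- by apply: ae_mono fg => y h Dy /=; rewrite h//; exact: sub.
Qed.

Definition sqnorm (l : R) (f : R -> R) : R := \int[mu]_(x in `[0, l]) (f x) ^+ 2.

Lemma sqnorm_ge0 (l : R) f : 0 <= sqnorm l f.
Proof. by apply: Rintegral_ge0 => x _; exact: sqr_ge0. Qed.

Lemma L2_on_sqr_integrable (l : R) f : L2_on l f ->
  mu.-integrable `[0, l] (EFin \o (fun x => f x ^+ 2)).
Proof.
move=> [mf foo]; apply/integrableP; split.
  by apply/measurable_EFinP; apply: measurable_funX.
apply: le_lt_trans foo; rewrite le_eqVlt; apply/orP; left; apply/eqP.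
by apply: eq_integral => x _ /=; rewrite ger0_norm// sqr_ge0.
Qed.

Lemma L2_on_sqnorm (l : R) f : L2_on l f ->
  (\int[mu]_(x in `[0%R, l]) ((f x) ^+ 2)%:E = (sqnorm l f)%:E)%E.
Proof.
move=> /L2_on_sqr_integrable fi; rewrite /sqnorm /Rintegral fineK//.
by apply: integrable_fin_num.
Qed.

Lemma integrable_cst_itv (l k : R) : mu.-integrable `[0, l] (EFin \o cst k).
Proof.
apply: continuous_compact_integrable; first exact: segment_compact.
by apply: continuous_subspaceT => x; exact: cst_continuous.
Qed.

Lemma L2_on_integrable (l : R) f : L2_on l f ->
  mu.-integrable `[0, l] (EFin \o f).
Proof.
move=> fL2; have [mf _] := fL2.
have h := integrable_add `[0, l]%classic _ _ (measurable_itv _)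
  (integrable_cst_itv l 1) (L2_on_sqr_integrable l f fL2).
apply: (@le_integrable _ _ _ mu _ (measurable_itv `[0, l]) _ _ _ _ h).
  exact/measurable_EFinP.
move=> x _ /=; rewrite lee_fin [leRHS]ger0_norm ?addr_ge0 ?sqr_ge0//.
by rewrite -(real_normK (num_real (f x))); have := normr_ge0 (f x); nra.
Qed.

Lemma L2_on_bounded (l : R) (f : R -> R) (M : R) : 0 <= l -> measurable_fun `[0, l] f ->
  (forall x, 0 <= x <= l -> f x ^+ 2 <= M) -> L2_on l f /\ sqnorm l f <= l * M.
Proof.
move=> l0 mf fM.
have ub : (\int[mu]_(x in `[0%R, l]) ((f x) ^+ 2)%:E <= (l * M)%:E)%E.
  have -> : (l * M)%:E = (\int[mu]_(x in `[0%R, l]) M%:E)%E.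
    rewrite integral_cst//= lebesgue_measure_itv/= lte_fin.
    case: ltP => [_|l0']; first by rewrite -EFinD subr0 muleC.
    have -> : l = 0 by apply/eqP; rewrite eq_le l0 l0'.
    by rewrite mul0r mule0.
  apply: ge0_le_integral => //.
  by move=> x _; rewrite lee_fin sqr_ge0.
  by apply/measurable_EFinP; apply: measurable_funX.
have fL2 : L2_on l f by split=> //; exact: (le_lt_trans ub (ltry _)).
by split; [exact: fL2|rewrite -lee_fin -L2_on_sqnorm].
Qed.

Lemma L2_on_continuous (l : R) (f : R -> R) : {within `[0, l], continuous f} -> L2_on l f.
Proof.
move=> cf; have [mf _] := within_continuous_bounded _ _ cf.
split=> //; apply: integrable_lty => //.
apply: (@continuous_compact_integrable _ (fun x => f x ^+ 2)); first exact: segment_compact.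
have cf2 : {within `[0, l], continuous (fun x => f x * f x)}.
  by move=> x; apply: cvgM; exact: cf.
exact: cf2.
Qed.

Lemma L2_onD (l : R) f g : L2_on l f -> L2_on l g ->
  L2_on l (fun x => f x + g x) /\
  sqnorm l (fun x => f x + g x) <= 2 * (sqnorm l f + sqnorm l g).
Proof.
move=> fL gL; have [[mf _] [mg _]] := (fL, gL).
have fi := L2_on_sqr_integrable _ _ fL; have gi := L2_on_sqr_integrable _ _ gL.
have mD : measurable (`[0, l]%classic : set R) by exact: measurable_itv.
have hi := integrable_scale _ 2 _ mD (integrable_add _ _ _ mD fi gi).
have mfg : measurable_fun `[0, l] (fun x => f x + g x) by exact: measurable_funD.
have le x : (f x + g x) ^+ 2 <= 2 * (f x ^+ 2 + g x ^+ 2).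
  by have := sqr_ge0 (f x - g x); nra.
have si : mu.-integrable `[0, l] (EFin \o (fun x => (f x + g x) ^+ 2)).
  apply: (@le_integrable _ _ _ mu _ (measurable_itv `[0, l]) _ _ _ _ hi).
    by apply/measurable_EFinP; apply: measurable_funX.
  move=> x _ /=; rewrite lee_fin !ger0_norm ?sqr_ge0//.
  by rewrite mulr_ge0// addr_ge0// sqr_ge0.
split; first by split=> //; apply: integrable_lty si.
rewrite /sqnorm -RintegralD// -RintegralZl//; last exact: integrable_add.
by apply: le_Rintegral => // x _; exact: le.
Qed.

Lemma L2_onZ (l k : R) f : L2_on l f ->
  L2_on l (fun x => k * f x) /\ sqnorm l (fun x => k * f x) = k ^+ 2 * sqnorm l f.
Proof.
move=> fL; have [mf _] := fL; have fi := L2_on_sqr_integrable _ _ fL.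
have e : (fun x => (k * f x) ^+ 2) = (fun x => k ^+ 2 * f x ^+ 2).
  by apply/funext => x; rewrite exprMn.
split; last by rewrite /sqnorm e RintegralZl.
split; first by apply: measurable_funM.
rewrite (_ : (fun x => ((k * f x) ^+ 2)%:E) = EFin \o (fun x => (k * f x) ^+ 2))// e.
by apply: integrable_lty => //; apply: integrable_scale.
Qed.

(** Expand the integral of (f - s phi)^2 at s = I / K. The added 1 keeps K positive when [phi]
    vanishes; later only a constant independent of [f] is wanted. *)
Lemma Rintegral_cauchy_schwarz (l : R) (f phi : R -> R) : L2_on l f ->
  {within `[0, l], continuous phi} ->
  (\int[mu]_(x in `[0, l]) (f x * phi x)) ^+ 2 <= (1 + sqnorm l phi) * sqnorm l f.
Proof.
move=> fL cphi; set I := Rintegral _ _ _; set K := 1 + _.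
have K0 : 0 < K by rewrite /K ltr_pwDl ?sqnorm_ge0.
pose s := I / K.
have mD : measurable (`[0, l]%classic : set R) by exact: measurable_itv.
have fi := L2_on_sqr_integrable _ _ fL.
have pi2 := L2_on_sqr_integrable _ _ (L2_on_continuous _ _ cphi).
have fpi := integrable_mul_continuous _ _ _ (L2_on_integrable _ _ fL) cphi.
have : 0 <= \int[mu]_(x in `[0, l])
    ((f x) ^+ 2 + (- 2 * s * (f x * phi x) + s ^+ 2 * phi x ^+ 2)).
  apply: Rintegral_ge0 => x _; have := sqr_ge0 (f x - s * phi x); nra.
have e1 := integrable_scale _ (- 2 * s) _ mD fpi.
have e2 := integrable_scale _ (s ^+ 2) _ mD pi2.
rewrite RintegralD//; last exact: integrable_add.
rewrite RintegralD// !RintegralZl// -/I -/(sqnorm l f) -/(sqnorm l phi).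
have -> : sqnorm l phi = K - 1 by rewrite /K; ring.
have IE : I = s * K by rewrite /s divfK// gt_eqF.
rewrite IE; have := sqnorm_ge0 l f; move: (sqnorm l f) => N N0 h.
have : s ^+ 2 * K <= N by have := sqr_ge0 s; nra.
by move=> /(ler_wpM2l (ltW K0)); rewrite exprMn; nra.
Qed.

End SquareIntegrable.

(** * The inhomogeneous equation on one edge *)

Section EdgeEquation.
Context {R : realType}.
Local Notation mu := (@lebesgue_measure R).

(* S(x) = sin(kx)/k and C(x) = cos(kx) when E = k^2 > 0; S(x) = x and C = 1 when E = 0. *)
Definition fundamental_pair (E : R) (S C : R -> R) :=
  [/\ S 0 = 0, C 0 = 1, (forall x, C x ^+ 2 + E * S x ^+ 2 = 1) &
    forall l, 0 < l -> primitive_on l S C /\ primitive_on l C (fun x => - E * S x)].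

Definition edge_solution (l E : R) (u u1 u2 f : R -> R) :=
  [/\ primitive_on l u u1, primitive_on l u1 u2, L2_on l f &
    {ae mu, forall x, `[0, l]%classic x -> - u2 x - E * u x = f x}].

Lemma primitive_onN_eq (l : R) F f x : primitive_on l F (fun x => - f x) ->
  0 <= x <= l -> F x = F 0 - \int[mu]_(t in `[0, x]) f t.
Proof.
move=> [fi FE] x0l; rewrite FE//; congr (_ + _).
have -> : (fun t => - f t) = (fun t => -1 * f t) by apply/funext => t; rewrite mulN1r.
rewrite RintegralZl//; first by rewrite mulN1r.
have xl : x <= l by case/andP: x0l.
have := integrable_scale _ (-1) _ (measurable_itv `[0, x]) (integrable_sub_itv _ _ _ xl fi).
by apply: eq_integrable => // t _ /=; rewrite mulN1r opprK.
Qed.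

(** Since S' = C and C' = -E S, the derivatives of u' S - u C and u' C + E u S collapse to -f S and
    -f C. All facts about solutions on an edge are read off these two identities. *)
Lemma edge_wronskian (l E : R) S C u u1 u2 f : 0 < l ->
  fundamental_pair E S C -> edge_solution l E u u1 u2 f ->
  forall x, 0 <= x <= l ->
  u1 x * S x - u x * C x = - u 0 - \int[mu]_(t in `[0, x]) (f t * S t) /\
  u1 x * C x + E * (u x * S x) = u1 0 - \int[mu]_(t in `[0, x]) (f t * C t).
Proof.
move=> l0 [S0 C0 _ /(_ l l0)[pS pC]] [pu pu1 [mf _] fE] x x0l.
have cS := primitive_on_continuous _ _ _ (ltW l0) pS.
have cC := primitive_on_continuous _ _ _ (ltW l0) pC.
have [mS _] := within_continuous_bounded _ _ cS.
have [mC _] := within_continuous_bounded _ _ cC.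
have pM F f' G g := primitive_onM l F f' G g (ltW l0).
split.
- have := primitive_onB _ _ _ _ _ (pM _ _ _ _ pu1 pS) (pM _ _ _ _ pu pC).
  move=> /(primitive_on_ae _ _ _ (fun t => - (f t * S t))) h.
  have {}h := h (measurable_funN (measurable_funM mf mS)).
  rewrite (primitive_onN_eq _ _ (fun t => f t * S t) _ (h _) x0l).
    by rewrite S0 C0; ring.
  by apply: ae_mono fE => t h' Dt; rewrite -h'//; ring.
- have := primitive_onD _ _ _ _ _ (pM _ _ _ _ pu1 pC) (primitive_onZ _ E _ _ (pM _ _ _ _ pu pS)).
  move=> /(primitive_on_ae _ _ _ (fun t => - (f t * C t))) h.
  have {}h := h (measurable_funN (measurable_funM mf mC)).
  rewrite (primitive_onN_eq _ _ (fun t => f t * C t) _ (h _) x0l).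
    by rewrite S0 C0; ring.
  by apply: ae_mono fE => t h' Dt; rewrite -h'//; ring.
Qed.

(* A cubic whose only nonzero boundary datum is its slope at 0: pairing with it
   recovers u(0), and it generates sources acting at a single vertex. *)
Definition cutoff (l : R) (x : R) := x - 2 / l * x ^+ 2 + x ^+ 3 / l ^+ 2.
Definition cutoff1 (l : R) (x : R) := 1 - 4 / l * x + 3 / l ^+ 2 * x ^+ 2.
Definition cutoff2 (l : R) (x : R) := - 4 / l + 6 / l ^+ 2 * x.

Lemma cutoff_primitive (l : R) : 0 < l ->
  primitive_on l (cutoff l) (cutoff1 l) /\ primitive_on l (cutoff1 l) (cutoff2 l).
Proof.
move=> l0.
have c1 : continuous (fun x : R => x) by move=> x.
have c2 (k : R) : continuous (fun x => k * x) by move=> x; exact: mulrl_continuous.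
have c3 (k : R) : continuous (fun x : R => k * x ^+ 2).
  by move=> x; apply: cvgM; [exact: cvg_cst|exact: exprn_continuous].
split; apply: primitive_on_derive => //.
- move=> x; rewrite /cutoff /cutoff1.
  by apply: is_derive_eq; rewrite /GRing.scale/=; lra.
- by move=> x; apply: cvgD; [apply: cvgB; [exact: cvg_cst|exact: c2]|exact: c3].
- move=> x; rewrite /cutoff1 /cutoff2.
  by apply: is_derive_eq; rewrite /GRing.scale/=; lra.
- by move=> x; apply: cvgD; [exact: cvg_cst|exact: c2].
Qed.

Lemma cutoff_boundary (l : R) : 0 < l ->
  [/\ cutoff l 0 = 0, cutoff l l = 0, cutoff1 l 0 = 1 & cutoff1 l l = 0].
Proof. by move=> l0; rewrite /cutoff /cutoff1; split; field; rewrite ?gt_eqF. Qed.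

Lemma cutoff2_continuous (l : R) : continuous (cutoff2 l).
Proof. by move=> x; apply: cvgD; [exact: cvg_cst|exact: mulrl_continuous]. Qed.

(** Integrating u'' b - u b'' over the edge, with b the cutoff, leaves only u(0) from the boundary;
    Cauchy-Schwarz does the rest. This is why the vertex values of a function in the domain are
    square summable. *)
Lemma edge_trace (l : R) : 0 < l -> exists2 K : R, 0 <= K &
  forall u u1 u2 : R -> R, L2_on l u2 ->
    primitive_on l u u1 -> primitive_on l u1 u2 ->
    u 0 ^+ 2 <= K * (sqnorm l u + sqnorm l u2).
Proof.
move=> l0; have [pb pb1] := cutoff_primitive l l0.
have [b0 bl b10 b1l] := cutoff_boundary l l0.
have cb := primitive_on_continuous _ _ _ (ltW l0) pb.
have cb2 : {within `[0, l], continuous (cutoff2 l)}.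
  by apply: continuous_subspaceT; exact: cutoff2_continuous.
exists (2 * (1 + sqnorm l (cutoff l)) + 2 * (1 + sqnorm l (cutoff2 l))).
  by have := sqnorm_ge0 l (cutoff l); have := sqnorm_ge0 l (cutoff2 l); lra.
move=> u u1 u2 u2L pu pu1.
have uL := L2_on_continuous _ _ (primitive_on_continuous _ _ _ (ltW l0) pu).
have [_] := primitive_onB _ _ _ _ _ (primitive_onM _ _ _ _ _ (ltW l0) pu1 pb)
   (primitive_onM _ _ _ _ _ (ltW l0) pu pb1).
move=> /(_ l); rewrite lexx ltW// => /(_ isT); rewrite b0 bl b10 b1l.
have -> : (fun x => u2 x * cutoff l x + cutoff1 l x * u1 x - (u1 x * cutoff1 l x + cutoff2 l x * u x))
  = (fun x => u2 x * cutoff l x - u x * cutoff2 l x) by apply/funext => x; ring.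
rewrite RintegralB//; last 2 first.
- by apply: integrable_mul_continuous => //; exact: L2_on_integrable.
- by apply: integrable_mul_continuous => //; exact: L2_on_integrable.
have := Rintegral_cauchy_schwarz _ _ _ u2L cb.
have := Rintegral_cauchy_schwarz _ _ _ uL cb2.
have := sqnorm_ge0 l (cutoff l); have := sqnorm_ge0 l (cutoff2 l).
have := sqnorm_ge0 l u; have := sqnorm_ge0 l u2.
move: (sqnorm _ _) (sqnorm _ _) (sqnorm _ _) (sqnorm _ _).
move: (Rintegral _ _ _) (Rintegral _ _ _) => I J a b c d a0 b0' c0 d0 h1 h2 e.
have -> : u 0 = I - J by lra.
have : (I - J) ^+ 2 <= 2 * I ^+ 2 + 2 * J ^+ 2 by have := sqr_ge0 (I + J); nra.
have : 0 <= a * c by rewrite mulr_ge0.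
have : 0 <= b * d by rewrite mulr_ge0.
have : 0 <= a * d by rewrite mulr_ge0.
have : 0 <= b * c by rewrite mulr_ge0.
nra.
Qed.

(** [eta] is the source for which the cutoff itself is a solution, so [edge_wronskian] at the far
    end turns its boundary data into the two pairings. *)
Lemma cutoff_source (l E : R) S C : 0 < l -> fundamental_pair E S C ->
  let eta := fun x => - cutoff2 l x - E * cutoff l x in
  [/\ L2_on l eta,
      \int[mu]_(t in `[0, l]) (eta t * S t) = 0 &
      \int[mu]_(t in `[0, l]) (eta t * C t) = 1].
Proof.
move=> l0 SC eta; have [pb pb1] := cutoff_primitive l l0.
have [b0 bl b10 b1l] := cutoff_boundary l l0.
have eL : L2_on l eta.
  apply: L2_on_continuous => x; apply: cvgB.
    by apply: cvgN; apply: (continuous_subspaceT (cutoff2_continuous l)).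
  apply: cvgM; first exact: cvg_cst.
  exact: (primitive_on_continuous _ _ _ (ltW l0) pb).
have : edge_solution l E (cutoff l) (cutoff1 l) (cutoff2 l) eta.
  by split => //; apply: aeW.
move=> /(edge_wronskian _ _ _ _ _ _ _ _ l0 SC) /(_ l).
rewrite lexx ltW// => /(_ isT); rewrite b0 bl b10 b1l => -[h1 h2].
by split => //; lra.
Qed.

Lemma sqnorm_sub (l x : R) f : L2_on l f -> x <= l ->
  L2_on x f /\ sqnorm x f <= sqnorm l f.
Proof.
move=> fL xl; have fi := L2_on_sqr_integrable _ _ fL.
have sub : `[0, x] `<=` (`[0, l]%classic : set R).
  by apply: subset_itvl; rewrite bnd_simp.
have xi := integrable_sub_itv _ _ _ xl fi.
have fxL : L2_on x f.
  split; first by apply: (measurable_funS (measurable_itv `[0, l]) sub); case: fL.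
  exact: integrable_lty xi.
split=> //; rewrite -lee_fin -!L2_on_sqnorm//.
apply: ge0_subset_integral => //; last by move=> t _; rewrite lee_fin sqr_ge0.
by move/integrableP: fi => [].
Qed.

Lemma linear_combination_sq (s c MS MC nS nC nf I J a0 b0 : R) :
  0 <= MS -> 0 <= MC -> s ^+ 2 <= MS -> c ^+ 2 <= MC ->
  0 <= nS -> 0 <= nC -> 0 <= nf -> I ^+ 2 <= (1 + nC) * nf -> J ^+ 2 <= (1 + nS) * nf ->
  (s * (b0 + -1 * I) + c * (a0 + J)) ^+ 2 <=
    4 * (MS + MC) * (1 + (1 + nS) + (1 + nC)) * (a0 ^+ 2 + b0 ^+ 2 + nf).
Proof.
move=> MS0 MC0 sM cM nS0 nC0 nf0 IM JM.
have aa := sqr_ge0 a0; have bb := sqr_ge0 b0.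
pose T := (1 + (1 + nS) + (1 + nC)) * (a0 ^+ 2 + b0 ^+ 2 + nf).
have Sf : 0 <= nS * nf by exact: mulr_ge0.
have Cf : 0 <= nC * nf by exact: mulr_ge0.
have SCab : 0 <= (nS + nC) * (a0 ^+ 2 + b0 ^+ 2) by rewrite mulr_ge0// addr_ge0.
have x1 : (b0 + -1 * I) ^+ 2 <= 2 * T.
  by have := sqr_ge0 (b0 + I); rewrite /T; lra.
have x2 : (a0 + J) ^+ 2 <= 2 * T.
  by have := sqr_ge0 (a0 - J); rewrite /T; lra.
have := ler_pM (sqr_ge0 _) (sqr_ge0 _) sM x1.
have := ler_pM (sqr_ge0 _) (sqr_ge0 _) cM x2.
have := sqr_ge0 (s * (b0 + -1 * I) - c * (a0 + J)).
rewrite -mulrA -/T; clear x1 x2; move: T (b0 + _) (a0 + _) => t x y; lra.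
Qed.

(** Variation of constants, with u = S P + C Q. The constant [K] does not depend on the data, so the
    bounds can be summed over all edges of one direction. *)
Lemma edge_existence (l E : R) S C : 0 < l -> fundamental_pair E S C ->
  exists2 K : R, 0 <= K & forall f a0 b0, L2_on l f ->
  exists u u1 u2, [/\ edge_solution l E u u1 u2 f, u 0 = a0, u1 0 = b0,
    L2_on l u /\ L2_on l u2 &
    sqnorm l u <= K * (a0 ^+ 2 + b0 ^+ 2 + sqnorm l f) /\
    sqnorm l u2 <= K * (a0 ^+ 2 + b0 ^+ 2 + sqnorm l f)].
Proof.
move=> l0 [S0 C0 SC1 /(_ l l0)[pS pC]].
have cS := primitive_on_continuous _ _ _ (ltW l0) pS.
have cC := primitive_on_continuous _ _ _ (ltW l0) pC.
have bnd (G : R -> R) : {within `[0, l], continuous G} ->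
    exists2 M : R, 0 <= M & forall x, 0 <= x <= l -> G x ^+ 2 <= M.
  move=> /within_continuous_bounded[_ [M [_ MG]]].
  exists ((`|M| + 1) ^+ 2); first exact: sqr_ge0.
  move=> x xl; rewrite -[G x ^+ 2]real_normK ?num_real// lerXn2r ?nnegrE//.
  by apply: MG; rewrite ?ltr_pwDr ?ler_norm//= in_itv.
have [MS MS0 hS] := bnd _ cS; have [MC MC0 hC] := bnd _ cC.
pose N := 4 * (MS + MC) * (1 + (1 + sqnorm l S) + (1 + sqnorm l C)).
have sS := sqnorm_ge0 l S; have sC := sqnorm_ge0 l C.
have N0 : 0 <= l * N by rewrite /N; apply: mulr_ge0; [lra|apply: mulr_ge0; lra].
exists (l * N + (2 + 2 * (E ^+ 2 * (l * N)))).
  by have := sqr_ge0 E; nra.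
move=> f a0 b0 fL; have fi := L2_on_integrable _ _ fL.
have fSi := integrable_mul_continuous _ _ _ fi cS.
have fCi := integrable_mul_continuous _ _ _ fi cC.
pose P x := b0 + -1 * \int[mu]_(t in `[0, x]) (f t * C t).
pose Q x := a0 + \int[mu]_(t in `[0, x]) (f t * S t).
have pQ : primitive_on l Q (fun t => f t * S t) by exact: primitive_on_integral.
have pP : primitive_on l P (fun t => -1 * (f t * C t)).
  have := primitive_onD _ _ _ _ _ (primitive_on_cst l b0 l0)
    (primitive_onZ _ (-1) _ _ (primitive_on_integral l 0 _ fCi)).
  by apply: primitive_on_eq => x _; rewrite /= add0r.
pose u x := S x * P x + C x * Q x.
pose u1 x := C x * P x + - E * (S x * Q x).
pose u2 x := - f x - E * u x.
have pM F f' G g := primitive_onM l F f' G g (ltW l0).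
have pu : primitive_on l u u1.
  apply: primitive_on_eq (primitive_onD _ _ _ _ _ (pM _ _ _ _ pS pP) (pM _ _ _ _ pC pQ)) => //.
  by move=> x _; rewrite /u1; ring.
have pu1 : primitive_on l u1 u2.
  apply: primitive_on_eq (primitive_onD _ _ _ _ _ (pM _ _ _ _ pC pP)
    (primitive_onZ _ (- E) _ _ (pM _ _ _ _ pS pQ))) => //.
  move=> x _; rewrite /u2 /u.
  have -> : - f x = - f x * (C x ^+ 2 + E * S x ^+ 2) by rewrite SC1 mulr1.
  ring.
have uL : L2_on l u by apply: L2_on_continuous; exact: primitive_on_continuous (ltW l0) pu.
have [mf _] := fL; have [mu_ _] := uL.
have z0 (h : R -> R) : \int[mu]_(t in `[0, 0]) h t = 0 by rewrite set_itv1 Rintegral_set1.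
have ub x : 0 <= x <= l -> u x ^+ 2 <= N * (a0 ^+ 2 + b0 ^+ 2 + sqnorm l f).
  move=> x0l; have xl : x <= l by case/andP: x0l.
  have [fxL fxn] := sqnorm_sub _ _ _ fL xl.
  have sub : `[0, x] `<=` (`[0, l]%classic : set R).
    by apply: subset_itvl; rewrite bnd_simp.
  have := Rintegral_cauchy_schwarz _ _ _ fxL (continuous_subspaceW sub cS).
  have := Rintegral_cauchy_schwarz _ _ _ fxL (continuous_subspaceW sub cC).
  have [_] := sqnorm_sub _ _ _ (L2_on_continuous _ _ cS) xl.
  have [_] := sqnorm_sub _ _ _ (L2_on_continuous _ _ cC) xl.
  rewrite /u /P /Q /N => Cn Sn h1 h2.
  apply: linear_combination_sq => //; [exact: hS|exact: hC|exact: sqnorm_ge0| |].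
    apply: le_trans h1 _; apply: ler_pM; rewrite ?lerD2l//; last exact: sqnorm_ge0.
    by rewrite addr_ge0// sqnorm_ge0.
  apply: le_trans h2 _; apply: ler_pM; rewrite ?lerD2l//; last exact: sqnorm_ge0.
  by rewrite addr_ge0// sqnorm_ge0.
have [_ un] := L2_on_bounded _ _ _ (ltW l0) mu_ ub.
have X0 : 0 <= a0 ^+ 2 + b0 ^+ 2 + sqnorm l f by rewrite !addr_ge0 ?sqr_ge0 ?sqnorm_ge0.
have [u2L u2n] : L2_on l u2 /\ sqnorm l u2 <= 2 * (sqnorm l f + E ^+ 2 * sqnorm l u).
  have [L1 n1] := L2_onZ _ (-1) _ fL; have [L2 n2] := L2_onZ _ (- E) _ uL.
  have [L3 n3] := L2_onD _ _ _ L1 L2.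
  have e : u2 = (fun x => -1 * f x + - E * u x).
    by apply/funext => x; rewrite /u2; ring.
  rewrite -e n1 n2 sqrrN expr1n mul1r sqrrN in n3.
  by split; [rewrite e|].
exists u, u1, u2; split.
- by split=> //; apply: aeW => x _; rewrite /u2 opprB opprK addrAC subrr add0r.
- by rewrite /u /P /Q S0 C0 !z0; ring.
- by rewrite /u1 /P /Q S0 C0 !z0; ring.
- by [].
have E0 := sqr_ge0 E; move: un u2n X0 N0; rewrite mulrA.
have := sqnorm_ge0 l f.
have nfX : sqnorm l f <= a0 ^+ 2 + b0 ^+ 2 + sqnorm l f.
  by rewrite lerDr addr_ge0 ?sqr_ge0.
move: nfX; move: (a0 ^+ 2 + b0 ^+ 2 + sqnorm l f) => X.
move: (sqnorm l f) (sqnorm l u) (sqnorm l u2) (l * N).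
move=> nf nu nu2 lN nfX nf0 un u2n X0 N0.
split; first by apply: le_trans un _; rewrite ler_wpM2r//; nra.
apply: le_trans u2n _.
have := ler_wpM2l E0 un; have := mulr_ge0 N0 X0.
nra.
Qed.

End EdgeEquation.

(** * Square summable functions on the vertex lattice *)

(* For a nonnegative family this says that its sum is at most M. *)
Definition sums_le {R : realType} {V : choiceType} (a : V -> R) (M : R) :=
  forall s : seq V, uniq s -> \sum_(v <- s) a v <= M.

Lemma sums_le_comp {R : realType} {V W : choiceType} (a : W -> R) M (e : V -> W) :
  injective e -> sums_le a M -> sums_le (a \o e) M.
Proof.
by move=> ie aM s us; have := aM (map e s); rewrite map_inj_uniq// big_map; exact.
Qed.

Section FiniteSums.
Context {R : realType} {V : choiceType}.
Implicit Types (a b f g : V -> R) (s : seq V).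

Lemma sums_le_term a M v : sums_le a M -> a v <= M.
Proof. by move=> /(_ [:: v] isT); rewrite big_seq1. Qed.

Lemma sums_le_ge0 a M : sums_le a M -> 0 <= M.
Proof. by move=> /(_ [::] isT); rewrite big_nil. Qed.

Lemma sums_le_mono a b M : (forall v, a v <= b v) -> sums_le b M -> sums_le a M.
Proof. by move=> ab bM s us; apply: le_trans (bM s us); apply: ler_sum. Qed.

Lemma sums_leD a b M N : sums_le a M -> sums_le b N ->
  sums_le (fun v => a v + b v) (M + N).
Proof. by move=> aM bN s us; rewrite big_split/= lerD ?aM ?bN. Qed.

Lemma sums_leZ a (k M : R) : 0 <= k -> sums_le a M ->
  sums_le (fun v => k * a v) (k * M).
Proof. by move=> k0 aM s us; rewrite -mulr_sumr ler_wpM2l ?aM. Qed.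

Lemma sums_le_sum (I : finType) (a : I -> V -> R) (M : I -> R) :
  (forall i, sums_le (a i) (M i)) ->
  sums_le (fun v => \sum_i a i v) (\sum_i M i).
Proof. by move=> aM s us; rewrite exchange_big/=; apply: ler_sum => i _; exact: aM. Qed.

Lemma sums_le_esum a M : (forall v, 0 <= a v) -> sums_le a M ->
  (\esum_(v in [set: V]) (a v)%:E <= M%:E)%E.
Proof.
move=> a0 aM; apply: ge_ereal_sup => _ [A [finA _] <-].
by rewrite fsbig_finite// sumEFin lee_fin aM.
Qed.

Lemma sums_le_of_esum a M : (forall v, 0 <= a v) ->
  (\esum_(v in [set: V]) (a v)%:E <= M%:E)%E -> sums_le a M.
Proof.
move=> a0 aM s us; rewrite -lee_fin; apply: le_trans aM.
apply: esum_ge; exists [set` s]; first by split.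
by rewrite -fsbig_seq// sumEFin.
Qed.

Lemma esum_lty_sums_le a : (forall v, 0 <= a v) ->
  (\esum_(v in [set: V]) (a v)%:E < +oo)%E <-> exists M, sums_le a M.
Proof.
move=> a0; split=> [aoo|[M /(sums_le_esum _ _ a0) /le_lt_trans]]; last by apply; rewrite ltry.
have afin : (\esum_(v in [set: V]) (a v)%:E)%E \is a fin_num.
  rewrite ge0_fin_numE//; apply: esum_ge0 => v _; by rewrite lee_fin.
exists (fine (\esum_(v in [set: V]) (a v)%:E)%E).
by apply: sums_le_of_esum => //; rewrite fineK.
Qed.

Definition psum a : R := fine (\esum_(v in [set: V]) (a v)%:E)%E.

Lemma psumK a M : (forall v, 0 <= a v) -> sums_le a M ->
  (\esum_(v in [set: V]) (a v)%:E)%E = (psum a)%:E.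
Proof.
move=> a0 aM; rewrite /psum fineK// ge0_fin_numE.
  exact: (le_lt_trans (sums_le_esum _ _ a0 aM) (ltry _)).
by apply: esum_ge0 => v _; rewrite lee_fin.
Qed.

Lemma psum_sums_le a M : (forall v, 0 <= a v) -> sums_le a M -> sums_le a (psum a).
Proof. by move=> a0 aM; apply: sums_le_of_esum => //; rewrite (psumK _ M). Qed.

Lemma psum_le a M : (forall v, 0 <= a v) -> sums_le a M -> psum a <= M.
Proof. by move=> a0 aM; rewrite -lee_fin -(psumK _ M)// sums_le_esum. Qed.

Lemma psumD a b M N : (forall v, 0 <= a v) -> (forall v, 0 <= b v) ->
  sums_le a M -> sums_le b N -> psum (fun v => a v + b v) = psum a + psum b.
Proof.
move=> a0 b0 aM bN; apply: EFin_inj; rewrite EFinD.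
rewrite -(psumK a M)// -(psumK b N)// -(psumK (fun v => a v + b v) (M + N)).
- by rewrite -esumD// => v _; rewrite lee_fin.
- by move=> v; rewrite addr_ge0.
- exact: sums_leD.
Qed.

Lemma psum_reindex a (e e' : V -> V) : cancel e e' -> cancel e' e ->
  psum (a \o e) = psum a.
Proof.
move=> eK e'K; rewrite /psum; congr fine; symmetry; apply: reindex_esum.
split => //; first by move=> x y _ _; exact: (can_inj eK).
by move=> y _; exists (e' y) => //=; exact: e'K.
Qed.

Definition pos_part a v := Num.max (a v) 0.
Definition neg_part a v := Num.max (- a v) 0.
(** [fine] sends an infinite sum to 0, so this is the sum of the family only under [summ]. *)
Definition tot a : R := psum (pos_part a) - psum (neg_part a).

Let pos_ge0 a v : 0 <= pos_part a v. Proof. by rewrite le_max lexx orbT. Qed.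
Let neg_ge0 a v : 0 <= neg_part a v. Proof. by rewrite le_max lexx orbT. Qed.
Let posBneg a v : a v = pos_part a v - neg_part a v.
Proof. by rewrite /pos_part /neg_part; have [h|h] := leP (a v) 0; have [h'|h'] := leP (- a v) 0; lra. Qed.
Let pos_le a v : pos_part a v <= `|a v|.
Proof. by rewrite ge_max ler_norm normr_ge0. Qed.
Let neg_le a v : neg_part a v <= `|a v|.
Proof. by rewrite ge_max -normrN ler_norm normr_ge0. Qed.

Definition summ a := exists M, sums_le (fun v => `|a v|) M.

Lemma totE a p n M N : (forall v, 0 <= p v) -> (forall v, 0 <= n v) ->
  sums_le p M -> sums_le n N -> (forall v, a v = p v - n v) ->
  tot a = psum p - psum n.
Proof.
move=> p0 n0 pM nN aE.
have aMN : sums_le (fun v => `|a v|) (M + N).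
  apply: sums_le_mono (sums_leD _ _ _ _ pM nN) => v.
  by rewrite aE (le_trans (ler_normB _ _))// !ger0_norm.
have aP := sums_le_mono _ _ _ (pos_le a) aMN.
have aN := sums_le_mono _ _ _ (neg_le a) aMN.
have e : (fun v => pos_part a v + n v) = (fun v => neg_part a v + p v).
  by apply/funext => v; have := posBneg a v; rewrite aE; lra.
have := congr1 psum e; rewrite (psumD _ _ (M + N) N)// (psumD _ _ (M + N) M)//.
by rewrite /tot; lra.
Qed.

Lemma summ_pos a M : sums_le (fun v => `|a v|) M -> sums_le (pos_part a) M /\ sums_le (neg_part a) M.
Proof. by move=> aM; split; apply: sums_le_mono aM; [exact: pos_le|exact: neg_le]. Qed.

Lemma summD a b : summ a -> summ b -> summ (fun v => a v + b v).
Proof.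
move=> [M aM] [N bN]; exists (M + N).
by apply: sums_le_mono (sums_leD _ _ _ _ aM bN) => v; exact: ler_normD.
Qed.

Lemma totD a b : summ a -> summ b -> tot (fun v => a v + b v) = tot a + tot b.
Proof.
move=> [M aM] [N bN]; have [ap an] := summ_pos _ _ aM; have [bp bn] := summ_pos _ _ bN.
rewrite (totE _ (fun v => pos_part a v + pos_part b v) (fun v => neg_part a v + neg_part b v) (M + N) (M + N)).
- by rewrite !(psumD _ _ M N)// /tot; ring.
- by move=> v; rewrite addr_ge0.
- by move=> v; rewrite addr_ge0.
- exact: sums_leD.
- exact: sums_leD.
- by move=> v; rewrite {1}(posBneg a) {1}(posBneg b); ring.
Qed.

Lemma tot_reindex a (e e' : V -> V) : cancel e e' -> cancel e' e ->
  tot (a \o e) = tot a.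
Proof.
move=> eK e'K; rewrite /tot -(psum_reindex (pos_part a) e e')//.
by rewrite -(psum_reindex (neg_part a) e e').
Qed.

Lemma summ_comp a e : injective e -> summ a -> summ (a \o e).
Proof. by move=> ie [M aM]; exists M; apply: (sums_le_comp (fun v => `|a v|)). Qed.

(** Summation by parts on the lattice: each term may be translated by its own shift. *)
Lemma tot_sum_reindex (I : finType) (a : I -> V -> R) (e e' : I -> V -> V) :
  (forall i, cancel (e i) (e' i)) -> (forall i, cancel (e' i) (e i)) ->
  (forall i, summ (a i)) ->
  tot (fun v => \sum_i a i (e i v)) = tot (fun v => \sum_i a i v).
Proof.
move=> eK e'K sa.
have key : forall s : seq I,
    [/\ summ (fun v => \sum_(i <- s) a i v), summ (fun v => \sum_(i <- s) a i (e i v)) &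
    tot (fun v => \sum_(i <- s) a i (e i v)) = tot (fun v => \sum_(i <- s) a i v)].
  elim=> [|i s [s1 s2 IH]].
    split; last by congr tot; apply/funext => v; rewrite !big_nil.
    - by exists 0 => t _; rewrite big1// => v _; rewrite big_nil normr0.
    - by exists 0 => t _; rewrite big1// => v _; rewrite big_nil normr0.
  have e1 : (fun v => \sum_(j <- i :: s) a j v) = (fun v => a i v + \sum_(j <- s) a j v).
    by apply/funext => v; rewrite big_cons.
  have e2 : (fun v => \sum_(j <- i :: s) a j (e j v)) =
      (fun v => (a i \o e i) v + \sum_(j <- s) a j (e j v)).
    by apply/funext => v; rewrite big_cons.
  have sai : summ (a i \o e i) by apply: summ_comp => //; exact: can_inj (eK i).
  rewrite e1 e2; split; [exact: summD|exact: summD|].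
  by rewrite !totD// IH (tot_reindex _ _ (e' i)).
by have [_ _] := key (index_enum I).
Qed.

Lemma tot_le a M : sums_le (fun v => `|a v|) M -> tot a <= M.
Proof.
move=> aM; have [ap an] := summ_pos _ _ aM.
have := psum_le _ _ (pos_ge0 a) ap.
have := sums_le_ge0 _ _ (psum_sums_le _ _ (neg_ge0 a) an).
by rewrite /tot; lra.
Qed.

Lemma le_tot a s : (forall v, 0 <= a v) -> summ a -> uniq s -> \sum_(v <- s) a v <= tot a.
Proof.
move=> a0 [M aM] us.
have aM' : sums_le a M by apply: sums_le_mono aM => v; exact: ler_norm.
have z0 : sums_le (fun _ : V => 0 : R) 0 by move=> t _; rewrite big1.
rewrite (totE _ a (fun=> 0) M 0)//; last by move=> v; rewrite subr0.
have : psum (fun _ : V => 0 : R) <= 0 by exact: psum_le z0.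
have := psum_sums_le _ _ a0 aM' s us; lra.
Qed.

End FiniteSums.

(** * Nearest neighbour operators and the Neumann series *)

Section LatticeOperator.
Context {R : realType} {V : choiceType} {I : finType}.
Variables (e e' : I -> V -> V).
Hypothesis eK : forall i, cancel (e i) (e' i).
Hypothesis e'K : forall i, cancel (e' i) (e i).

Definition l2_le (f : V -> R) (M : R) := sums_le (fun v => f v ^+ 2) M.

Definition hop (w : I -> R) (f : V -> R) (v : V) : R :=
  \sum_i w i * (f (e i v) + f (e' i v)).

(** The polynomial B - 2 t C + t^2 A is a sum of |w_j| (x_j - t)^2 or |w_j| (x_j + t)^2, according
    to the sign of w_j; evaluate it at its minimum C / A. If A = 0, it is affine in t and
    nonnegative, so C = 0. *)
Lemma sum_weighted_sq (J : Type) (s : seq J) (w x : J -> R) :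
  (\sum_(j <- s) w j * x j) ^+ 2 <=
  (\sum_(j <- s) `|w j|) * (\sum_(j <- s) `|w j| * x j ^+ 2).
Proof.
set A := \sum_(j <- s) `|w j|; set B := \sum_(j <- s) _ * _ ^+ 2.
set C := \sum_(j <- s) _.
have A0 : 0 <= A by exact: sumr_ge0.
have h t : 0 <= B - 2 * t * C + t ^+ 2 * A.
  have -> : B - 2 * t * C + t ^+ 2 * A =
      \sum_(j <- s) (`|w j| * x j ^+ 2 - 2 * t * (w j * x j) + t ^+ 2 * `|w j|).
    by rewrite big_split/= sumrB -!mulr_sumr.
  apply: sumr_ge0 => j _; have [w0|w0] := leP 0 (w j).
    by rewrite ger0_norm//; have := sqr_ge0 (x j - t); nra.
  by rewrite ltr0_norm//; have := sqr_ge0 (x j + t); nra.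
have [A1|A1] := eqVneq A 0.
  suff -> : C = 0 by rewrite expr0n/= A1 mul0r.
  have B1 : 0 <= B by have := h 0; rewrite expr0n/= !(mulr0, mul0r) subr0 addr0.
  have h1 := h (B + 1); have h2 := h (- (B + 1)); rewrite A1 in h1 h2.
  have h3 t := h t; rewrite A1 in h3.
  apply/eqP; apply: contraT => C0; have := h3 ((B + 1) / (2 * C)).
  have -> : 2 * ((B + 1) / (2 * C)) * C = B + 1 by field.
  lra.
have Ap : 0 < A by rewrite lt_def A1.
have := h (C / A).
have -> : B - 2 * (C / A) * C + (C / A) ^+ 2 * A = (A * B - C ^+ 2) / A by field.
by rewrite pmulr_lge0 ?invr_gt0// subr_ge0.
Qed.

Lemma l2_le_comp f M (k : V -> V) : injective k -> l2_le f M -> l2_le (f \o k) M.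
Proof. by move=> ik; apply: (sums_le_comp (fun v => f v ^+ 2)). Qed.

(** Each shift preserves the norm, so the operator norm is at most the sum of the moduli of the
    weights; [sum_weighted_sq] stands in for the triangle inequality. *)
Lemma hop_l2 (w : I -> R) (rho : R) f M : \sum_i 2 * `|w i| <= rho ->
  l2_le f M -> l2_le (hop w f) (rho ^+ 2 * M).
Proof.
move=> wrho fM; have M0 := sums_le_ge0 _ _ fM.
pose S := \sum_i `|w i|.
have S0 : 0 <= S by exact: sumr_ge0.
have S2 : 2 * S <= rho by rewrite /S mulr_sumr.
have b1 : sums_le (fun v => S * \sum_i `|w i| * 2 * (f (e i v) ^+ 2 + f (e' i v) ^+ 2))
    (S * \sum_i (`|w i| * 2 * (M + M))).
  apply: sums_leZ => //; apply: sums_le_sum => i; apply: sums_leZ.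
    by rewrite mulr_ge0.
  apply: sums_leD.
    by apply: (l2_le_comp f M (e i)) => //; exact: can_inj (eK i).
  by apply: (l2_le_comp f M (e' i)) => //; exact: can_inj (e'K i).
have b2 : S * \sum_i (`|w i| * 2 * (M + M)) <= rho ^+ 2 * M.
  rewrite -mulr_suml -mulr_suml -/S.
  have : (2 * S) ^+ 2 <= rho ^+ 2 by rewrite lerXn2r ?nnegrE//; lra.
  by move=> /(ler_wpM2r M0); lra.
move=> s us; apply: le_trans b2; apply: le_trans (b1 s us).
apply: ler_sum => v _; apply: le_trans (sum_weighted_sq _ _ _ _) _.
rewrite ler_wpM2l//; apply: ler_sum => i _; rewrite -mulrA ler_wpM2l//.
by have := sqr_ge0 (f (e i v) - f (e' i v)); nra.
Qed.

Lemma hopZD (w : I -> R) (f g : V -> R) (k : R) v :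
  hop w (fun u => k * f u + g u) v = k * hop w f v + hop w g v.
Proof. by rewrite /hop mulr_sumr -big_split/=; apply: eq_bigr => i _; ring. Qed.

Lemma cvgn_sum (J : Type) (s : seq J) (u : J -> nat -> R) (x : J -> R) :
  (forall j, u j @ \oo --> x j) ->
  (fun n => \sum_(j <- s) u j n) @ \oo --> \sum_(j <- s) x j.
Proof.
move=> ux; elim: s => [|j s IH].
  rewrite big_nil (_ : (fun _ => _) = cst 0); first exact: cvg_cst.
  by apply/funext => n; rewrite big_nil.
rewrite big_cons (_ : (fun _ => _) = (fun n => u j n + \sum_(i <- s) u i n)).
  exact: cvgD.
by apply/funext => n; rewrite big_cons.
Qed.

Lemma cvg_hop (w : I -> R) (F : nat -> V -> R) (f : V -> R) v :
  (forall u, F ^~ u @ \oo --> f u) -> (fun n => hop w (F n) v) @ \oo --> hop w f v.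
Proof.
move=> Ff; apply: cvgn_sum => i; apply: cvgM; first exact: cvg_cst.
by apply: cvgD; exact: Ff.
Qed.

Lemma l2_le_lim (F : nat -> V -> R) (f : V -> R) M :
  (forall u, F ^~ u @ \oo --> f u) -> (forall n, l2_le (F n) M) -> l2_le f M.
Proof.
move=> Ff FM s us.
have c : (fun n => \sum_(v <- s) F n v ^+ 2) @ \oo --> \sum_(v <- s) f v ^+ 2.
  by apply: cvgn_sum => v; rewrite expr2; apply: cvgM; exact: Ff.
rewrite -(cvg_lim (@Rhausdorff R) c); apply: limr_le; first by apply/cvg_ex; eexists; exact: c.
by apply: nearW => n; exact: FM.
Qed.

(** The series converges pointwise by comparison with a geometric one; square summability of the
    limit comes from a uniform bound on the partial sums [F n]. *)
Lemma resolvent_series (w : I -> R) (rho : R) g G :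
  0 < rho < 1 -> \sum_i 2 * `|w i| <= rho -> l2_le g G ->
  exists2 f, (forall v, f v = g v + hop w f v) & exists M, l2_le f M.
Proof.
move=> /andP[rho0 rho1] wrho gG; have G0 := sums_le_ge0 _ _ gG.
pose d n := iter n (hop w) g.
have dG n : l2_le (d n) ((rho ^+ n) ^+ 2 * G).
  elim: n => [|n IH]; first by rewrite !expr0 expr1n mul1r.
  have -> : (rho ^+ n.+1) ^+ 2 * G = rho ^+ 2 * ((rho ^+ n) ^+ 2 * G).
    by rewrite (exprS _ n); ring.
  exact: hop_l2.
pose F n v : R := series (fun m => d m v) n.
have F0 v : F 0 v = 0 by rewrite /F /series/= big_nil.
have FD n v : F n.+1 v = F n v + d n v by rewrite /F seriesSr.
have FS n v : F n.+1 v = g v + hop w (F n) v.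
  elim: n v => [|n IH] v.
    rewrite FD F0 add0r /hop big1 ?addr0// => i _.
    by rewrite !F0 addr0 mulr0.
  rewrite FD IH -addrA; congr (_ + _).
  have -> : F n.+1 = (fun u => 1 * F n u + d n u).
    by apply/funext => u; rewrite FD mul1r.
  by rewrite hopZD mul1r.
have cF v : cvgn (F ^~ v).
  apply: normed_cvg.
  apply: (@series_le_cvg _ _ (geometric (Num.sqrt G) rho)).
  - by move=> n; exact: normr_ge0.
  - by move=> n; rewrite /geometric/= mulr_ge0 ?sqrtr_ge0 ?exprn_ge0 ?ltW.
  - move=> n; rewrite /=; have := sums_le_term _ _ v (dG n) => h.
    rewrite -sqrtr_sqr; apply: le_trans (ler_wsqrtr h) _.
    by rewrite sqrtrM ?sqr_ge0// sqrtr_sqr ger0_norm ?exprn_ge0 ?(ltW rho0)// mulrC.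
  - by apply: is_cvg_geometric_series; rewrite ger0_norm ?ltW.
pose f v := limn (F ^~ v).
have Ff v : F ^~ v @ \oo --> f v by exact: cF.
exists f => [v|].
  have := Ff v; rewrite -(cvg_shiftS (F ^~ v)) => h1.
  have h2 : (fun n => g v + hop w (F n) v) @ \oo --> g v + hop w f v.
    by apply: cvgD; [exact: cvg_cst|exact: cvg_hop].
  rewrite -(cvg_lim (@Rhausdorff R) h2) -(cvg_lim (@Rhausdorff R) h1).
  by congr (limn _); apply/funext => n; rewrite /= FS.
(* The bound that the triangle inequality would give. It is preserved by adding [g] to the image
   under [hop], because (x + y)^2 <= x^2 / (1 - rho) + y^2 / rho. *)
pose M := G / (1 - rho) ^+ 2.
have r1 : 0 < 1 - rho by lra.
have M0 : 0 <= M by rewrite divr_ge0 ?sqr_ge0.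
exists M; apply: (l2_le_lim F) => // n; elim: n => [|n IH].
  by move=> s us; rewrite big1// => v _; rewrite /F /series/= big_nil expr0n.
have hM := hop_l2 _ _ _ _ wrho IH.
have := sums_leD _ _ _ _ (sums_leZ _ (1 - rho)^-1 _ _ gG) (sums_leZ _ rho^-1 _ _ hM).
rewrite !invr_ge0 !ltW// => /(_ isT isT).
have -> : (1 - rho)^-1 * G + rho^-1 * (rho ^+ 2 * M) = M by rewrite /M; field; lra.
apply: sums_le_mono => v; rewrite FS; move: (g v) (hop _ _ _) => x y.
have : 0 <= (rho * x - (1 - rho) * y) ^+ 2 / (rho * (1 - rho)).
  by rewrite divr_ge0 ?sqr_ge0// mulr_ge0; lra.
have -> : (rho * x - (1 - rho) * y) ^+ 2 / (rho * (1 - rho)) =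
   (1 - rho)^-1 * x ^+ 2 + rho^-1 * y ^+ 2 - (x + y) ^+ 2 by field; lra.
lra.
Qed.

Lemma hop_fixpoint0 (w : I -> R) (rho : R) f M :
  0 < rho < 1 -> \sum_i 2 * `|w i| <= rho -> l2_le f M ->
  (forall v, f v = hop w f v) -> forall v, f v = 0.
Proof.
move=> /andP[rho0 rho1] wrho fM ff v.
have fn n : l2_le f ((rho ^+ 2) ^+ n * M).
  elim: n => [|n IH]; first by rewrite expr0 mul1r.
  rewrite exprS -mulrA; have -> : f = hop w f by apply/funext.
  exact: hop_l2.
have r2 : `|rho ^+ 2| < 1 by rewrite ger0_norm ?sqr_ge0// expr_lt1// ltW.
have c := @cvg_geometric R M (rho ^+ 2) r2.
apply/eqP; rewrite -sqrf_eq0 eq_le sqr_ge0 andbT.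
rewrite -(cvg_lim (@Rhausdorff R) c); apply: limr_ge; first by apply/cvg_ex; exists 0.
by apply: nearW => n; rewrite /geometric/= mulrC; exact: sums_le_term (fn n).
Qed.

End LatticeOperator.

Section SumsOverLattice.
Context {R : realType}.

Lemma ler_sum_incl {T : choiceType} (F : T -> R) (s t : seq T) :
  (forall x, 0 <= F x) -> uniq s -> {subset s <= t} ->
  \sum_(x <- s) F x <= \sum_(x <- t) F x.
Proof.
move=> F0 us st.
have p : perm_eq s [seq x <- undup t | x \in s].
  apply: uniq_perm => //; first by rewrite filter_uniq// undup_uniq.
  by move=> x; rewrite mem_filter mem_undup; case: (boolP (x \in s)) => // /st ->.
rewrite (perm_big _ p) big_filter.
have sub : \sum_(x <- undup t | x \in s) F x <= \sum_(x <- undup t) F x.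
  rewrite [leRHS](bigID (mem s))/= lerDl.
  exact: sumr_ge0.
apply: le_trans sub _.
elim: t {st p} => [|x t IH]; first by rewrite !big_nil.
rewrite /= big_cons; case: ifPn => _; first by rewrite (le_trans IH)// lerDr.
by rewrite big_cons lerD2l.
Qed.

Lemma sums_le_geometric (q : R) : 0 < q < 1 ->
  sums_le (fun z : int => q ^+ `|z|%N) (2 / (1 - q)).
Proof.
move=> /andP[q0 q1].
have nat_le : sums_le (fun n : nat => q ^+ n) (1 - q)^-1.
  move=> s us; pose N := (\max_(i <- s) i).+1.
  apply: (@le_trans _ _ (\sum_(i <- iota 0 N) q ^+ i)).
    apply: ler_sum_incl => //; first by move=> n; rewrite exprn_ge0// ltW.
    by move=> x xs; rewrite mem_iota/= add0n ltnS; exact: (@leq_bigmax_seq _ _ xpredT id _ xs).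
  have e : (1 - q) * \sum_(i <- iota 0 N) q ^+ i = 1 - q ^+ N.
    rewrite -{1}(subn0 N) -/(index_iota 0 N) big_mkord.
    by rewrite -[in RHS](expr1n _ N) subrXX; congr (_ * _); apply: eq_bigr => i _;
      rewrite expr1n mul1r.
  rewrite -(ler_pM2l (_ : 0 < 1 - q)) ?subr_gt0// e mulfV ?subr_eq0 ?gt_eqF//.
  by rewrite gerBl exprn_ge0// ltW.
move=> s us; rewrite (bigID (fun z : int => 0 <= z))/=.
have -> : 2 / (1 - q) = (1 - q)^-1 + (1 - q)^-1 by ring.
have part (P : pred int) : {in P &, injective absz} ->
    \sum_(z <- s | P z) q ^+ `|z|%N <= (1 - q)^-1.
  move=> ip; rewrite -big_filter.
  have := nat_le (map absz [seq z <- s | P z]); rewrite big_map; apply.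
  rewrite map_inj_in_uniq ?filter_uniq// => x y.
  by rewrite !mem_filter => /andP[Px _] /andP[Py _]; exact: ip.
by apply: lerD; apply: part => x y; rewrite /in_mem/=; lia.
Qed.

(** Finitely many vertices lie in a finite box, over which the sum of products factors. *)
Lemma sums_le_prod (d : nat) (a : int -> R) (K : R) : (forall z, 0 <= a z) ->
  sums_le a K -> sums_le (fun v : vertex d => \prod_j a (v j)) (K ^+ d).
Proof.
move=> a0 aK s us.
pose t := undup [seq (v : vertex d) j | v <- s, j <- enum 'I_d].
pose phi (f : {ffun 'I_d -> seq_sub t}) : vertex d := [ffun j => val (f j)].
have vt (v : vertex d) j : v \in s -> v j \in t.
  by move=> vs; rewrite mem_undup; apply/allpairsP; exists (v, j); rewrite mem_enum.
have sub : {subset s <= map phi (index_enum _)}.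
  move=> v vs; apply/mapP; exists [ffun j => SeqSub (vt v j vs)].
    by rewrite mem_index_enum.
  by apply/ffunP => j; rewrite !ffunE.
apply: le_trans (ler_sum_incl _ _ _ _ us sub) _; first by move=> v; exact: prodr_ge0.
rewrite big_map.
under eq_bigr do under eq_bigr do rewrite ffunE.
rewrite -(bigA_distr_bigA (fun _ (x : seq_sub t) => a (val x))).
rewrite prodr_const card_ord lerXn2r ?nnegrE ?(sums_le_ge0 _ _ aK)//.
  exact: sumr_ge0.
have := aK (map val (index_enum (seq_sub t))); rewrite big_map; apply.
by rewrite map_inj_uniq ?index_enum_uniq//; exact: val_inj.
Qed.

End SumsOverLattice.

(** * Plane waves with exponentially decaying cutoffs *)

Section BandSpectrum.
Context {R : realType} {d : nat}.
Local Notation V := (vertex d).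
Local Notation up := (fun (j : 'I_d) (v : V) => vshift v j 1).
Local Notation down := (fun (j : 'I_d) (v : V) => vshift v j (-1)).

Lemma vshiftK (j : 'I_d) (s : int) (v : V) : vshift (vshift v j s) j (- s) = v.
Proof. by apply/ffunP => i; rewrite !ffunE; case: eqP => _; rewrite ?addrK ?addr0. Qed.

Lemma vshift_upK (j : 'I_d) : cancel (up j) (down j).
Proof. by move=> v; exact: vshiftK. Qed.

Lemma vshift_downK (j : 'I_d) : cancel (down j) (up j).
Proof. by move=> v; rewrite -[RHS](vshiftK j (-1)) opprK. Qed.

Local Notation hop := (hop up down).

Lemma summ_mul (f g : V -> R) M N : l2_le f M -> l2_le g N ->
  sums_le (fun v => `|f v * g v|) (M + N).
Proof.
move=> fM gN; apply: sums_le_mono (sums_leD _ _ _ _ fM gN) => v.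
rewrite normrM -(real_normK (num_real (f v))) -(real_normK (num_real (g v))).
by have := sqr_ge0 (`|f v| - `|g v|); have := normr_ge0 (f v); have := normr_ge0 (g v); nra.
Qed.

(** The two opposite shifts in a direction are adjoint to each other; [tot_sum_reindex] moves them
    from [f] to [g]. *)
Lemma hop_selfadjoint (b : 'I_d -> R) (D : R) (f g : V -> R) M N :
  l2_le f M -> l2_le g N ->
  tot (fun v => (hop b f v - D * f v) * g v) =
  tot (fun v => f v * (hop b g v - D * g v)).
Proof.
move=> fM gN.
have sfg (k : R) (e : V -> V) : injective e -> summ (fun v => k * f v * g (e v)).
  move=> ie; have h := summ_mul _ _ _ _ fM (l2_le_comp _ _ e ie gN).
  exists (`|k| * (M + N)); apply: sums_le_mono (sums_leZ _ _ _ (normr_ge0 k) h) => v.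
  by rewrite -mulrA normrM.
have iu j := can_inj (vshift_upK j); have id_ j := can_inj (vshift_downK j).
have E1 := tot_sum_reindex _ (fun j v => b j * f v * g (down j v)) _ _ vshift_upK vshift_downK
  (fun j => sfg _ _ (id_ j)).
have E2 := tot_sum_reindex _ (fun j v => b j * f v * g (up j v)) _ _ vshift_downK vshift_upK
  (fun j => sfg _ _ (iu j)).
have summ_sum (F : 'I_d -> V -> R) : (forall j, summ (F j)) -> summ (fun v => \sum_j F j v).
  move=> sF; have [m mF] := choice sF; exists (\sum_j m j).
  by apply: sums_le_mono (sums_le_sum _ _ _ mF) => v; exact: ler_norm_sum.
have S0 : summ (fun v => - D * f v * g v) by exact: (sfg _ id).
have S1 : summ (fun v => \sum_j b j * f v * g (down j v)) by apply: summ_sum => j; exact: sfg.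
have S2 : summ (fun v => \sum_j b j * f v * g (up j v)) by apply: summ_sum => j; exact: sfg.
have S1' : summ (fun v => \sum_j b j * f (up j v) * g v).
  apply: summ_sum => j.
  have := summ_comp _ _ (iu j) (sfg (b j) _ (id_ j)).
  by under [X in summ X -> _]eq_fun do rewrite /= vshift_upK.
have S2' : summ (fun v => \sum_j b j * f (down j v) * g v).
  apply: summ_sum => j.
  have := summ_comp _ _ (id_ j) (sfg (b j) _ (iu j)).
  by under [X in summ X -> _]eq_fun do rewrite /= vshift_downK.
have -> : (fun v => (hop b f v - D * f v) * g v) = (fun v =>
    (\sum_j b j * f (up j v) * g v + \sum_j b j * f (down j v) * g v) + - D * f v * g v).
  apply/funext => v; rewrite /hop mulrBl -big_split/= mulr_suml mulNr mulNr; congr (_ - _).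
  by apply: eq_bigr => j _; ring.
have -> : (fun v => f v * (hop b g v - D * g v)) = (fun v =>
    (\sum_j b j * f v * g (down j v) + \sum_j b j * f v * g (up j v)) + - D * f v * g v).
  apply/funext => v; rewrite /hop mulrBr -big_split/= mulr_sumr.
  rewrite (_ : - D * f v * g v = - (f v * (D * g v))); last by ring.
  by congr (_ - _); apply: eq_bigr => j _; ring.
rewrite !totD//; try exact: summD.
congr (_ + _ + _).
  rewrite -E1; congr tot; apply/funext => v; apply: eq_bigr => j _.
  by rewrite vshift_upK.
rewrite -E2; congr tot; apply/funext => v; apply: eq_bigr => j _.
by rewrite vshift_downK.
Qed.

Definition expdecay (r : R) (v : V) : R := \prod_j r ^+ `|v j|%N.

(** A step changes one exponent by one, hence the value by a factor r or 1 / r, and 1 - r <= 1 / r -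
    1. The difference is small relative to the cutoff at the same vertex, everywhere on the
    lattice. *)
Lemma expdecay_shift (r : R) (v : V) j (s : int) : 0 < r < 1 -> `|s|%N = 1%N ->
  `|expdecay r (vshift v j s) - expdecay r v| <= (r^-1 - 1) * expdecay r v.
Proof.
move=> /andP[r0 r1] s1.
pose P := \prod_(i < d | i != j) r ^+ `|v i|%N.
have -> : expdecay r v = r ^+ `|v j|%N * P by rewrite /expdecay (bigD1 j).
have -> : expdecay r (vshift v j s) = r ^+ `|(v j + s)%R|%N * P.
  rewrite /expdecay (bigD1 j)//= ffunE eqxx; congr (_ * _).
  by apply: eq_bigr => i ij; rewrite ffunE (negbTE ij) addr0.
have P0 : 0 <= P by apply: prodr_ge0 => i _; rewrite exprn_ge0// ltW.
rewrite -mulrBl mulrA normrM (ger0_norm P0) ler_wpM2r//.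
have [m m0] : exists m, (`|(v j + s)%R| = m.+1 /\ `|v j| = m \/ `|(v j + s)%R| = m /\ `|v j| = m.+1)%N.
  by exists (minn `|(v j + s)%R| `|v j|)%N; lia.
have rm : 0 < r ^+ m by rewrite exprn_gt0.
have rV : 1 < r^-1 by rewrite invf_gt1.
have rVr : r^-1 * r = 1 by rewrite mulVf// gt_eqF.
have k1 : 1 - r <= r^-1 - 1 by nra.
have k2 : r^-1 * (r * r ^+ m) = r ^+ m by rewrite mulrA rVr mul1r.
case: m0 => -[-> ->]; rewrite exprS.
  rewrite ler0_norm; last by nra.
  have h : (1 - r) * r ^+ m <= (r^-1 - 1) * r ^+ m by rewrite ler_wpM2r// ltW.
  by lra.
rewrite ger0_norm; last by nra.
by rewrite [leRHS]mulrBl k2 mul1r.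
Qed.

Lemma expdecay_l2 (r : R) : 0 < r < 1 -> exists K, l2_le (expdecay r) K.
Proof.
move=> /andP[r0 r1].
have q : 0 < r ^+ 2 < 1 by rewrite exprn_gt0//= expr_lt1// ltW.
have h := sums_le_prod d _ _ _ (sums_le_geometric _ q).
eexists; apply: sums_le_mono (h _).
  move=> v; rewrite /expdecay -prodrXl; apply: ler_prod => j _.
  by rewrite sqr_ge0/= -!exprM mulnC.
by move=> z; rewrite exprn_ge0// ltW; case/andP: q.
Qed.

Lemma expdecay_itv (r : R) v : 0 < r < 1 -> 0 <= expdecay r v <= 1.
Proof.
move=> /andP[r0 r1]; apply/andP; split.
  by apply: prodr_ge0 => i _; rewrite exprn_ge0// ltW.
rewrite -[leRHS](_ : \prod_(j < d) 1 = 1); last by rewrite big1.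
by apply: ler_prod => j _; rewrite exprn_ge0 ?exprn_ile1 ?ltW.
Qed.

(* A plane wave in the kernel of the symbol reduces the operator to first
   differences of the cutoff, whose logarithm has small differences. *)
Lemma hop_plane_wave (b theta : 'I_d -> R) (D r : R) (xi : R -> R) :
  0 < r < 1 -> D = \sum_j 2 * b j * cos (theta j) ->
  (forall x t, xi (x + t) + xi (x - t) = 2 * cos t * xi x) -> (forall x, `|xi x| <= 1) ->
  let phi := fun v : V => xi (\sum_j theta j * (v j)%:~R) * expdecay r v in
  forall v, `|hop b phi v - D * phi v| <=
    (2 * \sum_j `|b j|) * (r^-1 - 1) * expdecay r v.
Proof.
move=> r01 DE xiD xi1 phi v; pose Th (u : V) := \sum_j theta j * (u j)%:~R.
have ThS j s : Th (vshift v j s) = Th v + theta j * s%:~R.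
  rewrite /Th [LHS](bigD1 j)//= [in RHS](bigD1 j)//= ffunE eqxx intrD mulrDr addrAC.
  congr (_ + _ + _); apply: eq_bigr => i ij.
  by rewrite ffunE (negbTE ij) addr0.
have -> : hop b phi v - D * phi v = \sum_j b j *
   (xi (Th v + theta j) * (expdecay r (up j v) - expdecay r v) +
    xi (Th v - theta j) * (expdecay r (down j v) - expdecay r v)).
  rewrite DE /hop mulr_suml -sumrB; apply: eq_bigr => j _.
  rewrite /phi -!/(Th _) !ThS intrN mulrN mulr1.
  have := xiD (Th v) (theta j).
  move: (xi (Th v + _)) (xi (Th v - _)) (xi (Th v)) => x1 x2 x3 h.
  have -> : x1 = 2 * cos (theta j) * x3 - x2 by rewrite -h addrK.
  ring.
apply: le_trans (ler_norm_sum _ _ _) _.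
rewrite mulr_sumr !mulr_suml.
apply: ler_sum => j _; rewrite normrM.
have h1 := expdecay_shift r v j 1 r01 erefl.
have h2 := expdecay_shift r v j (-1) r01 erefl.
have := xi1 (Th v + theta j); have := xi1 (Th v - theta j).
have b0 := normr_ge0 (b j).
have key (x y B : R) : `|x| <= 1 -> `|y| <= B -> `|x * y| <= B.
  by move=> x1 yB; rewrite normrM -[B]mul1r; exact: ler_pM.
move=> x2 x1; have e1 := key _ _ _ x1 h1; have e2 := key _ _ _ x2 h2.
have := le_trans (ler_normD _ _) (lerD e1 e2).
by move=> /(ler_wpM2l b0); lra.
Qed.

End BandSpectrum.

Section BandNoSolution.
Context {R : realType} {d : nat}.
Local Notation V := (vertex d).
Local Notation up := (fun (j : 'I_d) (v : V) => vshift v j 1).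
Local Notation down := (fun (j : 'I_d) (v : V) => vshift v j (-1)).
Local Notation hop := (hop up down).

(** Chosen so that 1 / rate - 1 = 4^-n, the relative size of the differences of the n-th cutoff. *)
Let rate (n : nat) : R := (1 + 1 / 4 ^+ n)^-1.

Let rate01 n : 0 < rate n < 1.
Proof.
have h : 0 < 1 / 4 ^+ n :> R by rewrite divr_gt0 ?exprn_gt0.
by apply/andP; rewrite /rate; split; [rewrite invr_gt0|rewrite invf_lt1]; lra.
Qed.

Let decay n : V -> R := expdecay (rate n).
Let mass n : R := psum (fun v => decay n v ^+ 2).

Let decay_l2 n : l2_le (decay n) (mass n).
Proof.
have [K hK] := expdecay_l2 (d := d) _ (rate01 n).
by apply: psum_sums_le hK => v; exact: sqr_ge0.
Qed.

Let decay_itv n v : 0 <= decay n v <= 1. Proof. exact: expdecay_itv. Qed.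

Let mass_ge1 n : 1 <= mass n.
Proof.
have := sums_le_term _ _ [ffun=> 0] (decay_l2 n).
rewrite (_ : decay n _ = 1) ?expr1n// /decay /expdecay big1// => j _.
by rewrite ffunE expr0.
Qed.

Let coef n : R := (Num.sqrt (mass n))^-1.

Let coef_itv n : [/\ 0 < coef n, coef n <= 1 & coef n ^+ 2 * mass n = 1].
Proof.
have m1 := mass_ge1 n; have m0 : 0 < mass n by lra.
have s1 : 1 <= Num.sqrt (mass n) by rewrite -sqrtr1 ler_wsqrtr.
have s0 : 0 < Num.sqrt (mass n) by lra.
split; first by rewrite invr_gt0.
  by rewrite invf_le1.
by rewrite exprVn sqr_sqrtr ?mulVf ?gt_eqF ?ltW.
Qed.

(* One weight tests all scales at once: its pairing with the n-th cutoff is at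
   least 2^-n times the norm of that cutoff, whereas a solution would make it 4^-n. *)
Let weight : exists h : V -> R,
  [/\ l2_le h 4, forall v, 0 <= h v & forall n v, (1 / 2 ^+ n) * (coef n * decay n v) <= h v].
Proof.
pose u v n : R := (1 / 2 ^+ n) * (coef n * decay n v).
have half_ge0 n : 0 <= 1 / 2 ^+ n :> R by rewrite divr_ge0 ?exprn_ge0.
have u0 v n : 0 <= u v n.
  have [c0 _ _] := coef_itv n; have /andP[b0 _] := decay_itv n v.
  by rewrite /u !mulr_ge0// ltW.
have uE n : 1 / 2 ^+ n = geometric 1 (1 / 2) n :> R.
  by rewrite /geometric/= !mul1r exprVn.
have half1 : `|1 / 2 : R| < 1 by rewrite ger0_norm; lra.
have half_sum N : \sum_(i < N) 1 / 2 ^+ i <= 2 :> R.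
  have e : \sum_(i < N) 1 / 2 ^+ i = 2 - 2 / 2 ^+ N :> R.
    elim: N => [|N IH]; first by rewrite big_ord0 expr0; lra.
    rewrite big_ord_recr/= IH exprS; field.
    by rewrite expf_neq0.
  by rewrite e lerBlDr lerDl divr_ge0 ?exprn_ge0.
have cu v : cvgn (series (u v)).
  apply: (@series_le_cvg _ _ (geometric 1 (1 / 2))).
  - exact: u0.
  - by move=> n; rewrite -uE.
  - move=> n; rewrite -uE /u -[leRHS]mulr1 ler_wpM2l//.
    have [c0 c1 _] := coef_itv n; have /andP[b0 b1] := decay_itv n v.
    by rewrite -[leRHS]mulr1; apply: ler_pM => //; exact: ltW.
  - exact: is_cvg_geometric_series.
pose h v := limn (series (u v)).
have hu n v : series (u v) n <= h v.
  by apply: nondecreasing_cvgn_le => //; apply: nondecreasing_series.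
exists h; split.
- apply: (l2_le_lim (fun n v => series (u v) n)) => [v|N]; first exact: cu.
  have lim_le : sums_le (fun v => 2 * \sum_(i < N) (1 / 2 ^+ i) * (coef i ^+ 2 * decay i v ^+ 2))
      (2 * \sum_(i < N) (1 / 2 ^+ i) * (coef i ^+ 2 * mass i)).
    apply: sums_leZ => //; apply: sums_le_sum => i; apply: sums_leZ => //.
    by apply: sums_leZ; [exact: sqr_ge0|exact: decay_l2].
  move=> s us; apply: le_trans (le_trans (lim_le s us) _).
    apply: ler_sum => v _; rewrite /series/= big_mkord.
    apply: le_trans (sum_weighted_sq _ _ _ _) _.
    have E : \sum_(i < N) `|1 / 2 ^+ i : R| = \sum_(i < N) 1 / 2 ^+ i.
      by apply: eq_bigr => i _; rewrite ger0_norm.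
    rewrite E.
    have E2 : \sum_(i < N) `|1 / 2 ^+ i : R| * (coef i * decay i v) ^+ 2 =
        \sum_(i < N) (1 / 2 ^+ i) * (coef i ^+ 2 * decay i v ^+ 2).
      by apply: eq_bigr => i _; rewrite ger0_norm// exprMn.
    rewrite E2 ler_wpM2r//; apply: sumr_ge0 => i _.
    by rewrite mulr_ge0// mulr_ge0 ?sqr_ge0.
  rewrite (_ : \sum_(i < N) _ = \sum_(i < N) 1 / 2 ^+ i); last first.
    by apply: eq_bigr => i _; have [_ _ ->] := coef_itv i; rewrite mulr1.
  by have := half_sum N; lra.
- move=> v; apply: le_trans (hu 0%N v); by rewrite /series/= big_nil.
- move=> n v; apply: le_trans (hu n.+1 v).
  by rewrite seriesSr lerDr /series/=; apply: sumr_ge0.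
Qed.

(** [g1] and [g2] are the real and imaginary parts of the weight times a plane wave. They are tested
    together because cos^2 + sin^2 = 1 leaves the bare pairing of the weight with the cutoff. *)
Lemma band_no_solution (b : 'I_d -> R) (D : R) :
  (forall j, b j != 0) -> `|D| <= 2 * \sum_j `|b j| ->
  exists g1 g2 : V -> R, [/\ exists M, l2_le g1 M, exists M, l2_le g2 M &
    forall f1 f2 M, l2_le f1 M -> l2_le f2 M ->
      (forall v, hop b f1 v - D * f1 v = g1 v) ->
      (forall v, hop b f2 v - D * f2 v = g2 v) -> False].
Proof.
move=> b0 Db; pose W := \sum_j `|b j|.
have W0 : 0 <= W by exact: sumr_ge0.
pose c := D / (2 * W).
have DE : D = c * (2 * W).
  have [W1|W1] := eqVneq W 0; last by rewrite /c; field.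
  rewrite W1 !mulr0; apply/eqP; rewrite -normr_eq0 eq_le normr_ge0 andbT.
  by apply: le_trans Db _; rewrite -/W W1 mulr0.
have c1 : -1 <= c <= 1.
  have [W1|W1] := eqVneq W 0; first by rewrite /c W1 mulr0 invr0 mulr0; lra.
  have Wp : 0 < 2 * W by rewrite mulr_gt0// lt_def W1.
  by rewrite -ler_norml /c normrM normfV (gtr0_norm Wp) ler_pdivrMr// mul1r.
(* Every direction contributes the same fraction [c] of its maximal symbol 2 |b_j|, the sign of b_j
   being absorbed into the angle; the total is then D, and |c| <= 1 is the band condition. *)
pose theta j := acos (Num.sg (b j) * c).
have cosE j : 2 * b j * cos (theta j) = c * (2 * `|b j|).
  rewrite acosK; last first.
    rewrite in_itv/=; have [s0|s0|s0] := ltrgt0P (b j).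
    - by rewrite gtr0_sg// mul1r.
    - by rewrite ltr0_sg//; lra.
    - by rewrite s0 sgr0 mul0r; lra.
  by rewrite normrEsg; ring.
have DE' : D = \sum_j 2 * b j * cos (theta j).
  by under eq_bigr do rewrite cosE; rewrite -mulr_sumr -mulr_sumr -/W.
have [h [h4 h0 hn]] := weight.
pose Th (v : V) := \sum_j theta j * (v j)%:~R.
exists (fun v => h v * cos (Th v)), (fun v => h v * sin (Th v)).
have l2h (xi : R -> R) : (forall x, `|xi x| <= 1) ->
    exists M, l2_le (fun v => h v * xi (Th v)) M.
  move=> xi1; exists 4; apply: sums_le_mono h4 => v; rewrite exprMn -[leRHS]mulr1.
  rewrite ler_wpM2l ?sqr_ge0// -(real_normK (num_real (xi _))).
  by rewrite expr_le1.
split; [exact/l2h/cos_max|exact/l2h/sin_max|].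
move=> f1 f2 M f1M f2M e1 e2.
have M0 := sums_le_ge0 _ _ f1M.
have cosP x t : cos (x + t) + cos (x - t) = 2 * cos t * cos x :> R.
  by rewrite cosD cosB; ring.
have sinP x t : sin (x + t) + sin (x - t) = 2 * cos t * sin x :> R.
  by rewrite sinD sinB; ring.
(* Self-adjointness moves the operator from the solution onto the truncated wave, where it is 4^-n
   times the cutoff up to a constant. *)
have pair n (xi : R -> R) f :
    (forall x t, xi (x + t) + xi (x - t) = 2 * cos t * xi x) -> (forall x, `|xi x| <= 1) ->
    l2_le f M -> (forall v, hop b f v - D * f v = h v * xi (Th v)) ->
    tot (fun v => h v * xi (Th v) * (xi (Th v) * decay n v)) <=
      W * (1 / 4 ^+ n) * (Num.sqrt (mass n) * (M + 1)) /\
    summ (fun v => h v * xi (Th v) * (xi (Th v) * decay n v)).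
  move=> xiP xi1 fM fE.
  have phil2 : l2_le (fun v => xi (Th v) * decay n v) (mass n).
    apply: sums_le_mono (decay_l2 n) => v; rewrite exprMn -[leRHS]mul1r.
    by rewrite ler_wpM2r ?sqr_ge0// -(real_normK (num_real (xi _))) expr_le1.
  have [N hN] := l2h _ xi1.
  split; last by eexists; exact: summ_mul hN phil2.
  under [X in tot X]eq_fun do rewrite -fE.
  rewrite (hop_selfadjoint _ _ _ _ _ _ fM phil2); apply: tot_le.
  have := hop_plane_wave b theta D (rate n) xi (rate01 n) DE' xiP xi1.
  rewrite -/W /rate invrK => hp.
  have [c0 _ cm] := coef_itv n; pose S := Num.sqrt (mass n).
  have Sc : S * coef n = 1 by rewrite /coef mulfV// gt_eqF// -invr_gt0.
  have S0 : 0 < S by rewrite -invr_gt0.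
  have e0 : 0 <= W * (1 / 4 ^+ n) by rewrite mulr_ge0// divr_ge0 ?exprn_ge0.
  have := sums_leZ _ (W * (1 / 4 ^+ n)) _ e0 (sums_leD _ _ _ _ (sums_leZ _ S _ (ltW S0) fM)
     (sums_leZ _ (coef n) _ (ltW c0) (decay_l2 n))).
  have -> : S * M + coef n * mass n = S * (M + 1).
    rewrite mulrDr mulr1; congr (_ + _).
    by rewrite -[RHS]mulr1 -cm; rewrite mulrA expr2 !mulrA Sc mul1r.
  apply: sums_le_mono => v; rewrite normrM.
  have := ler_wpM2l (normr_ge0 (f v)) (hp v); move=> /le_trans; apply.
  rewrite -/(decay n v) [1 + _ - 1]addrAC subrr add0r.
  have /andP[bv0 _] := decay_itv n v.
  rewrite -(real_normK (num_real (f v))); move: (`|f v|) (decay n v) bv0 => x y y0.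
  (* The mean inequality with weights S and 1 / S, so that the sum is S (M + 1) rather than M plus
     the whole mass S^2. *)
  have : 2 * (x * y) <= S * x ^+ 2 + coef n * y ^+ 2.
    have := mulr_ge0 (ltW c0) (sqr_ge0 (S * x - y)).
    have -> : coef n * (S * x - y) ^+ 2 =
       (S * coef n) * S * x ^+ 2 - 2 * (S * coef n) * (x * y) + coef n * y ^+ 2 by ring.
    by rewrite Sc; lra.
  by move=> /(ler_wpM2l e0); lra.
(* The pairing is at least 2^-n S by the choice of [h], and at most a constant times 4^-n S if
   solutions exist, where S is the norm of the n-th cutoff. *)
have key n : 2 ^+ n <= 2 * W * (M + 1) :> R.
  have [t1 s1] := pair n _ _ cosP (@cos_max R) f1M e1.
  have [t2 s2] := pair n _ _ sinP (@sin_max R) f2M e2.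
  have tsum : tot (fun v => h v * decay n v) <=
      2 * W * (1 / 4 ^+ n) * (Num.sqrt (mass n) * (M + 1)).
    have -> : (fun v => h v * decay n v) = (fun v =>
       h v * cos (Th v) * (cos (Th v) * decay n v) + h v * sin (Th v) * (sin (Th v) * decay n v)).
      apply/funext => v; have := cos2Dsin2 (Th v).
      move: (cos _) (sin _) => x y xy; rewrite -[LHS]mulr1 -xy; ring.
    by rewrite totD//; lra.
  have [c0 _ cm] := coef_itv n.
  have S0 : 0 < Num.sqrt (mass n) by rewrite -invr_gt0.
  have p2 : 0 < 2 ^+ n :> R by rewrite exprn_gt0.
  have p4 : 4 ^+ n = 2 ^+ n * 2 ^+ n :> R by rewrite -exprMn; congr (_ ^+ _); lra.
  have mle : mass n <= 2 ^+ n * Num.sqrt (mass n) * tot (fun v => h v * decay n v).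
    apply: psum_le => [v|s us]; first exact: sqr_ge0.
    have hb0 v : 0 <= h v * decay n v.
      by rewrite mulr_ge0//; case/andP: (decay_itv n v).
    have hs : summ (fun v => h v * decay n v).
      by eexists; exact: summ_mul h4 (decay_l2 n).
    have := le_tot _ _ hb0 hs us => /(ler_wpM2l (ltW (mulr_gt0 p2 S0))); apply: le_trans.
    rewrite mulr_sumr; apply: ler_sum => v _.
    have /andP[bv0 _] := decay_itv n v.
    have := ler_wpM2r bv0 (ler_wpM2l (ltW (mulr_gt0 p2 S0)) (hn n v)).
    rewrite -[leRHS]mulrA; apply: le_trans.
    have -> : 2 ^+ n * Num.sqrt (mass n) * (1 / 2 ^+ n * (coef n * decay n v)) * decay n v =
      (Num.sqrt (mass n) * coef n) * decay n v ^+ 2 by field; rewrite gt_eqF.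
    by rewrite /coef mulfV ?gt_eqF// mul1r.
  have m1 := mass_ge1 n.
  have mS : mass n = Num.sqrt (mass n) * Num.sqrt (mass n).
    by rewrite -expr2 sqr_sqrtr//; lra.
  have := le_trans mle (ler_wpM2l (ltW (mulr_gt0 p2 S0)) tsum).
  rewrite p4; have -> : 2 ^+ n * Num.sqrt (mass n) * (2 * W * (1 / (2 ^+ n * 2 ^+ n)) *
     (Num.sqrt (mass n) * (M + 1))) = (2 * W * (M + 1) / 2 ^+ n) *
      (Num.sqrt (mass n) * Num.sqrt (mass n)) by field; rewrite gt_eqF.
  rewrite -mS -[leLHS]mul1r ler_pM2r; last by lra.
  by rewrite ler_pdivlMr// mul1r.
have [n nle] : exists n : nat, 2 * W * (M + 1) < n%:R.
  exists (Num.truncn (2 * W * (M + 1))).+1; exact: truncnS_gt.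
have := key n; rewrite leNgt => /negP; apply.
apply: lt_le_trans nle _; rewrite -natrX ler_nat; by apply: ltnW; exact: ltn_expl.
Qed.

End BandNoSolution.

(** * From the quantum graph to the lattice *)

Section Graph.
Context {R : realType} {d : nat}.
Variable len : 'I_d -> R.
Hypothesis len_gt0 : forall j, 0 < len j.
Local Notation mu := (@lebesgue_measure R).
Local Notation V := (vertex d).
Local Notation up := (fun (j : 'I_d) (v : V) => vshift v j 1).
Local Notation down := (fun (j : 'I_d) (v : V) => vshift v j (-1)).
Local Notation hop := (hop up down).

Lemma L2_graphP (g : edge d -> R -> R) : L2_graph len g <->
  (forall e, L2_on (len e.2) (g e)) /\
  exists M, sums_le (fun e : edge d => sqnorm (len e.2) (g e)) M.
Proof.
have int_ge0 (e : edge d) : (0 <= \int[mu]_(x in `[0%R, len e.2]) ((g e x) ^+ 2)%:E)%E.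
  by apply: integral_ge0 => x _; rewrite lee_fin sqr_ge0.
have eqL : (forall e, L2_on (len e.2) (g e)) ->
    (\esum_(e in [set: edge d]) \int[mu]_(x in `[0%R, len e.2]) ((g e x) ^+ 2)%:E)%E =
    (\esum_(e in [set: edge d]) (sqnorm (len e.2) (g e))%:E)%E.
  by move=> gL; apply: eq_esum => e _; exact: L2_on_sqnorm.
have sq0 e : 0 <= sqnorm (len e.2) (g e) by exact: sqnorm_ge0.
split=> [[mg goo]|[gL gM]].
  have gL e : L2_on (len e.2) (g e).
    split; first exact: mg.
    apply: le_lt_trans goo; apply: esum_ge; exists [set e]; first by split.
    by rewrite fsbig_set1.
  split => //; apply/(esum_lty_sums_le _ sq0); by rewrite -eqL.
split; first by move=> e; case: (gL e).
by rewrite eqL//; apply/esum_lty_sums_le.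
Qed.

Lemma sums_le_edge (a : edge d -> R) (M : 'I_d -> R) :
  (forall j, sums_le (fun v => a (v, j)) (M j)) -> sums_le a (\sum_j M j).
Proof.
move=> aM s us.
have -> : \sum_(e <- s) a e = \sum_j \sum_(e <- s | e.2 == j) a e.
  rewrite (exchange_big_dep xpredT)//=; apply: eq_bigr => e _.
  by rewrite (big_pred1 e.2)// => j; rewrite eq_sym.
apply: ler_sum => j _; rewrite -big_filter.
have := aM j (map fst [seq e <- s | e.2 == j]); rewrite big_map.
rewrite map_inj_in_uniq ?filter_uniq// => [/(_ isT)|[x1 x2] [y1 y2]]; last first.
  by rewrite !mem_filter/= => /andP[/eqP-> _] /andP[/eqP-> _] ->.
apply: le_trans; rewrite le_eqVlt; apply/orP; left; apply/eqP.
rewrite !big_filter; apply: eq_bigr => -[v i] /= /eqP ->//.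
Qed.

Lemma H2_repP (l : R) (u u1 u2 : R -> R) : 0 < l ->
  H2_rep l u u1 u2 <-> [/\ L2_on l u2, primitive_on l u u1 & primitive_on l u1 u2].
Proof.
move=> l0; split=> [[u2L h]|[u2L [_ hu] [_ hu1]]]; last first.
  by split => // x; rewrite /= in_itv/= => xl; rewrite -hu// -hu1.
have h' x : 0 <= x <= l -> u1 x = u1 0 + \int[mu]_(t in `[0, x]) u2 t /\
    u x = u 0 + \int[mu]_(t in `[0, x]) u1 t.
  by move=> xl; apply: h; rewrite /= in_itv.
have p1 : primitive_on l u1 u2.
  by split; [exact: L2_on_integrable|move=> x /h' []].
split=> //; split; last by move=> x /h' [].
apply: continuous_compact_integrable; first exact: segment_compact.
exact: primitive_on_continuous (ltW l0) p1.
Qed.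

(** [j0] selects one outgoing edge per vertex, on which [edge_trace] bounds the vertex value. *)
Lemma solves_vertex_values (alpha E : R) (u f : edge d -> R -> R) (j0 : 'I_d) :
  L2_graph len f -> solves len alpha E u f ->
  exists (val : V -> R) (u1 u2 : edge d -> R -> R),
  [/\ forall v j, u (v, j) 0 = val v /\ u (v, j) (len j) = val (up j v),
      exists M, l2_le val M,
      forall e, edge_solution (len e.2) E (u e) (u1 e) (u2 e) (f e) &
      forall v, \sum_j (u1 (v, j) 0 - u1 (down j v, j) (len j)) = alpha * val v].
Proof.
move=> /L2_graphP[fL _] [u1 [u2 [H2 [/L2_graphP[uL [Mu uM]] [/L2_graphP[u2L [M2 u2M]]
  [/choice[val valP] ode]]]]]].
have H2' e := (H2_repP _ _ _ _ (len_gt0 e.2)).1 (H2 e).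
have val0 v j : u (v, j) 0 = val v by have [/(_ j)[]] := valP v.
exists val, u1, u2; split.
- move=> v j; split=> //.
  by have [/(_ j)[_ <-] _] := valP (up j v); rewrite vshift_upK.
- have [K K0 tr] := edge_trace (len j0) (len_gt0 j0).
  exists (K * (Mu + M2)).
  have ie : injective (fun v : V => (v, j0)) by move=> x y [].
  have h := sums_leZ _ _ _ K0 (sums_leD _ _ _ _ (sums_le_comp _ _ _ ie uM)
    (sums_le_comp _ _ _ ie u2M)).
  apply: sums_le_mono h => v /=; rewrite -(val0 v j0).
  have [L p1 p2] := H2' (v, j0); exact: tr p2.
- by move=> e; have [L p1 p2] := H2' e; split => //; exact: ode.
- by move=> v; have [_] := valP v.
Qed.

End Graph.

(** * Reduction to a difference equation for the vertex values *)

Section Criteria.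
Context {R : realType} {d : nat}.
Variables (len : 'I_d -> R) (alpha E : R) (S C : R -> R).
Hypothesis len_gt0 : forall j, 0 < len j.
Hypothesis SC : fundamental_pair E S C.
Local Notation mu := (@lebesgue_measure R).
Local Notation V := (vertex d).
Local Notation up := (fun (j : 'I_d) (v : V) => vshift v j 1).
Local Notation down := (fun (j : 'I_d) (v : V) => vshift v j (-1)).
Local Notation hop := (hop up down).

Definition pairS (l : R) (g : R -> R) := \int[mu]_(t in `[0, l]) (g t * S t).
Definition pairC (l : R) (g : R -> R) := \int[mu]_(t in `[0, l]) (g t * C t).

(** [edge_wronskian] at x = l. The slopes stay multiplied by S(l), so that the last identity also
    covers S(l) = 0, where it becomes the propagation rule of [spectrum_flat]. *)
Lemma edge_endpoints (l : R) u u1 u2 f : 0 < l -> edge_solution l E u u1 u2 f ->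
  [/\ u l = S l * (u1 0 - pairC l f) + C l * (u 0 + pairS l f),
      S l * u1 0 = u l - C l * u 0 + S l * pairC l f - C l * pairS l f &
      - (S l * u1 l) = u 0 - C l * u l + pairS l f].
Proof.
move=> l0 es; have := edge_wronskian _ _ _ _ _ _ _ _ l0 SC es l.
rewrite lexx ltW// -/(pairS l f) -/(pairC l f) => /(_ isT)[h1 h2].
have [_ _ /(_ l) SC1 _] := SC.
have e : u l = S l * (u1 0 - pairC l f) + C l * (u 0 + pairS l f).
  rewrite -h2 (_ : u 0 + pairS l f = - (u1 l * S l - u l * C l)); last by rewrite h1; ring.
  by rewrite -[LHS]mulr1 -SC1; ring.
split=> //; first by rewrite e; ring.
by move: h1; lra.
Qed.

Lemma edge_solution_unique (l : R) u u1 u2 w w1 w2 f : 0 < l ->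
  edge_solution l E u u1 u2 f -> edge_solution l E w w1 w2 f ->
  u 0 = w 0 -> u1 0 = w1 0 -> forall x, 0 <= x <= l -> u x = w x.
Proof.
move=> l0 eu ew u0 u10 x xl.
have [h1 h2] := edge_wronskian _ _ _ _ _ _ _ _ l0 SC eu _ xl.
have [h3 h4] := edge_wronskian _ _ _ _ _ _ _ _ l0 SC ew _ xl.
have [_ _ /(_ x) SC1 _] := SC.
have e1 : u1 x * S x - u x * C x = w1 x * S x - w x * C x by rewrite h1 h3 u0.
have e2 : u1 x * C x + E * (u x * S x) = w1 x * C x + E * (w x * S x).
  by rewrite h2 h4 u10.
rewrite -[LHS]mulr1 -[RHS]mulr1 -SC1.
have g y y1 : y * (C x ^+ 2 + E * S x ^+ 2) =
  S x * (y1 * C x + E * (y * S x)) - C x * (y1 * S x - y * C x) by ring.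
by rewrite (g (u x) (u1 x)) (g (w x) (w1 x)) e1 e2.
Qed.

Definition weight_S (j : 'I_d) : R := (S (len j))^-1.
Definition symbol_const : R := alpha + \sum_j 2 * (C (len j) / S (len j)).
Definition vertex_source (f : edge d -> R -> R) (v : V) : R :=
  \sum_j (pairC (len j) (f (v, j)) - C (len j) / S (len j) * pairS (len j) (f (v, j))
     + pairS (len j) (f (down j v, j)) / S (len j)).

(** Dividing the slope formulas by S(l) separates neighbour values, the value at [v] and the
    contribution of [f]. As an identity between defects it serves both the passage to the lattice
    and the way back. *)
Lemma kirchhoffE (val : V -> R) (u1 : edge d -> R -> R) f :
  (forall j, S (len j) != 0) ->
  (forall v j, S (len j) * u1 (v, j) 0 = val (up j v) - C (len j) * val v
     + S (len j) * pairC (len j) (f (v, j)) - C (len j) * pairS (len j) (f (v, j))) ->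
  (forall v j, - (S (len j) * u1 (v, j) (len j)) =
     val v - C (len j) * val (up j v) + pairS (len j) (f (v, j))) ->
  forall v, \sum_j (u1 (v, j) 0 - u1 (down j v, j) (len j)) - alpha * val v =
    hop weight_S val v - symbol_const * val v + vertex_source f v.
Proof.
move=> S0 h1 h2 v.
rewrite /hop /symbol_const /vertex_source mulrDl mulr_suml opprD.
rewrite [RHS](_ : _ = \sum_j weight_S j * (val (up j v) + val (down j v))
   - \sum_i 2 * (C (len i) / S (len i)) * val v + vertex_source f v - alpha * val v); last first.
  by rewrite /vertex_source; ring.
congr (_ - _); rewrite -sumrB -big_split/=; apply: eq_bigr => j _.
have Sj := S0 j.
have e1 : u1 (v, j) 0 = (S (len j) * u1 (v, j) 0) / S (len j) by field.
have e2 : u1 (down j v, j) (len j) =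
  - ((- (S (len j) * u1 (down j v, j) (len j))) / S (len j)) by field.
by rewrite e1 e2 h1 h2 vshift_downK /weight_S; field.
Qed.

Lemma pairSC_bound : exists2 K : R, 0 <= K & forall (j : 'I_d) g, L2_on (len j) g ->
  pairS (len j) g ^+ 2 <= K * sqnorm (len j) g /\ pairC (len j) g ^+ 2 <= K * sqnorm (len j) g.
Proof.
pose KS j := 1 + sqnorm (len j) S; pose KC j := 1 + sqnorm (len j) C.
have KS0 j : 0 <= KS j by rewrite addr_ge0 ?sqnorm_ge0.
have KC0 j : 0 <= KC j by rewrite addr_ge0 ?sqnorm_ge0.
exists (\sum_j (KS j + KC j)); first by apply: sumr_ge0 => j _; rewrite addr_ge0.
move=> j g gL; have [_ _ _ /(_ _ (len_gt0 j))[pS pC]] := SC.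
have le K : K <= KS j + KC j -> K * sqnorm (len j) g <=
    (\sum_j (KS j + KC j)) * sqnorm (len j) g.
  move=> Kle; rewrite ler_wpM2r ?sqnorm_ge0// (le_trans Kle)//.
  by rewrite (bigD1 j)//= lerDl; apply: sumr_ge0 => i _; rewrite addr_ge0.
split.
  apply: le_trans (le (KS j) _); last by rewrite lerDl.
  by apply: Rintegral_cauchy_schwarz => //; exact: primitive_on_continuous (ltW _) pS.
apply: le_trans (le (KC j) _); last by rewrite lerDr.
by apply: Rintegral_cauchy_schwarz => //; exact: primitive_on_continuous (ltW _) pC.
Qed.

Lemma vertex_source_l2 f : L2_graph len f -> exists M, l2_le (vertex_source f) M.
Proof.
move=> /L2_graphP[fL [M fM]]; have [K K0 hK] := pairSC_bound.
pose c j := C (len j) / S (len j).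
pose n := \sum_(j < d) 1 : R.
pose F j (v : V) := 3 * (K * sqnorm (len j) (f (v, j)) +
  (c j ^+ 2 * (K * sqnorm (len j) (f (v, j))) +
  (S (len j))^-1 ^+ 2 * (K * sqnorm (len j) (f (down j v, j))))).
have iv (j : 'I_d) : injective (fun v : V => (v, j)) by move=> x y [].
have idn j : injective (down j) := can_inj (vshift_downK j).
have hv j := sums_le_comp _ _ _ (iv j) fM.
have Fle j : exists m, sums_le (F j) m.
  eexists; apply: sums_leZ => //; apply: sums_leD; first exact: sums_leZ (hv j).
  apply: sums_leD; apply: sums_leZ; rewrite ?sqr_ge0//; first exact: sums_leZ (hv j).
  by apply: sums_leZ => //; exact: (sums_le_comp _ _ _ (idn j) (hv j)).
have [m mF] := choice Fle.
have n0 : 0 <= n by exact: sumr_ge0.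
have := sums_leZ _ n _ n0 (sums_le_sum _ _ _ mF).
move=> h; eexists; apply: sums_le_mono h => v.
have := sum_weighted_sq _ (index_enum 'I_d) (fun=> 1) (fun j => pairC (len j) (f (v, j))
   - c j * pairS (len j) (f (v, j)) + pairS (len j) (f (down j v, j)) / S (len j)).
under eq_bigr do rewrite mul1r; move=> /le_trans; apply.
rewrite (eq_bigr (fun=> 1)); last by move=> j _; rewrite normr1.
rewrite ler_wpM2l//; apply: ler_sum => j _; rewrite normr1 mul1r /F.
have [h1 h2] := hK _ _ (fL (v, j)); have [h3 _] := hK _ _ (fL (down j v, j)).
move: h1 h2 h3 => /=.
move: (pairC _ _) (pairS _ (f (v, j))) (pairS _ (f (vshift _ _ _, _))) => x y z h1 h2 h3.
have cq : 0 <= c j ^+ 2 by exact: sqr_ge0.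
have sq : 0 <= (S (len j))^-1 ^+ 2 by exact: sqr_ge0.
have k1 := ler_wpM2l cq h1; have k2 := ler_wpM2l sq h3.
move: k1 k2; move: (c j) (S (len j))^-1 => p q k1 k2.
have : (x - p * y + z * q) ^+ 2 <= 3 * (x ^+ 2 + (p ^+ 2 * y ^+ 2 + q ^+ 2 * z ^+ 2)).
  have := sqr_ge0 (x + p * y); have := sqr_ge0 (x - z * q); have := sqr_ge0 (p * y + z * q).
  lra.
by move=> /le_trans; apply; lra.
Qed.

(** On each edge the vertex values prescribe the initial value and, through [slope], the initial
    derivative that makes the far end match; [edge_existence] fills in the edge. *)
Lemma solves_from_vertex (val : V -> R) f : (forall j, S (len j) != 0) ->
  L2_graph len f -> (exists M, l2_le val M) ->
  (forall v, hop weight_S val v - symbol_const * val v = - vertex_source f v) ->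
  exists u, solves len alpha E u f.
Proof.
move=> S0 /L2_graphP[fL [Mf fM]] [M valM] eqn.
have [K K0 hK] := pairSC_bound.
pose slope (e : edge d) := (val (up e.2 e.1) - C (len e.2) * val e.1) / S (len e.2)
   + pairC (len e.2) (f e) - C (len e.2) / S (len e.2) * pairS (len e.2) (f e).
have ex j := edge_existence (len j) E S C (len_gt0 j) SC.
have exK j : exists k : R, 0 <= k /\ forall f a0 b0, L2_on (len j) f ->
  exists u u1 u2, [/\ edge_solution (len j) E u u1 u2 f, u 0 = a0, u1 0 = b0,
    L2_on (len j) u /\ L2_on (len j) u2 &
    sqnorm (len j) u <= k * (a0 ^+ 2 + b0 ^+ 2 + sqnorm (len j) f) /\
    sqnorm (len j) u2 <= k * (a0 ^+ 2 + b0 ^+ 2 + sqnorm (len j) f)].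
  by have [k k0 hk] := ex j; exists k.
have [KE KEP] := choice exK.
have exe (e : edge d) : exists t : (R -> R) * (R -> R) * (R -> R),
   [/\ edge_solution (len e.2) E t.1.1 t.1.2 t.2 (f e), t.1.1 0 = val e.1, t.1.2 0 = slope e,
    L2_on (len e.2) t.1.1 /\ L2_on (len e.2) t.2 &
    sqnorm (len e.2) t.1.1 <= KE e.2 * (val e.1 ^+ 2 + slope e ^+ 2 + sqnorm (len e.2) (f e)) /\
    sqnorm (len e.2) t.2 <= KE e.2 * (val e.1 ^+ 2 + slope e ^+ 2 + sqnorm (len e.2) (f e))].
  have [_ /(_ (f e) (val e.1) (slope e) (fL e))[u [u1 [u2 h]]]] := KEP e.2.
  by exists (u, u1, u2).
have [t tP] := choice exe.
pose u e := (t e).1.1; pose u1 e := (t e).1.2; pose u2 e := (t e).2.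
have es e : edge_solution (len e.2) E (u e) (u1 e) (u2 e) (f e) by have [] := tP e.
have u0 e : u e 0 = val e.1 by have [] := tP e.
have u10 e : u1 e 0 = slope e by have [] := tP e.
have iv (j : 'I_d) : injective (fun v : V => (v, j)) by move=> x y [].
have bound : exists B, sums_le (fun e : edge d =>
    KE e.2 * (val e.1 ^+ 2 + slope e ^+ 2 + sqnorm (len e.2) (f e))) B.
  have bj j : exists B, sums_le (fun v : V =>
      KE j * (val v ^+ 2 + slope (v, j) ^+ 2 + sqnorm (len j) (f (v, j)))) B.
    have [k0 _] := KEP j.
    have hf := sums_le_comp _ _ _ (iv j) fM.
    have hu := l2_le_comp val M (up j) (can_inj (vshift_upK j)) valM.
    pose p := (S (len j))^-1; pose q := C (len j) * p.
    suff [B hB] : exists B, sums_le (fun v => slope (v, j) ^+ 2) B.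
      eexists; apply: sums_leZ => //; apply: sums_leD; last exact: hf.
      by apply: sums_leD; [exact: valM|exact: hB].
    have h := sums_leZ _ 4 _ (ltW (ltr0Sn _ 3)) (sums_leD _ _ _ _
      (sums_leD _ _ _ _ (sums_leZ _ _ _ (sqr_ge0 p) hu) (sums_leZ _ _ _ (sqr_ge0 q) valM))
      (sums_leD _ _ _ _ (sums_leZ _ _ _ K0 hf)
         (sums_leZ _ _ _ (sqr_ge0 q) (sums_leZ _ _ _ K0 hf)))).
    eexists; apply: sums_le_mono h => v /=.
    have [h1 h2] := hK _ _ (fL (v, j)); move: h1 h2 => /= h1 h2.
    have k2 := ler_wpM2l (sqr_ge0 q) h1; rewrite /slope/=.
    move: h1 h2 k2; rewrite -/(p) -/(q).
    move: (val (vshift _ _ _)) (val v) (pairC _ _) (pairS _ _) (K * _) => x y z w N h1 h2 k2.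
    rewrite (_ : (x - C (len j) * y) * p = p * x - q * y); last by rewrite /q; ring.
    have := sqr_ge0 (p * x + q * y); have := sqr_ge0 (p * x - z).
    have := sqr_ge0 (p * x + q * w); have := sqr_ge0 (q * y + z).
    have := sqr_ge0 (q * y - q * w); have := sqr_ge0 (z + q * w).
    lra.
  have [B hB] := choice bj; exists (\sum_j B j).
  by apply: sums_le_edge.
have [B hB] := bound.
have ends v j := edge_endpoints _ _ _ _ _ (len_gt0 j) (es (v, j)).
have ul v j : u (v, j) (len j) = val (up j v).
  by have [-> _ _] := ends v j; rewrite u0 u10 /slope/=; field; exact: S0.
exists u, u1, u2; split; [|split; [|split; [|split]]].
- move=> e; have [h _ _ [L1 L2] _] := tP e; have [p1 p2 _ _] := h.
  by apply/H2_repP.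
- apply/L2_graphP; split; first by move=> e; have [_ _ _ []] := tP e.
  by exists B; apply: sums_le_mono hB => e; have [_ _ _ _ []] := tP e.
- apply/L2_graphP; split; first by move=> e; have [_ _ _ []] := tP e.
  by exists B; apply: sums_le_mono hB => e; have [_ _ _ _ []] := tP e.
- move=> v; exists (val v); split.
    by move=> j; rewrite u0/= ul vshift_downK.
  apply/eqP; rewrite -subr_eq0 (kirchhoffE val u1 f)//.
  + by rewrite eqn addNr.
  + by move=> w j; have [_ -> _] := ends w j; rewrite ul u0.
  + by move=> w j; have [_ _ ->] := ends w j; rewrite ul u0.
- by move=> e; have [_ _ _] := es e.
Qed.

Lemma solves_vertex_eq (j0 : 'I_d) u f : (forall j, S (len j) != 0) ->
  L2_graph len f -> solves len alpha E u f ->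
  exists (val : V -> R) (u1 u2 : edge d -> R -> R),
  [/\ exists M, l2_le val M,
      forall e, edge_solution (len e.2) E (u e) (u1 e) (u2 e) (f e),
      forall e, u e 0 = val e.1,
      forall v j, S (len j) * u1 (v, j) 0 = val (up j v) - C (len j) * val v
     + S (len j) * pairC (len j) (f (v, j)) - C (len j) * pairS (len j) (f (v, j)) &
      forall v, hop weight_S val v - symbol_const * val v = - vertex_source f v].
Proof.
move=> S0 fL /(solves_vertex_values len len_gt0 _ _ _ _ j0 fL)[val [u1 [u2 [uv vM es kir]]]].
have ends v j := edge_endpoints _ _ _ _ _ (len_gt0 j) (es (v, j)).
have h1 v j : S (len j) * u1 (v, j) 0 = val (up j v) - C (len j) * val v
     + S (len j) * pairC (len j) (f (v, j)) - C (len j) * pairS (len j) (f (v, j)).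
  by have [_ -> _] := ends v j; have [-> ->] := uv v j.
exists val, u1, u2; split=> //.
  by move=> [v j]; have [] := uv v j.
move=> v; apply/eqP; rewrite -subr_eq0 opprK -(kirchhoffE val u1 f)//.
  by rewrite kir subrr.
by move=> w j; have [_ _ ->] := ends w j; have [-> ->] := uv w j.
Qed.

End Criteria.

Section SpectrumCriteria.
Context {R : realType} {d : nat}.
Variables (len : 'I_d -> R) (alpha E : R) (S C : R -> R).
Hypothesis len_gt0 : forall j, 0 < len j.
Hypothesis SC : fundamental_pair E S C.
Local Notation mu := (@lebesgue_measure R).
Local Notation V := (vertex d).
Local Notation up := (fun (j : 'I_d) (v : V) => vshift v j 1).
Local Notation down := (fun (j : 'I_d) (v : V) => vshift v j (-1)).
Local Notation hop := (hop up down).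
Local Notation b := (weight_S len S).
Local Notation D := (symbol_const len alpha S C).

Lemma resolvent_criterion (j0 : 'I_d) : (forall j, S (len j) != 0) ->
  2 * \sum_j `|b j| < `|D| -> resolvent len alpha E.
Proof.
move=> S0 bD.
have D0 : D != 0.
  rewrite -normr_gt0; apply: le_lt_trans bD.
  by rewrite mulr_ge0//; exact: sumr_ge0.
have Dp : 0 < `|D| by rewrite normr_gt0.
pose w j := b j / D.
have wE : \sum_j 2 * `|w j| = (2 * \sum_j `|b j|) / `|D|.
  rewrite mulr_sumr mulr_suml; apply: eq_bigr => j _.
  by rewrite /w normf_div mulrA.
(* The maximum with 1/2 keeps [rho] positive, since the series argument divides by it. *)
pose rho := Num.max (1 / 2) (\sum_j 2 * `|w j|).
have rho01 : 0 < rho < 1.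
  have h1 : \sum_j 2 * `|w j| < 1 by rewrite wE ltr_pdivrMr// mul1r.
  have h2 : 0 < 1 / 2 :> R by lra.
  have h3 : 1 / 2 < 1 :> R by lra.
  by rewrite lt_max gt_max h1 h2 h3.
have wrho : \sum_j 2 * `|w j| <= rho by rewrite le_max lexx orbT.
have hopw f v : hop w f v = hop b f v / D.
  by rewrite /hop mulr_suml; apply: eq_bigr => j _; rewrite /w; ring.
have ex f : L2_graph len f -> exists u, solves len alpha E u f.
  move=> fL; have [M sM] := vertex_source_l2 _ _ _ _ len_gt0 SC f fL.
  pose g v := D^-1 * vertex_source len S C f v.
  have gM : l2_le g (D^-1 ^+ 2 * M).
    by apply: sums_le_mono (sums_leZ _ _ _ (sqr_ge0 D^-1) sM) => v; rewrite exprMn.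
  have [val valE valM] := resolvent_series _ _ vshift_upK vshift_downK w rho g _ rho01 wrho gM.
  apply: (solves_from_vertex _ alpha _ _ _ len_gt0 SC val f S0 fL valM) => v.
  have h : D * val v = vertex_source len S C f v + hop b val v.
    by rewrite [in LHS]valE hopw /g; field.
  by rewrite h; ring.
have uniq f u u' : L2_graph len f -> solves len alpha E u f ->
    solves len alpha E u' f -> L2_eq len u u'.
  move=> fL su su'.
  have [val [u1 [u2 [[M valM] es u0 u10 eqn]]]] :=
    solves_vertex_eq _ _ _ _ _ len_gt0 SC j0 u f S0 fL su.
  have [val' [u1' [u2' [[M' valM'] es' u0' u10' eqn']]]] :=
    solves_vertex_eq _ _ _ _ _ len_gt0 SC j0 u' f S0 fL su'.
  pose dl v := -1 * val' v + val v.
  have dlM : l2_le dl (2 * (M' + M)).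
    apply: sums_le_mono (sums_leZ _ 2 _ _ (sums_leD _ _ _ _ valM' valM)) => //.
    by move=> v; rewrite /dl; have := sqr_ge0 (val v + val' v); lra.
  have dl0 v : dl v = 0.
    apply: (hop_fixpoint0 _ _ vshift_upK vshift_downK w rho dl _ rho01 wrho dlM) => {}v.
    rewrite hopw hopZD mulN1r; have := eqn v; rewrite -(eqn' v) => h.
    apply: (mulIf D0); rewrite divfK// /dl; lra.
  have vv v : val v = val' v by have := dl0 v; rewrite /dl; lra.
  move=> [v j]; apply: aeW => x; rewrite /= in_itv/= => xl.
  apply: (edge_solution_unique _ _ _ SC _ _ _ _ _ _ _ _ (len_gt0 j) (es (v, j)) (es' (v, j)) _ _ _ xl).
    by rewrite u0 u0' vv.
  by apply: (mulfI (S0 j)); rewrite u10 u10' !vv.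
move=> f1 f2 f1L f2L; split.
  by have [u su] := ex _ f1L; have [w' sw] := ex _ f2L; exists u, w'.
by move=> u w' u' w'' s1 s2 s3 s4; split; [exact: uniq s3|exact: uniq s4].
Qed.

Lemma supported_source_L2 (j0 : 'I_d) (G : V -> R) (eta : R -> R) M :
  L2_on (len j0) eta -> l2_le G M ->
  L2_graph len (fun e => if e.2 == j0 then (fun x => G e.1 * eta x) else fun=> 0).
Proof.
move=> eL GM; apply/L2_graphP.
have zL l : L2_on l (fun=> 0 : R) /\ sqnorm l (fun=> 0 : R) = 0.
  have z : (fun x : R => 0 * (0 : R)) = (fun=> 0) by apply/funext => x; rewrite mul0r.
  have cz : {within `[0, l], continuous (fun=> 0 : R)}.
    by apply: continuous_subspaceT => x; exact: cst_continuous.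
  have := L2_onZ l 0 _ (L2_on_continuous _ _ cz).
  by rewrite z expr0n/= mul0r.
split.
  move=> [v j] /=; case: eqP => [->|_]; last by have [] := zL (len j).
  by have [] := L2_onZ _ (G v) _ eL.
exists (\sum_j (if j == j0 then sqnorm (len j0) eta * M else 0)).
apply: sums_le_edge => j /=; case: eqP => [->|_].
  apply: sums_le_mono (sums_leZ _ (sqnorm (len j0) eta) _ (sqnorm_ge0 _ _) GM) => v.
  by have [_ ->] := L2_onZ _ (G v) _ eL; rewrite mulrC.
by move=> s us; rewrite big1// => v _; have [_ ->] := zL (len j).
Qed.

(** Any square summable right-hand side [g] of the lattice equation is realised on the graph: put
    -g(v) times the [eta] of [cutoff_source] on the edge (v, j0). The pair from [band_no_solution]
    then contradicts solvability. *)
Lemma spectrum_band (j0 : 'I_d) : (forall j, S (len j) != 0) ->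
  `|D| <= 2 * \sum_j `|b j| -> spectrum len alpha E.
Proof.
move=> S0 Db res.
have b0 j : b j != 0 by rewrite invr_eq0.
have [g1 [g2 [[M1 g1M] [M2 g2M] nosol]]] := band_no_solution b D b0 Db.
have [etaL etaS etaC] := cutoff_source (len j0) E S C (len_gt0 j0) SC.
set eta := (fun x => _) in etaL etaS etaC.
pose f (g : V -> R) (e : edge d) : R -> R :=
  if e.2 == j0 then (fun x => - g e.1 * eta x) else fun=> 0.
have fL g M : l2_le g M -> L2_graph len (f g).
  move=> gM; apply: (supported_source_L2 j0 (fun v => - g v) eta M) => //.
  by apply: sums_le_mono gM => v; rewrite sqrrN.
have [_ _ _ /(_ _ (len_gt0 j0))[pS pC]] := SC.
have ei := L2_on_integrable _ _ etaL.
have eSi := integrable_mul_continuous _ _ _ ei (primitive_on_continuous _ _ _ (ltW (len_gt0 j0)) pS).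
have eCi := integrable_mul_continuous _ _ _ ei (primitive_on_continuous _ _ _ (ltW (len_gt0 j0)) pC).
have pS0 l : pairS S l (fun=> 0) = 0.
  rewrite /pairS; under eq_Rintegral do rewrite mul0r.
  by rewrite Rintegral_cst// mul0r.
have pC0 l : pairC C l (fun=> 0) = 0.
  rewrite /pairC; under eq_Rintegral do rewrite mul0r.
  by rewrite Rintegral_cst// mul0r.
have pSf g v j : pairS S (len j) (f g (v, j)) = 0.
  rewrite /f/=; case: eqP => [->|_]; last exact: pS0.
  rewrite /pairS; under eq_Rintegral do rewrite -mulrA.
  by rewrite RintegralZl// etaS mulr0.
have pCf g v j : pairC C (len j) (f g (v, j)) = if j == j0 then - g v else 0.
  rewrite /f/=; case: eqP => [->|_]; last exact: pC0.
  rewrite /pairC; under eq_Rintegral do rewrite -mulrA.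
  by rewrite RintegralZl// etaC mulr1.
have src g v : vertex_source len S C (f g) v = - g v.
  rewrite /vertex_source (bigD1 j0)//= !pSf pCf eqxx mulr0 subr0 mul0r addr0.
  rewrite big1 ?addr0// => j jj0.
  by rewrite !pSf pCf (negbTE jj0) mulr0 mul0r subr0 addr0.
have [[u [w [su sw]]] _] := res _ _ (fL _ _ g1M) (fL _ _ g2M).
have [val [u1 [u2 [[M valM] _ _ _ eqn]]]] :=
  solves_vertex_eq _ _ _ _ _ len_gt0 SC j0 u _ S0 (fL _ _ g1M) su.
have [val' [u1' [u2' [[M' valM'] _ _ _ eqn']]]] :=
  solves_vertex_eq _ _ _ _ _ len_gt0 SC j0 w _ S0 (fL _ _ g2M) sw.
have M0 := sums_le_ge0 _ _ valM; have M0' := sums_le_ge0 _ _ valM'.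
apply: (nosol val val' (M + M')).
- by move=> s us; apply: le_trans (valM s us) _; rewrite lerDl.
- by move=> s us; apply: le_trans (valM' s us) _; rewrite lerDr.
- by move=> v; rewrite eqn src opprK.
- by move=> v; rewrite eqn' src opprK.
Qed.

Lemma l2_le_const_ray (g : V -> R) (M : R) (e : nat -> V) : injective e -> l2_le g M ->
  (forall n, g (e n) ^+ 2 = g (e 0%N) ^+ 2) -> g (e 0%N) = 0.
Proof.
move=> ie gM cst; apply/eqP; rewrite -sqrf_eq0; apply: contraT => g0.
have gp : 0 < g (e 0%N) ^+ 2 by rewrite lt_def g0 sqr_ge0.
pose N := (Num.truncn (M / g (e 0%N) ^+ 2)).+1.
have := gM (map e (iota 0 N)); rewrite map_inj_uniq// iota_uniq => /(_ isT).
rewrite big_map (eq_bigr (fun=> g (e 0%N) ^+ 2)); last by move=> n _; exact: cst.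
rewrite big_const_seq count_predT size_iota iter_addr_0 -mulr_natl -ler_pdivlMr//.
by rewrite leNgt truncnS_gt.
Qed.

(* Along a line of edges with S(l) = 0 the vertex values propagate with constant
   modulus, so a source on one edge has no square summable response. *)
Lemma spectrum_flat (j : 'I_d) : S (len j) = 0 -> spectrum len alpha E.
Proof.
move=> Sj res; have l0 := len_gt0 j; set l := len j in Sj l0.
have [_ _ /(_ l) SC1 /(_ l l0)[pS _]] := SC.
rewrite Sj expr0n/= mulr0 addr0 in SC1.
(* Its values are -1 at 0 and 0 at [l]; applied to it, the last identity of [edge_endpoints] says
   that its source pairs to 1 with S. *)
pose lin x := x / l - 1.
have plin : primitive_on l lin (fun=> l^-1).
  apply: primitive_on_derive => //; last by move=> x; exact: cst_continuous.
  by move=> x; rewrite /lin; apply: is_derive_eq; rewrite /GRing.scale/=; lra.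
pose eta x := - 0 - E * lin x.
have clin := primitive_on_continuous _ _ _ (ltW l0) plin.
have etaL : L2_on l eta.
  apply: L2_on_continuous => x; apply: cvgB; first exact: cvg_cst.
  by apply: cvgM; [exact: cvg_cst|exact: clin].
have es : edge_solution l E lin (fun=> l^-1) (fun=> 0) eta.
  by split => //; [exact: primitive_on_cst|apply: aeW].
have etaS : pairS S l eta = 1.
  have [_ _] := edge_endpoints _ _ _ SC _ _ _ _ _ l0 es.
  by rewrite Sj mul0r /lin mul0r divff ?gt_eqF// subrr mulr0; lra.
pose G (v : V) : R := if v == [ffun=> 0] then 1 else 0.
have GM : l2_le G 1.
  move=> s us; rewrite /G.
  have [s0|s0] := boolP ([ffun=> 0] \in s); last first.
    rewrite big_seq big1// => v vs; case: eqP => [ve|_]; last by rewrite expr0n.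
    by rewrite -ve vs in s0.
  rewrite (big_rem _ s0)/= eqxx expr1n big_seq big1 ?addr0// => v.
  by rewrite mem_rem_uniq// inE => /andP[/negbTE -> _]; rewrite expr0n.
pose f (e : edge d) : R -> R := if e.2 == j then (fun x => G e.1 * eta x) else fun=> 0.
have fL : L2_graph len f by exact: supported_source_L2 etaL GM.
have [[u [_ [su _]]] _] := res _ _ fL fL.
have [val [u1 [u2 [uv [M valM] esu _]]]] := solves_vertex_values len len_gt0 _ _ _ _ j fL su.
have ei := L2_on_integrable _ _ etaL.
have eSi := integrable_mul_continuous _ _ _ ei (primitive_on_continuous _ _ _ (ltW l0) pS).
have prop v : C l * val (up j v) = val v + G v.
  have [_ _] := edge_endpoints _ _ _ SC _ _ _ _ _ l0 (esu (v, j)).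
  have [-> ->] := uv v j; rewrite Sj mul0r oppr0.
  have -> : pairS S l (f (v, j)) = G v.
    rewrite /f/= eqxx /pairS; under eq_Rintegral do rewrite -mulrA.
    by rewrite RintegralZl// -/(pairS S l eta) etaS mulr1.
  by rewrite -/l; lra.
pose pt (z : int) : V := [ffun i => if i == j then z else 0].
have ptS z : up j (pt z) = pt (z + 1).
  by apply/ffunP => i; rewrite !ffunE; case: eqP => // _; rewrite addr0.
have ptI z z' : pt z = pt z' -> z = z'.
  by move=> /ffunP /(_ j); rewrite !ffunE eqxx.
have pt0 : pt 0 = [ffun=> 0] by apply/ffunP => i; rewrite !ffunE; case: ifP.
have Gz z : G (pt z) = if z == 0 then 1 else 0.
  rewrite /G -pt0; case: (eqVneq z 0) => [->|z0]; first by rewrite eqxx.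
  by case: eqP => // /ptI /eqP; rewrite (negbTE z0).
have sq z : z != 0 -> val (pt (z + 1)) ^+ 2 = val (pt z) ^+ 2.
  move=> z0; have := prop (pt z); rewrite ptS Gz (negbTE z0) addr0 => <-.
  by rewrite exprMn SC1 mul1r.
(* C(l)^2 = 1 and the source sits at 0 only, so the modulus of [val] is constant on the ray forward
   from 1 and on the ray backward from 0. Both values vanish, against the unit jump between them. *)
have v1 : val (pt 1) = 0.
  apply: (l2_le_const_ray val M (fun n : nat => pt (1 + n%:Z))) => //.
    by move=> x y /ptI; lia.
  elim=> [//|n IH]; rewrite -IH -[RHS]sq; last by lia.
  by congr (val (pt _) ^+ 2); lia.
have v0 : val (pt 0) = 0.
  apply: (l2_le_const_ray val M (fun n : nat => pt (0 - n%:Z))) => //.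
    by move=> x y /ptI; lia.
  elim=> [//|n IH]; rewrite -IH -sq; last by lia.
  by congr (val (pt _) ^+ 2); lia.
have := prop (pt 0); rewrite ptS Gz eqxx v0 add0r v1 mulr0 => /eqP.
by rewrite add0r eq_sym oner_eq0.
Qed.

End SpectrumCriteria.

(** * Band condition for the rectangular lattice *)

Section HalfTangent.
Context {R : realType}.

Definition htan (r : R) : R := tan (pi / 2 * r).

Let half_lt (r : R) : 0 <= r < 1 -> 0 <= pi / 2 * r < pi / 2.
Proof.
have p0 := @pi_gt0 R; move=> /andP[r0 r1]; apply/andP; split.
  by rewrite mulr_ge0//; lra.
by rewrite gtr_pMr//; lra.
Qed.

Let cos_pos (x : R) : 0 <= x < pi / 2 -> 0 < cos x.
Proof.
have p0 := @pi_gt0 R; move=> /andP[x0 x1]; apply: cos_gt0_pihalf.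
by rewrite x1 andbT; lra.
Qed.

Lemma htan0 : htan 0 = 0. Proof. by rewrite /htan mulr0 tan0. Qed.

Lemma htan_half : htan (1 / 2) = 1.
Proof. by rewrite -[RHS]tan_piquarter /htan; congr tan; field. Qed.

Lemma htan_lt x y : 0 <= x -> x < y -> y < 1 -> htan x < htan y.
Proof.
move=> x0 xy y1; have p0 := @pi_gt0 R.
have /andP[hx0 hx1] : 0 <= pi / 2 * x < pi / 2 by apply: half_lt; rewrite x0 (lt_trans xy).
have /andP[hy0 hy1] : 0 <= pi / 2 * y < pi / 2.
  by apply: half_lt; rewrite y1 andbT (le_trans x0)// ltW.
rewrite /htan ltr_tan ?in_itv/=; last 2 first.
- by rewrite hx1 andbT; lra.
- by rewrite hy1 andbT; lra.
by rewrite ltr_pM2l//; lra.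
Qed.

Lemma htan_le x y : 0 <= x -> x <= y -> y < 1 -> htan x <= htan y.
Proof.
move=> x0; rewrite le_eqVlt => /predU1P[->//|xy y1]; exact/ltW/htan_lt.
Qed.

Lemma htan_ge0 x : 0 <= x < 1 -> 0 <= htan x.
Proof. by move=> /andP[x0 x1]; rewrite -htan0 htan_le. Qed.

Let tan_mvt (a b : R) : 0 <= a -> a < b -> b < pi / 2 ->
  exists2 c, a < c < b & tan b - tan a = (cos c) ^- 2 * (b - a).
Proof.
move=> a0 ab bp.
have [x xab|x|c + e] := @MVT R tan (fun x => (cos x) ^- 2) a b ab.
- apply: is_derive_tan; rewrite gt_eqF// cos_pos//; move: xab; rewrite in_itv/= => /andP[ax xb].
  by rewrite (le_trans a0 (ltW ax)) (lt_trans xb).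
- apply: continuous_in_subspaceT => y; rewrite inE/= in_itv/= => /andP[ay yb].
  by apply: continuous_tan; rewrite gt_eqF// cos_pos// (le_trans a0 ay) (le_lt_trans yb).
- by rewrite in_itv/= => cab; exists c.
Qed.

Lemma htan_ge_linear r : 0 <= r < 1 -> pi / 2 * r <= htan r.
Proof.
rewrite /htan => /half_lt/andP[]; rewrite le_eqVlt => /predU1P[<- _|r0 r1].
  by rewrite tan0.
have [c /andP[c0 cr]] := tan_mvt _ _ (lexx 0) r0 r1.
rewrite tan0 !subr0 => ->; rewrite ler_peMl ?(ltW r0)//.
have cp : 0 < cos c by rewrite cos_pos// (ltW c0) (lt_trans cr).
by rewrite -exprVn expr_ge1 ?invr_ge0 ?(ltW cp)// invf_ge1// cos_le1.
Qed.

(** Mean value points on [0, x] and [x, y] are ordered, and 1 / cos^2 increases. *)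
Let tan_convex (x y : R) : 0 < x -> x < y -> y < pi / 2 -> y * tan x <= x * tan y.
Proof.
move=> x0 xy yp; have xp := lt_trans xy yp.
have [c /andP[c0 cx]] := tan_mvt _ _ (lexx 0) x0 xp; rewrite tan0 !subr0 => e1.
have [e /andP[xe ey] e2] := tan_mvt _ _ (ltW x0) xy yp.
have cp : 0 < cos c by rewrite cos_pos// (ltW c0) (lt_trans cx).
have ep : 0 < cos e by rewrite cos_pos// (ltW (lt_trans x0 xe)) (lt_trans ey).
have cose : cos e <= cos c.
  have p0 := @pi_gt0 R; have ce := lt_trans cx xe.
  have e_pi := lt_trans ey yp.
  rewrite ltW// ltr_cos// in_itv/=; apply/andP; split; lra.
have : (cos c) ^- 2 <= (cos e) ^- 2.
  by rewrite lef_pV2 ?posrE ?exprn_gt0// lerXn2r// nnegrE ltW.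
have -> : tan y = tan x + cos e ^- 2 * (y - x) by rewrite -e2; ring.
rewrite e1; set p := _ ^- 2; set q := _ ^- 2 => pq.
have : 0 <= x * (y - x) by rewrite mulr_ge0//; lra.
by move=> /ler_wpM2r /(_ _ _ pq); lra.
Qed.

(** With t the tangent, doubling gives tan(pi/6), and pi/6 + pi/12 = pi/4 then yields (t + 1) (t^2 -
    4 t + 1) = 0; the positive root below 1 is the one wanted. *)
Lemma tan_pi_12 : tan (pi / 12) = 2 - Num.sqrt 3 :> R.
Proof.
have p0 := @pi_gt0 R.
have c12 : 0 < cos (pi / 12 : R) by apply: cos_pos; apply/andP; split; lra.
have c6 : 0 < cos (pi / 6 : R) by apply: cos_pos; apply/andP; split; lra.
set t := tan (pi / 12).
have t0 : 0 < t by rewrite divr_gt0// sin_gt0_pihalf//; apply/andP; split; lra.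
have t1 : t < 1.
  rewrite -tan_piquarter ltr_tan ?in_itv/=; try (apply/andP; split); lra.
have e6 : tan (pi / 6) = 2 * t / (1 - t ^+ 2).
  have -> : pi / 6 = pi / 12 *+ 2 :> R by rewrite mulr2n; field.
  by rewrite tan_mulr2n ?gt_eqF// -/t mulr_natl.
have t2 : 1 - t ^+ 2 != 0 by rewrite gt_eqF//; nra.
have := @tan_piquarter R; have -> : pi / 4 = pi / 6 + pi / 12 :> R by field.
rewrite tanD ?gt_eqF// -/t => h.
have d0 : 1 - tan (pi / 6) * t != 0.
  by apply/eqP => d0; move: h; rewrite d0 invr0 mulr0 => /eqP; rewrite eq_sym oner_eq0.
have {h} : tan (pi / 6) + t = 1 - tan (pi / 6) * t.
  by move: h => /(congr1 (fun z => z * (1 - tan (pi / 6) * t))); rewrite divfK// mul1r.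
rewrite e6 => h.
have {h} : (t + 1) * (t ^+ 2 - 4 * t + 1) = 0.
  have -> : (t + 1) * (t ^+ 2 - 4 * t + 1) = (1 - t ^+ 2) *
     ((1 - 2 * t / (1 - t ^+ 2) * t) - (2 * t / (1 - t ^+ 2) + t)) by field.
  by rewrite -h subrr mulr0.
move=> /eqP; rewrite mulf_eq0 => /orP[/eqP|/eqP q]; first by lra.
have : Num.sqrt ((2 - t) ^+ 2) = Num.sqrt 3 by congr Num.sqrt; lra.
by rewrite sqrtr_sqr ger0_norm; lra.
Qed.

(** The chord from 0 to 1/6, where [htan] equals tan(pi/12). *)
Lemma htan_le_linear r : 0 < r -> r < 1 / 6 -> htan r <= 6 * (2 - Num.sqrt 3) * r.
Proof.
move=> r0 r6; have p0 := @pi_gt0 R.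
have := tan_convex (pi / 2 * r) (pi / 12); rewrite tan_pi_12 -/(htan r) => h.
have h1 : 0 < pi / 2 * r by rewrite mulr_gt0//; lra.
have h2 : pi / 2 * r < pi / 12.
  have -> : pi / 12 = pi / 2 * (1 / 6) :> R by field.
  by rewrite ltr_pM2l//; lra.
have h3 : pi / 12 < pi / 2 :> R by lra.
have {h1 h2 h3} := h h1 h2 h3.
by move=> {}h; rewrite -(ler_pM2l p0); lra.
Qed.

Lemma htan_continuous r : 0 <= r < 1 -> {for r, continuous htan}.
Proof.
move=> /half_lt h; apply: (@continuous_comp _ _ _ (fun x => pi / 2 * x) tan).
  exact: mulrl_continuous.
by apply: continuous_tan; rewrite gt_eqF// cos_pos.
Qed.

Lemma htanE r : 0 < r < 1 -> htan r = (1 - cos (pi * r)) / sin (pi * r).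
Proof.
move=> /andP[r0 r1].
have /half_lt h : 0 <= r < 1 by rewrite ltW.
have cp := cos_pos _ h.
have sp : 0 < sin (pi / 2 * r).
  have p0 := @pi_gt0 R; apply: sin_gt0_pihalf; move: h => /andP[_ ->].
  by rewrite mulr_gt0//; lra.
have -> : pi * r = pi / 2 * r *+ 2 by rewrite mulr2n; field.
rewrite sin_mulr2n cos_mulr2n /htan /tan cos2sin2; move: cp sp.
set x := pi / 2 * r => cp sp; rewrite !mulr2n; field.
by rewrite !gt_eqF// addr_gt0// mulr_gt0.
Qed.

Lemma fundamental_pair_sin (k : R) : k != 0 ->
  fundamental_pair (k ^+ 2) (fun x => sin (k * x) / k) (fun x => cos (k * x)).
Proof.
move=> k0; split.
- by rewrite mulr0 sin0 mul0r.
- by rewrite mulr0 cos0.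
- by move=> x; rewrite -(cos2Dsin2 (k * x)); field.
- have ck : continuous (fun x : R => cos (k * x)).
    move=> x; apply: (@continuous_comp _ _ _ (fun x => k * x) cos).
      exact: mulrl_continuous.
    exact: continuous_cos.
  have sk : continuous (fun x : R => sin (k * x)).
    move=> x; apply: (@continuous_comp _ _ _ (fun x => k * x) sin).
      exact: mulrl_continuous.
    exact: continuous_sin.
  move=> l l0; split; apply: primitive_on_derive => //.
    move=> x; apply: is_derive_eq; rewrite /GRing.scale/=; field; exact: k0.
  + move=> x; apply: is_derive_eq; rewrite /GRing.scale/=; field; exact: k0.
  + move=> x; apply: cvgM; first exact: cvg_cst.
    by apply: cvgM; [exact: sk|exact: cvg_cst].
Qed.

Lemma fundamental_pair_linear : fundamental_pair 0 (fun x : R => x) (fun=> 1).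
Proof.
split=> //; first by move=> x; rewrite mul0r addr0 expr1n.
move=> l l0; split; last first.
  apply: primitive_on_eq (primitive_on_cst l 1 l0) => // x _.
  by rewrite oppr0 mul0r.
by apply: primitive_on_derive => // x; exact: cst_continuous.
Qed.

End HalfTangent.

Section RectangularLattice.
Context {R : realType} {d : nat} {gamma a alpha : R}.
Hypothesis d_ge2 : (2 <= d)%N.
Hypothesis gamma_gt0 : 0 < gamma.
Hypothesis a_gt0 : 0 < a.
Hypothesis alpha_gt0 : 0 < alpha.
Local Notation len := (@rect_len R d gamma a).

Definition energy (y : R) : R := (y * pi / a) ^+ 2.

(* With k = pi y / a and m0, m1 the integer parts of gamma y and y, the energy k^2
   lies in a gap exactly when this is below alpha a / (2 pi). *)
Definition band_fun (m0 m1 : nat) (y : R) : R :=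
  y * (htan (gamma * y - m0%:R) + d.-1%:R * htan (y - m1%:R)).

Lemma rect_len_gt0 (j : 'I_d) : 0 < len j.
Proof. by rewrite /rect_len; case: ifP => // _; exact: mulr_gt0. Qed.

Lemma sum_rect_len (F : R -> R) :
  \sum_(j < d) F (len j) = F (gamma * a) + d.-1%:R * F a.
Proof.
case: d d_ge2 => // n _; rewrite big_ord_recl /rect_len/=; congr (_ + _).
by rewrite (eq_bigr (fun=> F a))// sumr_const card_ord mulr_natl.
Qed.

(** The sign (-1)^m cancels in the quotient and under the modulus, leaving (1 - cos) / sin of the
    fractional part, a half angle tangent. *)
Lemma sin_cos_frac (x : R) (m : nat) : 0 < x - m%:R < 1 ->
  sin (pi * x) != 0 /\
  `|sin (pi * x)|^-1 - cos (pi * x) / sin (pi * x) = htan (x - m%:R).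
Proof.
move=> xm; set r := x - m%:R in xm *.
have -> : pi * x = pi * r + pi *+ m by rewrite /r -mulr_natr; ring.
rewrite (alternatingn (@sinDpi R)) (alternatingn (@cosDpi R)).
have sp : 0 < sin (pi * r).
  have p0 := pi_gt0 R; apply: sin_gt0_pi; case/andP: xm => r0 r1.
  by rewrite mulr_gt0//= gtr_pMr.
have s0 : (-1) ^+ m != 0 :> R by rewrite expf_neq0// oppr_eq0 oner_eq0.
split; first by rewrite mulf_neq0// gt_eqF.
rewrite normrM normrX normrN1 expr1n mul1r (gtr0_norm sp) htanE//.
by field; rewrite s0 gt_eqF.
Qed.

Section Frequency.
Variables (y : R) (m0 m1 : nat).
Hypothesis y_gt0 : 0 < y.
Hypothesis frac0 : 0 < gamma * y - m0%:R < 1.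
Hypothesis frac1 : 0 < y - m1%:R < 1.

Let k : R := y * pi / a.
Let S (x : R) := sin (k * x) / k.
Let C (x : R) := cos (k * x).

Let k_gt0 : 0 < k.
Proof. by rewrite /k divr_gt0// mulr_gt0// pi_gt0. Qed.

Let SC : fundamental_pair (energy y) S C.
Proof. by apply: fundamental_pair_sin; rewrite gt_eqF. Qed.

Let k_gamma : k * (gamma * a) = pi * (gamma * y).
Proof. by rewrite /k; field; rewrite gt_eqF. Qed.

Let k_a : k * a = pi * y.
Proof. by rewrite /k; field; rewrite gt_eqF. Qed.

Let S_neq0 j : S (len j) != 0.
Proof.
apply: mulf_neq0; last by rewrite invr_eq0 gt_eqF.
rewrite /rect_len; case: ifP => _; rewrite ?k_gamma ?k_a.
  by have [] := sin_cos_frac _ _ frac0.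
by have [] := sin_cos_frac _ _ frac1.
Qed.

(** Twice this is the excess of the weights over the diagonal without its [alpha], so diagonal
    dominance becomes a comparison of [alpha] with 2 pi / a times [band_fun]. *)
Let weights_sum :
  \sum_j `|weight_S len S j| - \sum_j C (len j) / S (len j) =
  pi / a * band_fun m0 m1 y.
Proof.
rewrite -sumrB (sum_rect_len (fun l => `|(S l)^-1| - C l / S l)).
have e l : `|(S l)^-1| - C l / S l = k * (`|sin (k * l)|^-1 - cos (k * l) / sin (k * l)).
  by rewrite /S /C invf_div normf_div (gtr0_norm k_gt0); ring.
rewrite !e k_gamma k_a (sin_cos_frac _ _ frac0).2 (sin_cos_frac _ _ frac1).2.
by rewrite /band_fun /k; ring.
Qed.

Let symbolE : symbol_const len alpha S C = alpha + 2 * \sum_j C (len j) / S (len j).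
Proof. by rewrite /symbol_const mulr_sumr. Qed.

Let rescale (P : R) : 0 < P -> alpha = 2 * (P / a * (alpha * a / (2 * P))).
Proof. by move=> P0; field; rewrite !gt_eqF. Qed.

Let j0 : 'I_d := Ordinal (ltnW d_ge2).

Lemma gap_resolvent : band_fun m0 m1 y < alpha * a / (2 * pi) ->
  resolvent len alpha (energy y).
Proof.
move=> gap; apply: (resolvent_criterion _ _ _ _ _ rect_len_gt0 SC j0 S_neq0).
rewrite symbolE; apply: lt_le_trans (ler_norm _).
have p0 := pi_gt0 R.
have : 2 * (pi / a * band_fun m0 m1 y) < alpha.
  have -> : alpha = 2 * (pi / a * (alpha * a / (2 * pi))) by exact: rescale.
  by rewrite ltr_pM2l// ltr_pM2l// divr_gt0.
by rewrite -weights_sum; lra.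
Qed.

Lemma band_spectrum : alpha * a / (2 * pi) <= band_fun m0 m1 y ->
  spectrum len alpha (energy y).
Proof.
move=> band; apply: (spectrum_band _ _ _ _ _ rect_len_gt0 SC j0 S_neq0).
rewrite symbolE ler_norml.
have p0 := pi_gt0 R.
have : alpha <= 2 * (pi / a * band_fun m0 m1 y).
  have -> : alpha = 2 * (pi / a * (alpha * a / (2 * pi))) by exact: rescale.
  by rewrite ler_pM2l// ler_pM2l// divr_gt0.
(* The lower half of the band condition is automatic, as |cos| <= 1 and [alpha] is positive. *)
have : - \sum_j `|weight_S len S j| <= \sum_j C (len j) / S (len j).
  rewrite -sumrN; apply: ler_sum => j _; rewrite lerNl.
  apply: le_trans (ler_norm _) _; rewrite normrN normrM.
  by rewrite ler_piMl// cos_max.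
rewrite -weights_sum => h1 h2; have key (X Y A : R) : - X <= Y -> A <= 2 * (X - Y) ->
    0 < A -> - (2 * X) <= A + 2 * Y <= 2 * X by move=> *; apply/andP; split; lra.
exact: key.
Qed.

End Frequency.

Lemma integer_spectrum (m : nat) : (0 < m)%N -> spectrum len alpha (energy m%:R).
Proof.
move=> m_gt0; pose k : R := m%:R * pi / a.
have k0 : k != 0 by rewrite !mulf_neq0 ?invr_eq0 ?gt_eqF ?ltr0n ?pi_gt0.
(* The direction of index 1, which exists since d >= 2 and has edge length [a]; index 0 has length
   [gamma * a]. *)
apply: (spectrum_flat _ _ _ _ _ rect_len_gt0 (fundamental_pair_sin k k0) (Ordinal d_ge2)).
rewrite /rect_len/= (_ : k * a = pi *+ m); last first.
  by rewrite /k divfK ?gt_eqF// mulr_natl.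
by rewrite -[_ *+ _]add0r (alternatingn (@sinDpi R)) sin0 mulr0 mul0r.
Qed.

(** Excludes k = 0 as an endpoint: with S(x) = x and C = 1 the diagonal exceeds the weights by
    exactly [alpha]. *)
Lemma zero_resolvent : resolvent len alpha 0.
Proof.
apply: (resolvent_criterion _ _ _ _ _ rect_len_gt0 fundamental_pair_linear (Ordinal (ltnW d_ge2))).
  by move=> j; rewrite gt_eqF// rect_len_gt0.
apply: lt_le_trans (ler_norm _).
rewrite /symbol_const mulr_sumr (eq_bigr (fun j => 2 * (1 / len j))).
  by rewrite ltrDr.
move=> j _; rewrite /weight_S gtr0_norm ?div1r// invr_gt0.
exact: rect_len_gt0.
Qed.

End RectangularLattice.

(** * Gap endpoints within the window for the coupling *)

Section GapEndpoints.
Context {R : realType} {d : nat} {c : nat -> nat} {gamma a alpha : R}.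
Hypothesis c0 : c 0%N = 0%N.
Hypothesis c1 : c 1%N = 1%N.
Hypothesis c_even : forall n, (1 <= n)%N -> c (2 * n)%N = 1%N.
Hypothesis c_odd : forall n, c (2 * n).+1 = 1%N \/ c (2 * n).+1 = 2%N.
Hypothesis cf_gamma : has_cf_expansion gamma c.
Hypothesis d_ge2 : (2 <= d)%N.
Hypothesis a_gt0 : 0 < a.
Hypothesis alpha_ge : 4 * pi * (2 - Num.sqrt 3) / a <= alpha.
Hypothesis alpha_le : alpha <= 2 * pi ^+ 2 / (5 * a).
Local Notation g := (@band_fun R d gamma).
Local Notation len := (@rect_len R d gamma a).

Let A : R := alpha * a / (2 * pi).

Let pi0 : 0 < pi :> R := pi_gt0 R.

Let A_ge : 2 * (2 - Num.sqrt 3) <= A.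
Proof.
rewrite /A ler_pdivlMr ?mulr_gt0//; move: alpha_ge; rewrite ler_pdivrMr//.
lra.
Qed.

Let A_le : A <= pi / 5.
Proof.
rewrite /A ler_pdivrMr ?mulr_gt0//; move: alpha_le; rewrite ler_pdivlMr ?mulr_gt0//.
lra.
Qed.

Let sqrt3_lt2 : Num.sqrt 3 < 2 :> R.
Proof.
have -> : 2 = Num.sqrt (2 ^+ 2) :> R by rewrite sqrtr_sqr ger0_norm.
by rewrite ltr_sqrt ?exprn_gt0//; lra.
Qed.

Let A_gt0 : 0 < A. Proof. by have := A_ge; have := sqrt3_lt2; lra. Qed.

Let A_lt1 : A < 1.
Proof. by have := A_le; have := @pihalf_lt2 R; lra. Qed.

Let alpha_gt0 : 0 < alpha.
Proof.
have pp : 0 < 2 * pi :> R by rewrite mulr_gt0.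
have := mulr_gt0 A_gt0 pp; rewrite /A divfK ?gt_eqF//.
by rewrite pmulr_lgt0.
Qed.

Let gamma_gt0 : 0 < gamma.
Proof. by have /andP[] := gamma_bounds c0 c1 c_even c_odd cf_gamma. Qed.

Let gamma_le : gamma <= 5 / 8.
Proof. by have /andP[] := gamma_bounds c0 c1 c_even c_odd cf_gamma. Qed.

(** Monotonicity of g(x) / x, the sum of tangents, with denominators cleared; the extra factor gives
    strictness when x < y. *)
Let band_fun_le (m0 m1 : nat) (x y : R) : 0 < x -> x <= y ->
  0 <= gamma * x - m0%:R -> gamma * y - m0%:R < 1 ->
  0 <= x - m1%:R -> y - m1%:R < 1 ->
  0 <= g m0 m1 x /\ y * g m0 m1 x <= x * g m0 m1 y.
Proof.
move=> x0 xy h1 h2 h3 h4.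
have gxy : gamma * x <= gamma * y by rewrite ler_pM2l.
have t0 : htan (gamma * x - m0%:R) <= htan (gamma * y - m0%:R).
  by apply: htan_le => //; lra.
have t1 : htan (x - m1%:R) <= htan (y - m1%:R) by apply: htan_le => //; lra.
have p0 : 0 <= htan (gamma * x - m0%:R) by apply: htan_ge0; apply/andP; split; lra.
have p1 : 0 <= htan (x - m1%:R) by apply: htan_ge0; apply/andP; split; lra.
have s : htan (gamma * x - m0%:R) + d.-1%:R * htan (x - m1%:R) <=
    htan (gamma * y - m0%:R) + d.-1%:R * htan (y - m1%:R).
  by rewrite lerD// ler_wpM2l.
have s0 : 0 <= htan (gamma * x - m0%:R) + d.-1%:R * htan (x - m1%:R).
  by rewrite addr_ge0// mulr_ge0.
have y0 : 0 < y by exact: lt_le_trans xy.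
rewrite /band_fun; split; first by rewrite mulr_ge0// ltW.
by rewrite mulrCA ler_pM2l// ler_pM2l.
Qed.

Let energy_lt (x y : R) : 0 < x -> x < y -> energy (a := a) x < energy (a := a) y.
Proof.
move=> x0 xy; have k0 : 0 < x * pi / a by rewrite divr_gt0// mulr_gt0.
have kxy : x * pi / a < y * pi / a by rewrite ltr_pM2r ?invr_gt0// ltr_pM2r.
by rewrite /energy ltrXn2r// ?nnegrE ltW// (lt_trans k0).
Qed.

Let energy_inv (e : R) : 0 < e -> exists2 y, 0 < y & e = energy (a := a) y.
Proof.
move=> e0; exists (Num.sqrt e * a / pi).
  by rewrite divr_gt0// mulr_gt0// sqrtr_gt0.
by rewrite /energy divfK ?gt_eqF// mulfK ?gt_eqF// sqr_sqrtr// ltW.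
Qed.

Let energy_lt_inv (x y : R) : 0 < x -> 0 < y ->
  energy (a := a) x < energy (a := a) y -> x < y.
Proof.
move=> x0 y0; apply: contraTT; rewrite -!leNgt le_eqVlt => /predU1P[->//|yx].
by rewrite ltW// energy_lt.
Qed.

Lemma endpoint_is_convergent (k E2 : R) :
  spectral_gap len alpha (k ^+ 2) E2 ->
  exists n, c (2 * n).+1 = 2%N /\ k ^+ 2 = energy (a := a) (cf_den c (2 * n))%:R.
Proof.
move=> [kE2 [sk [sE2 gap]]].
have k20 : 0 < k ^+ 2.
  rewrite lt_def sqr_ge0 andbT; apply/eqP => k0; apply: sk; rewrite k0.
  exact: zero_resolvent.
have [y y0 ky] := energy_inv _ k20; rewrite ky in kE2 sk gap *.
have [y2 y20 E2y] := energy_inv _ (lt_trans k20 (eq_ind_r (fun z => z < E2) kE2 ky)).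
rewrite {}E2y in kE2 gap sE2.
have yy2 := energy_lt_inv _ _ y0 y20 kE2.
pose m0 := Num.truncn (gamma * y); pose m1 := Num.truncn y.
have gy0 : 0 < gamma * y by exact: mulr_gt0.
have /andP[m0l m0u] : m0%:R <= gamma * y < m0.+1%:R by rewrite truncn_itv ?ltW.
have /andP[m1l m1u] : m1%:R <= y < m1.+1%:R by rewrite truncn_itv ?ltW.
rewrite -[m0.+1]addn1 natrD in m0u; rewrite -[m1.+1]addn1 natrD in m1u.
(* Otherwise monotonicity keeps g above A up to the next jump, which puts a point of the spectrum
   inside the gap. *)
have small : g m0 m1 y < A.
  rewrite ltNge; apply/negP => Ag.
  pose u := Num.min y2 (Num.min (m1%:R + 1) ((m0%:R + 1) / gamma)).
  have yu : y < u by rewrite !lt_min yy2 m1u ltr_pdivlMr// mulrC.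
  pose x := (y + u) / 2.
  have yx : y < x by rewrite /x; lra.
  have xu : x < u by rewrite /x; lra.
  have x0 := lt_trans y0 yx.
  have : u <= u by []; rewrite {2}/u !le_min => /andP[u1 /andP[u2 u3]].
  have gx : gamma * x < m0%:R + 1.
    by rewrite mulrC -ltr_pdivlMr// (lt_le_trans xu).
  have gyx : gamma * y < gamma * x by rewrite ltr_pM2l.
  have [g0 gm] : 0 <= g m0 m1 y /\ x * g m0 m1 y <= y * g m0 m1 x.
    by apply: band_fun_le; rewrite ?(ltW yx)//; lra.
  apply: (gap (energy (a := a) x)).
    by rewrite !energy_lt//; lra.
  apply: (band_spectrum d_ge2 gamma_gt0 a_gt0 alpha_gt0 x m0 m1 x0).
  - by apply/andP; split; lra.
  - by apply/andP; split; lra.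
  - apply: (le_trans Ag); rewrite -(ler_pM2l y0); apply: le_trans gm.
    by rewrite ler_wpM2r// ltW.
(* In the spectrum with g below A, [y] must be a jump. At y = m1 one tangent vanishes, and htan r >=
   pi r / 2 with A <= pi / 5 gives m1 (gamma m1 - m0) < 2/5. *)
have [ym1|ym1] := eqVneq y m1%:R.
  have m1pos : (0 < m1)%N by rewrite -(ltr0n R) -ym1.
  move: small; rewrite /band_fun {3}ym1 subrr htan0 mulr0 addr0 => small.
  have lin : pi / 2 * (gamma * y - m0%:R) <= htan (gamma * y - m0%:R).
    by apply: htan_ge_linear; apply/andP; split; lra.
  have lin' := le_lt_trans (ler_wpM2l (ltW y0) lin) small.
  have [||n [cn m1E]] := lower_approx c0 c1 c_even c_odd cf_gamma m1 m0 m1pos.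
  + by rewrite -ym1 mulrC; lra.
  + rewrite -ym1 (mulrC y gamma) -(ler_pM2l pi0).
    by have := A_le; lra.
  + by exists n; split => //; rewrite {1}ym1 m1E.
have m1lt : m1%:R < y by rewrite lt_neqAle eq_sym ym1.
have [gm0|gm0] := eqVneq (gamma * y) m0%:R; last first.
  have m0lt : m0%:R < gamma * y by rewrite lt_neqAle eq_sym gm0.
  exfalso; apply: sk; apply: (gap_resolvent d_ge2 gamma_gt0 a_gt0 y m0 m1 y0) => //.
    by apply/andP; split; lra.
  by apply/andP; split; lra.
(* At the jump gamma y = m0 the same linear bound gives m1 (m0 - m1 gamma) < 2/5 gamma <= 1/4, below
   the 1/3 of [upper_approx]. *)
exfalso; move: small; rewrite /band_fun gm0 subrr htan0 add0r => small.
have lin : pi / 2 * (y - m1%:R) <= htan (y - m1%:R).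
  by apply: htan_ge_linear; apply/andP; split; lra.
have d1 : 1 <= d.-1%:R :> R by rewrite ler1n -subn1 subn_gt0.
have m0pos : 1 <= m0%:R :> R by rewrite ler1n -(ltr0n R) -gm0.
have y1 : 1 < y by rewrite -(ltr_pM2l gamma_gt0); have := gamma_le; lra.
have m1pos : (0 < m1)%N by rewrite -(ltr_nat R) -(ltrD2r 1) add0r (lt_trans y1).
have low := upper_approx c0 c1 c_even c_odd cf_gamma m1 m0 m1pos.
have e : m0%:R - m1%:R * gamma = gamma * (y - m1%:R) by rewrite -gm0; ring.
have e0 : 0 < gamma * (y - m1%:R) by rewrite mulr_gt0// subr_gt0.
rewrite e in low; have {}low := low e0.
have r0 : 0 < y - m1%:R by lra.
have t0 : 0 < htan (y - m1%:R) by apply: lt_le_trans lin; rewrite mulr_gt0// divr_gt0.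
have b1 : y * (pi / 2 * (y - m1%:R)) < pi / 5.
  apply: lt_le_trans A_le; apply: le_lt_trans small; rewrite ler_pM2l//.
  by apply: le_trans lin _; rewrite ler_peMl// ltW.
have b2 : y * (y - m1%:R) < 2 / 5 by rewrite -(ltr_pM2l pi0); lra.
have b3 : m1%:R * (y - m1%:R) < 2 / 5.
  by apply: le_lt_trans b2; rewrite ler_wpM2r// ltW.
have := ltr_pM2l gamma_gt0 (m1%:R * (y - m1%:R)) (2 / 5); rewrite b3 => b4.
by have := gamma_le; lra.
Qed.

Lemma convergent_is_endpoint (n : nat) : c (2 * n).+1 = 2%N ->
  exists E2, spectral_gap len alpha (energy (a := a) (cf_den c (2 * n))%:R) E2.
Proof.
move=> cn; set q := cf_den c (2 * n); pose p := cf_num c (2 * n).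
have [ub q2] := err_den_even_ub c1 c_even c_odd cf_gamma n cn.
have dl0 := cf_err_gt0 cf_gamma (2 * n).
have dlE : @cf_err R c gamma (2 * n) = gamma * q%:R - p%:R.
  by rewrite /cf_err exprM sqrrN !expr1n mul1r mulrC.
rewrite dlE -/q in ub dl0; rewrite -/q in q2.
have q0 : 0 < q%:R :> R by lra.
(* From q >= 2 and the product bound 10/31 the error is at most 5/31, inside the range of the chord
   bound. *)
have dl6 : gamma * q%:R - p%:R < 1 / 6.
  have := ler_wpM2r (ltW dl0) q2; lra.
(* The chord bound gives at most 60/31 (2 - sqrt 3), just below 2 (2 - sqrt 3), the lower end of the
   window for A. *)
have gq : g p q q%:R < A.
  rewrite /band_fun subrr htan0 mulr0 addr0.
  have h := htan_le_linear _ dl0 dl6.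
  apply: (@lt_le_trans _ _ (2 * (2 - Num.sqrt 3))) => //.
  apply: le_lt_trans (ler_wpM2l (ltW q0) h) _.
  have s3 : 0 < 2 - Num.sqrt 3 :> R by rewrite subr_gt0.
  have := ler_wpM2l (ltW s3) ub; lra.
(* The first point where one fractional part reaches 1/2: its tangent is 1 there, so g >= y1 >= 1 >
   A, while both arguments stay away from the pole. *)
pose y1 := Num.min (q%:R + 1 / 2) ((p%:R + 1 / 2) / gamma).
have qy1 : q%:R < y1.
  by rewrite lt_min ltr_pdivlMr// mulrC; apply/andP; split; lra.
have /andP[y1a y1b] : (y1 <= q%:R + 1 / 2) && (y1 <= (p%:R + 1 / 2) / gamma).
  by rewrite -le_min.
have {}y1b : gamma * y1 <= p%:R + 1 / 2 by rewrite mulrC -ler_pdivlMr.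
have frac y : q%:R <= y -> y <= y1 ->
    (0 <= gamma * y - p%:R < 1) /\ (0 <= y - q%:R < 1).
  move=> qy yy1; have h1 : gamma * q%:R <= gamma * y by rewrite ler_pM2l.
  have h2 : gamma * y <= gamma * y1 by rewrite ler_pM2l.
  by split; apply/andP; split; lra.
have g1 : A <= g p q y1.
  apply: (@le_trans _ _ 1); first exact: ltW A_lt1.
  have [f0 f1] := frac y1 (ltW qy1) (lexx _).
  have t0 := htan_ge0 _ f0; have t1 := htan_ge0 _ f1.
  have d1 : 1 <= d.-1%:R :> R by rewrite ler1n -subn1 subn_gt0.
  have y11 : 1 <= y1 by lra.
  have dt : htan (y1 - q%:R) <= d.-1%:R * htan (y1 - q%:R) by rewrite ler_peMl.
  suff T1 : 1 <= htan (gamma * y1 - p%:R) + d.-1%:R * htan (y1 - q%:R).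
    by apply: (le_trans T1); rewrite ler_peMl// (le_trans ler01).
  have : y1 = q%:R + 1 / 2 \/ y1 = (p%:R + 1 / 2) / gamma.
    by rewrite /y1; case: leP => _; [left|right].
  case=> e.
    have : htan (y1 - q%:R) = 1 by rewrite -[RHS]htan_half; congr htan; rewrite e; ring.
    by lra.
  have : htan (gamma * y1 - p%:R) = 1.
    by rewrite -[RHS]htan_half; congr htan; rewrite e mulrC divfK ?gt_eqF//; ring.
  have := mulr_ge0 (le_trans ler01 d1) t1; lra.
have cg : {within `[q%:R, y1], continuous (g p q)}.
  apply: continuous_in_subspaceT => y; rewrite inE/= in_itv/= => /andP[qy yy1].
  have [f0 f1] := frac y qy yy1.
  rewrite /band_fun; apply: cvgM; first exact: cvg_id.
  apply: cvgD.
    apply: (@continuous_comp _ _ _ (fun y => gamma * y - p%:R) htan).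
      by apply: cvgB; [exact: mulrl_continuous|exact: cvg_cst].
    exact: htan_continuous.
  apply: cvgM; first exact: cvg_cst.
  apply: continuous_cvg; first exact: htan_continuous.
  by apply: cvgB; [exact: cvg_id|exact: cvg_cst].
(* The crossing gives the upper end of the gap: by monotonicity g stays below A strictly between q
   and x. *)
have [x + gx] : exists2 x, x \in `[q%:R, y1] & g p q x = A.
  apply: IVT => //; first exact: ltW.
  by rewrite ge_min le_max (ltW gq) g1 orbT.
rewrite in_itv/= => /andP[qx xy1].
have {}qx : q%:R < x.
  by rewrite lt_neqAle qx andbT; apply/eqP => e; move: gq; rewrite e gx ltxx.
have x0 := lt_trans q0 qx.
have frac' y : q%:R < y -> y <= y1 ->
    (0 < gamma * y - p%:R < 1) /\ (0 < y - q%:R < 1).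
  move=> qy yy1; have [/andP[_ h1] /andP[_ h2]] := frac y (ltW qy) yy1.
  have h3 : gamma * q%:R < gamma * y by rewrite ltr_pM2l.
  by split; apply/andP; split; lra.
exists (energy (a := a) x); split; first exact: energy_lt.
split.
  apply: (integer_spectrum d_ge2 gamma_gt0 a_gt0).
  by rewrite -(ltr0n R).
split.
  have [f0 f1] := frac' x qx xy1.
  apply: (band_spectrum d_ge2 gamma_gt0 a_gt0 alpha_gt0 x p q x0 f0 f1).
  by rewrite gx.
move=> e /andP[e1 e2] spec; apply: spec.
have epos : 0 < e.
  by apply: lt_trans e1; rewrite exprn_gt0// divr_gt0// mulr_gt0.
have [y y0 ey] := energy_inv _ epos; rewrite ey in e1 e2 *.
have qy := energy_lt_inv _ _ q0 y0 e1; have yx := energy_lt_inv _ _ y0 x0 e2.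
have [f0 f1] := frac' y qy (le_trans (ltW yx) xy1).
have [fx0 fx1] := frac' x qx xy1.
apply: (gap_resolvent d_ge2 gamma_gt0 a_gt0 y p q y0 f0 f1).
have [gy0 gyx] : 0 <= g p q y /\ x * g p q y <= y * g p q x.
  move: f0 f1 fx0 fx1 => /andP[? ?] /andP[? ?] /andP[? ?] /andP[? ?].
  by apply: band_fun_le; rewrite ?(ltW yx)//; lra.
rewrite -(ltr_pM2l x0); apply: le_lt_trans gyx _.
by rewrite gx ltr_pM2r.
Qed.

End GapEndpoints.

Theorem theorem5p5 (R : realType) (c : nat -> nat) (gamma : R)
    (d : nat) (a alpha : R) :
  c 0%N = 0%N ->
  c 1%N = 1%N ->
  (forall n, (1 <= n)%N -> c (2 * n)%N = 1%N) ->
  (forall n, c (2 * n).+1 = 1%N \/ c (2 * n).+1 = 2%N) ->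
  has_cf_expansion gamma c ->
  (2 <= d)%N ->
  0 < a ->
  4 * pi * (2 - Num.sqrt 3) / a <= alpha ->
  alpha <= 2 * pi ^+ 2 / (5 * a) ->
  forall k : R,
    (exists E2 : R, spectral_gap (@rect_len R d gamma a) alpha (k ^+ 2) E2) <->
    (exists n : nat, c (2 * n).+1 = 2%N /\
       k ^+ 2 = ((cf_q c (2 * n)%N)%:~R * pi / a) ^+ 2).
Proof.
move=> c0 c1 ce co cf d2 a0 al au k.
have qE n : (cf_q c (2 * n))%:~R = (cf_den c (2 * n))%:R :> R.
  by rewrite cf_qE; [|exact: cf.1].
split=> [[E2 gap]|[n [cn kE]]].
  have [n [cn kE]] := endpoint_is_convergent c0 c1 ce co cf d2 a0 al au k E2 gap.
  by exists n; rewrite qE.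
rewrite kE qE; exact: convergent_is_endpoint c0 c1 ce co cf d2 a0 al au n cn.
Qed.
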